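(* Suppose $(A,C)$ is detectable and $P_0>0$, $P_0'>0$ (positive definite). Then there is a matrix $P_\infty$ such that $P_t\to P_\infty$ and $P_t'\to P_\infty$ as $t\to\infty$, and $\mathbf{E}\|\hat X_t-\hat X_t'\|\to0$ as $t\to\infty$.
   Context: Consider the linear signal-observation model $$dX_t=AX_t\,dt+B\,dW_t,\qquad dY_t=CX_t\,dt+dB_t,$$ where $A,B,C$ are (constant) $n\times n$, $n\times m$ and $p\times n$ matrices, $W_t$ and $B_t$ are independent standard Wiener processes (of dimensions $m$ and $p$), $Y_0=0$, and $X_0$ is Gaussian with mean $\hat X_0$ and covariance matrix $P_0$, independent of $W,B$. $\mathbf{E}$ is expectation under this model. With $\mathscr{F}_t^Y=\sigma\{Y_s:s\le t\}$, the filtered estimate $\hat X_t=\mathbf{E}(X_t|\mathscr{F}_t^Y)$ and covariance $P_t=\mathbf{E}((X_t-\hat X_t)(X_t-\hat X_t)^* )$ satisfy the Kalman filtering and Riccati equations $$d\hat X_t=A\hat X_t\,dt+P_tC^*(dY_t-C\hat X_t\,dt),\qquad \frac{dP_t}{dt}=AP_t+P_tA^*+BB^*-P_tC^*CP_t.$$ $\hat X_t'$, $P_t'$ denote the solutions of the same two equations (driven by the same $Y_t$, with $P_t'$ in place of $P_t$ in the first) started from (possibly incorrect) initial conditions $\hat X_0'$ (a deterministic vector) and $P_0'$ (a symmetric matrix). The pair $(A,C)$ is detectable if there exists an $n\times p$ matrix $K$ such that all eigenvalues of $A-KC$ have strictly negative real parts. *)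

(* Defs.v *)
From HB Require Import structures.
From mathcomp Require Import all_boot all_order all_algebra.
From mathcomp Require Import complex.
From mathcomp Require Import all_classical all_reals all_analysis.

Set Implicit Arguments.
Unset Strict Implicit.
Unset Printing Implicit Defensive.

Import Order.TTheory GRing.Theory Num.Theory.
Import numFieldNormedType.Exports.

Local Open Scope classical_set_scope.
Local Open Scope ring_scope.

Section LinearAlgebra.
Context {R : realType}.

Definition dotv k (x y : 'cV[R]_k) : R := (x^T *m y) 0 0.

Definition enorm k (x : 'cV[R]_k) : R := Num.sqrt (dotv x x).

Definition pos_semidef k (S : 'M[R]_k) : Prop :=
  S^T = S /\ forall x : 'cV[R]_k, 0 <= dotv x (S *m x).

Definition pos_def k (S : 'M[R]_k) : Prop :=
  S^T = S /\ forall x : 'cV[R]_k, x != 0 -> 0 < dotv x (S *m x).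

(* Eigenvalues are taken in R[i], the complex numbers over R. *)
Definition stable k (M : 'M[R]_k) : Prop :=
  forall l : R[i], eigenvalue (map_mx (real_complex R) M) l -> complex.Re l < 0.

Definition detectable n p (A : 'M[R]_n) (C : 'M[R]_(p, n)) : Prop :=
  exists K : 'M[R]_(n, p), stable (A - K *m C).

Definition vintegral k (f : R -> 'cV[R]_k) (t : R) : 'cV[R]_k :=
  \col_i \int[lebesgue_measure]_(s in `[0, t]) f s i 0.

(* Only the values on [0, +oo[ of functions of time are meaningful; at time 0
   a solution is required to be right-continuous. *)
Definition riccati_solution n m p (A : 'M[R]_n) (B : 'M[R]_(n, m))
    (C : 'M[R]_(p, n)) (S0 : 'M[R]_n) (S : R -> 'M[R]_n) : Prop :=
  [/\ S 0 = S0,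
      {within `[0, +oo[, continuous S} &
      forall (t : R) (i j : 'I_n), 0 < t ->
        is_derive t 1 (fun s => S s i j)
          ((A *m S t + S t *m A^T + B *m B^T - S t *m C^T *m C *m S t) i j)].

End LinearAlgebra.

Section Processes.
Context {d : measure_display} {T : measurableType d} {R : realType}.
Variable mu : probability T R.

Definition random_vector k (Z : T -> 'cV[R]_k) : Prop :=
  forall i, measurable_fun setT (fun w => Z w i 0).

Definition continuous_process k (Z : R -> T -> 'cV[R]_k) : Prop :=
  (forall t, 0 <= t -> random_vector (Z t)) /\
  (\forall w \ae mu, {within `[0, +oo[, continuous (fun t => Z t w)}).

Definition sigma_process k (D : set R) (Z : R -> T -> 'cV[R]_k)
    : set (set T) :=
  <<s [set E | exists t (i : 'I_k) (U : set R),
        [/\ D t, measurable U & E = (fun w => Z t w i 0) @^-1` U]] >>.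

Definition independent2 (F G : set (set T)) : Prop :=
  forall E E', F E -> G E' -> mu (E `&` E') = (mu E * mu E')%E.

Definition independent3 (F G H : set (set T)) : Prop :=
  forall E E' E'', F E -> G E' -> H E'' ->
    mu (E `&` E' `&` E'') = (mu E * mu E' * mu E'')%E.

(* The one-dimensional Gaussian law of mean a and variance v >= 0.  The library
   measure normal_prob takes the standard deviation, and for deviation 0 it is
   not the Dirac mass. *)
Definition gaussian_law (a v : R) (U : set R) : \bar R :=
  if v == 0 then (\d_a U)%E else normal_prob a (Num.sqrt v) U.

Definition gaussian_vector k (Z : T -> 'cV[R]_k) (a : 'cV[R]_k) (S : 'M[R]_k)
    : Prop :=
  [/\ random_vector Z, pos_semidef S &
      forall (x : 'cV[R]_k) (U : set R), measurable U ->
        mu ((fun w => dotv x (Z w)) @^-1` U) =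
        gaussian_law (dotv x a) (dotv x (S *m x)) U].

Definition wiener k (W : R -> T -> 'cV[R]_k) : Prop :=
  [/\ continuous_process W,
      \forall w \ae mu, W 0 w = 0,
      forall s t, 0 <= s < t ->
        gaussian_vector (fun w => W t w - W s w) 0 ((t - s)%:M) &
      forall s t, 0 <= s < t ->
        independent2 (sigma_process `[0, s] W)
          (sigma_process [set t] (fun r w => W r w - W s w))].

Definition cond_expectation k (G : set (set T)) (X Z : T -> 'cV[R]_k) : Prop :=
  forall i : 'I_k,
    [/\ mu.-integrable setT (fun w => (X w i 0)%:E),
        mu.-integrable setT (fun w => (Z w i 0)%:E),
        forall U : set R, measurable U -> G ((fun w => Z w i 0) @^-1` U) &
        forall E, G E ->
          (\int[mu]_(w in E) (Z w i 0)%:E = \int[mu]_(w in E) (X w i 0)%:E)%E].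

(* A partition 0 = t_0 < t_1 < ... < t_N = t is given by the list of
   t_1, ..., t_N, as in itv_partition. *)
Definition left_sum n p (H : R -> 'M[R]_(n, p)) (Y : R -> T -> 'cV[R]_p)
    (s : seq R) (w : T) : 'cV[R]_n :=
  \sum_(i < size s) H (nth 0 (0 :: s) i) *m
    (Y (nth 0 (0 :: s) i.+1) w - Y (nth 0 (0 :: s) i) w).

Definition mesh_lt (s : seq R) (delta : R) : Prop :=
  forall i, (i < size s)%N -> nth 0 (0 :: s) i.+1 - nth 0 (0 :: s) i < delta.

(* J is the Ito integral of H dY over [0, t], for a continuous deterministic
   integrand H and a continuous semimartingale Y: the limit in probability of
   the left-endpoint sums as the mesh of the partition tends to 0. *)
Definition ito_integral n p (H : R -> 'M[R]_(n, p)) (Y : R -> T -> 'cV[R]_p)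
    (t : R) (J : T -> 'cV[R]_n) : Prop :=
  random_vector J /\
  forall eps : R, 0 < eps -> exists2 delta : R, 0 < delta &
    forall s : seq R, itv_partition 0 t s -> mesh_lt s delta ->
      (mu [set w | (eps <= enorm (left_sum H Y s w - J w))%R] <= eps%:E)%E.

(* dX = A X dt + B dW,  dY = C X dt + dV,  Y_0 = 0. *)
Definition signal_observation n m p (A : 'M[R]_n) (B : 'M[R]_(n, m))
    (C : 'M[R]_(p, n)) (W : R -> T -> 'cV[R]_m) (V : R -> T -> 'cV[R]_p)
    (X : R -> T -> 'cV[R]_n) (Y : R -> T -> 'cV[R]_p) : Prop :=
  [/\ continuous_process X, continuous_process Y,
      \forall w \ae mu, forall t, 0 <= t ->
        X t w = X 0 w + vintegral (fun s => A *m X s w) t + B *m W t w &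
      \forall w \ae mu, forall t, 0 <= t ->
        Y t w = vintegral (fun s => C *m X s w) t + V t w].

(* dZ = A Z dt + S_t C^* (dY - C Z dt),  Z_0 = z0. *)
Definition kalman_solution n p (A : 'M[R]_n) (C : 'M[R]_(p, n))
    (Y : R -> T -> 'cV[R]_p) (S : R -> 'M[R]_n) (z0 : 'cV[R]_n)
    (Z : R -> T -> 'cV[R]_n) : Prop :=
  [/\ continuous_process Z,
      \forall w \ae mu, Z 0 w = z0 &
      forall t, 0 <= t -> exists2 J : T -> 'cV[R]_n,
        ito_integral (fun s => S s *m C^T) Y t J &
        \forall w \ae mu,
          Z t w = z0
            + vintegral (fun s => A *m Z s w - S s *m C^T *m (C *m Z s w)) t
            + J w].

(* S_t = E ((X_t - Z_t) (X_t - Z_t)^* ) *)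
Definition error_covariance n (X Z : R -> T -> 'cV[R]_n) (S : R -> 'M[R]_n)
    : Prop :=
  forall (t : R) (i j : 'I_n), 0 <= t ->
    ('E_mu[fun w => ((X t w - Z t w) i 0 * (X t w - Z t w) j 0)%R]
      = (S t i j)%:E)%E.

End Processes.

(* Main.v *)
Require Import Defs.
From HB Require Import structures.
From mathcomp Require Import all_boot all_order all_algebra.
From mathcomp Require Import complex.
From mathcomp Require Import all_classical all_reals all_analysis.
From mathcomp Require Import measurable_realfun.
From mathcomp Require Import ring lra.

Set Implicit Arguments.
Unset Strict Implicit.
Unset Printing Implicit Defensive.

Import Order.TTheory GRing.Theory Num.Theory.
Import numFieldNormedType.Exports.

Local Open Scope classical_set_scope.
Local Open Scope ring_scope.

(** Write Phi' for the transition matrix of dx/dt = (A - P'_t C* C) x and Psi'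
    for its inverse.

    The deterministic half is that Phi' tends to 0 and that P and P' have a
    common limit. The inverse transition matrix comes from the Hamiltonian
    linear system of the Riccati equation [riccati_inverse_flow]; conjugated by
    it, the Riccati solution becomes nondecreasing, so that it stays positive.
    Detectability provides a quadratic Lyapunov function for some A - K C
    [stable_lyapunov], which bounds the Riccati solution [solution_bounded]. Along
    dx/dt = (A - P C* C) x the information x* P^-1 x loses at least |C x|^2 per
    unit of time, so C x is square integrable and, by the Lyapunov function, x
    tends to 0 [flow_decay]. This settles the rest: P - P' is P_0 - P'_0
    transported by the two transition matrices [riccati_diff], and comparing P
    with its own translates in time shows that each quadratic form x* P_t x is
    nonincreasing up to a vanishing error, hence converges [riccati_cvg].

    For the filters, split the error of the second one as
      X - Xhat' = (X - Xhat) + (Xhat - Xhat').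
    The first term integrates to 0 over the events determined by the
    observation, while Xhat - Xhat' is an almost sure limit of variables
    determined by the observation; so the two are orthogonal [gap_orth] and
      E |Xhat - Xhat'|^2 = E |X - Xhat'|^2 - tr P_t.
    Now X - Xhat' solves a linear equation driven by the independent W and V and
    by X_0 - x_0', and the Riccati equation of P' is the Lyapunov equation for its
    second moment, so that [error_moment]
      E |X - Xhat'|^2 <= tr (Phi' (Q_0 - P'_0) Phi'* + P'_t),
    with Q_0 = P_0 + (x_0 - x_0') (x_0 - x_0')*. Hence E |Xhat - Xhat'|^2 is at
    most tr (Phi' (Q_0 - P'_0) Phi'* ) + tr (P'_t - P_t), which tends to 0.

    The integrands P'C*, Psi'B and Psi'P'C* are differentiable in time, so
    summation by parts turns every stochastic integral involved into a pathwise
    limit of left-endpoint sums along uniform partitions [ito_by_parts],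
    [error_sum_cvg]. The second moments of the sums are bounded by Riemann sums,
    and Fatou's lemma carries the bound to the limit. *)

(** * Real functions of time on the half-line *)

Lemma cvgr_sum (R : numFieldType) (T I : Type) (F : set_system T)
    {FF : Filter F} (s : seq I) (f : I -> T -> R) (l : I -> R) :
  (forall i, f i x @[x --> F] --> l i) ->
  (\sum_(i <- s) f i x) @[x --> F] --> \sum_(i <- s) l i.
Proof.
move=> fl; elim: s => [|i s IH].
  by under eq_fun do rewrite big_nil; rewrite big_nil; exact: cvg_cst.
by under eq_fun do rewrite big_cons; rewrite big_cons; exact: cvgD.
Qed.

Lemma cvgr_sum0 (R : numFieldType) (T I : Type) (F : set_system T)
    {FF : Filter F} (s : seq I) (f : I -> T -> R) :
  (forall i, f i x @[x --> F] --> (0 : R)) ->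
  (\sum_(i <- s) f i x) @[x --> F] --> (0 : R).
Proof.
move=> h; have /= := cvgr_sum (s := s) h.
by rewrite big1_eq; apply.
Qed.

Lemma cvgM0 (R : numFieldType) (T : Type) (F : set_system T) {FF : Filter F}
    (f g : T -> R) (l : R) : f x @[x --> F] --> (0 : R) ->
  g x @[x --> F] --> l -> f x * g x @[x --> F] --> (0 : R).
Proof. by move=> f0 gl; rewrite -(mul0r l); exact: cvgM. Qed.

Section Curves.
Context {R : realType}.
Implicit Types f g : R -> R.

(** Continuity on [0, +oo[, from the right at 0. *)
Definition ray_cont f := {within `[0, +oo[, continuous f}.

(** The functions for which differential equations on [0, +oo[ are stated: no
    derivative is required at 0, where one-sided continuity is enough for the
    mean value theorem. *)
Definition rcurve f f' :=
  ray_cont f /\ forall t : R, 0 < t -> is_derive t 1 f (f' t).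

Lemma ray_cont_cst (c : R) : ray_cont (fun=> c).
Proof. by move=> x; exact: cvg_cst. Qed.

Lemma ray_cont_id : ray_cont (fun t => t).
Proof. by apply: continuous_subspaceT => x; exact: cvg_id. Qed.

Lemma ray_contD f g : ray_cont f -> ray_cont g -> ray_cont (fun t => f t + g t).
Proof. by move=> cf cg x; apply: cvgD; [exact: cf|exact: cg]. Qed.

Lemma ray_contN f : ray_cont f -> ray_cont (fun t => - f t).
Proof. by move=> cf x; apply: cvgN; exact: cf. Qed.

Lemma ray_contM f g : ray_cont f -> ray_cont g -> ray_cont (fun t => f t * g t).
Proof. by move=> cf cg x; apply: cvgM; [exact: cf|exact: cg]. Qed.

Lemma ray_cont_sum (I : Type) (s : seq I) (F : I -> R -> R) :
  (forall i, ray_cont (F i)) -> ray_cont (fun t => \sum_(i <- s) F i t).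
Proof.
move=> cF; elim: s => [|i s IH].
  by under eq_fun do rewrite big_nil; exact: ray_cont_cst.
by under eq_fun do rewrite big_cons; exact: ray_contD.
Qed.

Lemma ray_contV f : ray_cont f -> (forall t, 0 <= t -> f t != 0) ->
  ray_cont (fun t => (f t)^-1).
Proof.
move=> /subspace_continuousP cf f0; apply/subspace_continuousP => x x0.
apply: cvgV; last exact: cf.
by apply: f0; move: x0; rewrite /= in_itv/= andbT.
Qed.

Lemma ray_cont_ext f g : ray_cont f -> (forall t, 0 <= t -> f t = g t) ->
  ray_cont g.
Proof.
move=> cf fg; apply: (subspace_eq_continuous _ cf) => x.
rewrite inE/= in_itv/= andbT.
exact: fg.
Qed.

Lemma rcurve_ext f g f' g' : rcurve f f' ->
  (forall t, 0 <= t -> f t = g t) ->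
  (forall t, 0 < t -> f' t = g' t) -> rcurve g g'.
Proof.
move=> [cf df] fg e; split; first exact: ray_cont_ext fg.
move=> t t0; rewrite -e//; apply: (near_eq_is_derive _ (df _ t0)) => //.
near=> x; apply/fg/ltW.
by near: x; exact: lt_nbhsr.
Unshelve. all: by end_near. Qed.

Lemma rcurve_cst (c : R) : rcurve (fun=> c) (fun=> 0).
Proof.
split; first exact: ray_cont_cst.
by move=> t _; exact: is_derive_cst.
Qed.

Lemma rcurve_id : rcurve (fun t => t) (fun=> 1).
Proof. split; [exact: ray_cont_id|move=> t _; exact: is_derive_id]. Qed.

Lemma rcurveD f g f' g' : rcurve f f' -> rcurve g g' ->
  rcurve (fun t => f t + g t) (fun t => f' t + g' t).
Proof.
move=> [cf df] [cg dg]; split; first exact: ray_contD.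
by move=> t t0; apply: is_deriveD; [exact: df|exact: dg].
Qed.

Lemma rcurveN f f' : rcurve f f' -> rcurve (fun t => - f t) (fun t => - f' t).
Proof.
move=> [cf df]; split; first exact: ray_contN.
by move=> t t0; apply: is_deriveN; exact: df.
Qed.

Lemma rcurveB f g f' g' : rcurve f f' -> rcurve g g' ->
  rcurve (fun t => f t - g t) (fun t => f' t - g' t).
Proof. by move=> cf cg; apply: rcurveD => //; exact: rcurveN. Qed.

Lemma rcurveM f g f' g' : rcurve f f' -> rcurve g g' ->
  rcurve (fun t => f t * g t) (fun t => f' t * g t + f t * g' t).
Proof.
move=> [cf df] [cg dg]; split; first exact: ray_contM.
move=> t t0; have Df := df _ t0; have Dg := dg _ t0.
apply: (@is_derive_eq _ _ _ (f * g) _ _ _ _ (is_deriveM Df Dg)).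
by rewrite /GRing.scale/= addrC; congr (_ + _); rewrite mulrC.
Qed.

Lemma rcurveZ (k : R) f f' : rcurve f f' ->
  rcurve (fun t => k * f t) (fun t => k * f' t).
Proof.
move=> cf; apply: (rcurve_ext (rcurveM (rcurve_cst k) cf)) => // t _.
by rewrite mul0r add0r.
Qed.

Lemma rcurve_sum (I : Type) (s : seq I) (F F' : I -> R -> R) :
  (forall i, rcurve (F i) (F' i)) ->
  rcurve (fun t => \sum_(i <- s) F i t) (fun t => \sum_(i <- s) F' i t).
Proof.
move=> cF; elim: s => [|i s IH].
  by apply: (rcurve_ext (rcurve_cst 0)) => t; rewrite big_nil.
by apply: (rcurve_ext (rcurveD (cF i) IH)) => t; rewrite big_cons.
Qed.

Lemma ray_cont_itv f s t : 0 <= s -> ray_cont f ->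
  {within `[s, t], continuous f}.
Proof.
move=> s0 cf; apply: continuous_subspaceW cf => x /=.
by rewrite !in_itv/= andbT => /andP[sx _]; exact: le_trans sx.
Qed.

Lemma ray_cont_pt f t : 0 < t -> ray_cont f -> {for t, continuous f}.
Proof.
move=> t0 cf.
have /continuous_within_itvP : {within `[0, t + 1], continuous f}.
  exact: ray_cont_itv.
case; first by rewrite ltr_wpDl// ltW.
move=> ct _ _; apply: ct; rewrite in_itv/= t0/= ltrDl; exact: ltr01.
Qed.

Lemma rcurve_MVT f f' s t : 0 <= s -> s < t -> rcurve f f' ->
  exists2 c, (s < c < t)%R & f t - f s = f' c * (t - s).
Proof.
move=> s0 st [cf df].
have [||c cst e] := @MVT R f f' s t st.
- move=> x; rewrite in_itv/= => /andP[sx xt]; apply: df; exact: le_lt_trans sx.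
- exact: ray_cont_itv.
by exists c => //; move: cst; rewrite in_itv.
Qed.

Lemma rcurve_nondecr f f' s t : rcurve f f' -> 0 <= s -> s <= t ->
  (forall x, s < x < t -> 0 <= f' x) -> f s <= f t.
Proof.
move=> cf s0; rewrite le_eqVlt => /predU1P[->//|st f'0].
have [c cst e] := rcurve_MVT s0 st cf.
by rewrite -subr_ge0 e mulr_ge0 ?subr_ge0 ?(ltW st)// f'0.
Qed.

Lemma rcurve_nonincr f f' s t : rcurve f f' -> 0 <= s -> s <= t ->
  (forall x, s < x < t -> f' x <= 0) -> f t <= f s.
Proof.
move=> cf s0 st f'0; rewrite -lerN2.
by apply: (rcurve_nondecr (rcurveN cf)) => // x xst; rewrite oppr_ge0 f'0.
Qed.

Lemma rcurve_const f f' : rcurve f f' -> (forall t, 0 < t -> f' t = 0) ->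
  forall t, 0 <= t -> f t = f 0.
Proof.
move=> cf f'0 t t0; apply/eqP; rewrite eq_le.
rewrite (rcurve_nonincr cf) ?(rcurve_nondecr cf)// => x /andP[x0 _].
  by rewrite f'0.
by rewrite f'0.
Qed.

(** A bound on the derivative inside the interval suffices, by the mean value
    theorem. *)
Lemma rcurve_lip f f' k s t : 0 <= s -> s <= t -> rcurve f f' ->
  (forall x, (s < x < t)%R -> `|f' x| <= k) -> `|f t - f s| <= k * (t - s).
Proof.
move=> s0; rewrite le_eqVlt => /predU1P[->|st] cf fk.
  by rewrite !subrr normr0 mulr0.
have [c cst ->] := rcurve_MVT s0 st cf.
by rewrite normrM (gtr0_norm (x := t - s)) ?subr_gt0// ler_wpM2r ?subr_ge0 ?(ltW st)// fk.
Qed.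

Lemma ray_cont_bounded f T : ray_cont f ->
  exists2 k : R, 0 <= k & forall t, 0 <= t <= T -> `|f t| <= k.
Proof.
move=> cf; have : compact (f @` `[0, T]).
  apply: continuous_compact; last exact: segment_compact.
  exact: ray_cont_itv.
move=> /compact_bounded[M [Mr HM]]; exists (`|M| + 1).
  by rewrite addr_ge0.
move=> t t0T; apply: HM; first by rewrite (le_lt_trans (ler_norm _))// ltrDl.
by exists t => //=; rewrite in_itv.
Qed.

Lemma ray_cont_shift f r : 0 <= r -> ray_cont f -> ray_cont (fun t => f (r + t)).
Proof.
rewrite le_eqVlt => /predU1P[<-|r0] cf.
  by apply: (ray_cont_ext cf) => t _; rewrite add0r.
apply/subspace_continuousP => t; rewrite /= in_itv/= andbT => t0.
apply: cvg_within_filter.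
apply: (@cvg_comp _ _ _ (fun t => r + t) f _ (nbhs (r + t))); last first.
  have rt0 : 0 < r + t by rewrite ltr_wpDr.
  exact: (ray_cont_pt rt0 cf).
by apply: cvgD; [exact: cvg_cst|exact: cvg_id].
Qed.

Lemma rcurve_shift f f' r : 0 <= r -> rcurve f f' ->
  rcurve (fun t => f (r + t)) (fun t => f' (r + t)).
Proof.
move=> r0 [cf df]; split; first exact: ray_cont_shift.
move=> t t0; have rt0 : 0 < r + t by rewrite ltr_wpDl.
have D1 : is_derive t (1 : R) (fun t => r + t) 1.
  by apply: (@is_derive_eq _ _ _ _ _ _ _ _ (is_deriveD (is_derive_cst r t 1) (is_derive_id t 1))); rewrite add0r.
have := @is_derive1_comp _ f _ _ _ _ (df _ rt0) D1.
by rewrite mulr1.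
Qed.

(** A LaSalle argument: the integral of g is finite, so g is small at some
    late time, and g can only increase by what v still has to lose. *)
Lemma decay_to0 (g v g' v' : R -> R) (k : R) : 0 < k ->
  rcurve g g' -> rcurve v v' ->
  (forall t, 0 <= t -> 0 <= g t) -> (forall t, 0 <= t -> 0 <= v t) ->
  (forall t, 0 < t -> v' t <= 0) ->
  (forall t, 0 < t -> g' t + v' t <= - k * g t) ->
  g t @[t --> +oo] --> (0 : R).
Proof.
move=> k0 cg cv g0 v0 v'0 gv.
have dv s t : 0 <= s -> s <= t -> v t <= v s.
  move=> s0 st; apply: (rcurve_nonincr cv) => // x /andP[sx _].
  by apply: v'0; exact: le_lt_trans sx.
have dE s t : 0 <= s -> s <= t -> g t + v t <= g s + v s.
  move=> s0 st; apply: (rcurve_nonincr (rcurveD cg cv)) => // x /andP[sx _].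
  have x0 : 0 < x by exact: le_lt_trans sx.
  apply: (le_trans (gv _ x0)); rewrite mulNr oppr_le0.
  by apply: mulr_ge0; [exact: ltW|exact/g0/ltW].
apply/cvgrPdist_le => e e0.
pose V := [set v t | t in [set t | 0 <= t]].
have hV : has_inf V.
  split; first by exists (v 0), 0 => //=; exact: lexx.
  by exists 0 => _ [t/= t0 <-]; exact: v0.
have [_ [T /= T0 <-] vT] := inf_adherent (divr_gt0 e0 (ltr0n R 2)) hV.
have vT' t : 0 <= t -> v T < v t + e / 2.
  move=> t0; apply: (lt_le_trans vT); rewrite lerD2r.
  by apply: ge_inf; [case: hV|exists t].
have [s Ts gs] : exists2 s, T <= s & g s <= e / 2.
  apply: contrapT => h.
  have gbig s : T <= s -> e / 2 < g s.
    by move=> Ts; rewrite ltNge; apply/negP => gs; apply: h; exists s.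
  (* Otherwise g + v would decrease at rate at least k' for ever; t is a time at
     which it would have become negative. *)
  pose k' := k * (e / 2).
  have k'0 : 0 < k' by rewrite mulr_gt0// divr_gt0.
  have cL := rcurveD (rcurveD cg cv) (rcurveZ k' rcurve_id).
  pose t := T + (g T + v T) / k' + 1.
  have Tt : T <= t by rewrite /t -addrA lerDl addr_ge0// divr_ge0 ?(ltW k'0)// addr_ge0 ?g0 ?v0.
  have := rcurve_nonincr cL T0 Tt; rewrite mulr1 => hL.
  have {hL} : g t + v t + k' * t <= g T + v T + k' * T.
    apply: hL => x /andP[Tx _]; have x0 : 0 < x by exact: le_lt_trans Tx.
    have := gv _ x0; have : k' <= k * g x by rewrite ler_wpM2l ?(ltW k0)// ltW// gbig// ltW.
    lra.
  have := g0 _ (le_trans T0 Tt); have := v0 _ (le_trans T0 Tt).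
  have : k' * t = k' * T + (g T + v T) + k'.
    by rewrite /t !mulrDr mulr1 mulrCA mulfV ?gt_eqF// mulr1.
  lra.
near=> t.
have st : s <= t by near: t; apply: nbhs_pinfty_ge; exact: num_real.
have s0 := le_trans T0 Ts; have t0 := le_trans s0 st.
rewrite sub0r normrN ger0_norm ?g0//.
have := dE _ _ s0 st; have := vT' t t0; have := dv _ _ T0 Ts.
lra.
Unshelve. all: by end_near. Qed.

(** The fundamental theorem of calculus; at 0 only the continuity of the integral
    is claimed. *)
Lemma rcurve_int f : ray_cont f ->
  rcurve (fun t => \int[lebesgue_measure]_(s in `[0, t]) f s) f.
Proof.
move=> cf.
have fi u : (lebesgue_measure : measure _ R).-integrable `[0, u] (EFin \o f).
  apply: continuous_compact_integrable; first exact: segment_compact.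
  exact: ray_cont_itv.
split.
  apply/continuous_within_itvcyP; split.
    move=> x; rewrite in_itv/= andbT => x0.
    have x1 : 0 <= x + 1 by rewrite addr_ge0 ?ltW.
    have /continuous_within_itvP := @parameterized_integral_continuous R 0 (x + 1) f x1 (fi _).
    case; first by rewrite ltr_wpDl// ltW.
    move=> h _ _; apply: h; rewrite in_itv/= x0/= ltrDl; exact: ltr01.
  have /continuous_within_itvP := @parameterized_integral_continuous R 0 1 f ler01 (fi _).
  by case; [exact: ltr01|].
move=> t t0.
have [] := @continuous_FTC1_closed R f 0 t (t + 1) _ (fi _) t0 (ray_cont_pt t0 cf).
  by rewrite ltrDl; exact: ltr01.
by move=> D1 D2; apply: DeriveDef => //; rewrite -derive1E.
Qed.

Lemma rcurve_expR (k : R) :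
  rcurve (fun t => expR (k * t)) (fun t => k * expR (k * t)).
Proof.
have dE (t : R) : is_derive t 1 (fun t => expR (k * t)) (k * expR (k * t)).
  have D : is_derive t 1 (fun t => k * t) k.
    have := is_deriveZ k (is_derive_id t 1).
    by rewrite /GRing.scale/= mulr1.
  have := is_derive1_comp (is_derive_expR (k * t)) D.
  by rewrite mulrC.
split=> [|t _]; last exact: dE.
apply: continuous_subspaceT => t; apply/differentiable_continuous.
by apply/derivable1_diffP; case: (dE t).
Qed.

(** Differentiability without naming the derivative, used where only its
    existence matters, as for determinants. *)
Definition rsmooth f := exists f', rcurve f f'.

Lemma rsmoothM f g : rsmooth f -> rsmooth g -> rsmooth (fun t => f t * g t).
Proof. by move=> [f' cf] [g' cg]; eexists; exact: rcurveM cf cg. Qed.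

Lemma rsmooth_sum (I : Type) (s : seq I) (F : I -> R -> R) :
  (forall i, rsmooth (F i)) -> rsmooth (fun t => \sum_(i <- s) F i t).
Proof.
move=> /choice[F' cF]; exists (fun t => \sum_(i <- s) F' i t).
exact: rcurve_sum.
Qed.

Lemma rsmooth_prod (I : Type) (s : seq I) (F : I -> R -> R) :
  (forall i, rsmooth (F i)) -> rsmooth (fun t => \prod_(i <- s) F i t).
Proof.
move=> cF; elim: s => [|i s IH].
  exists (fun=> 0); apply: (rcurve_ext (rcurve_cst 1)) => t //.
  by rewrite big_nil.
have [f' cf] := rsmoothM (cF i) IH.
by exists f'; apply: (rcurve_ext cf) => // t; rewrite big_cons.
Qed.

Lemma rsmoothV f : rsmooth f -> (forall t, 0 <= t -> f t != 0) ->
  rsmooth (fun t => (f t)^-1).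
Proof.
move=> [f' [cf df]] f0; exists (fun t => - (f t) ^- 2 *: f' t); split.
  exact: ray_contV.
move=> t t0; have Df := df t t0.
by apply: (is_deriveV _ Df); rewrite f0// ltW.
Qed.

Lemma rcurve_unique f f1 f2 t : rcurve f f1 -> rcurve f f2 -> 0 < t ->
  f1 t = f2 t.
Proof.
move=> [_ d1] [_ d2] t0.
by have [_ <-] := d1 _ t0; have [_ <-] := d2 _ t0.
Qed.

End Curves.

(** * Matrix-valued functions of time *)

Section MatrixCurves.
Context {R : realType}.

Definition mcurve m n (F F' : R -> 'M[R]_(m, n)) :=
  forall i j, rcurve (fun t => F t i j) (fun t => F' t i j).

Definition mcont m n (F : R -> 'M[R]_(m, n)) :=
  forall i j, ray_cont (fun t => F t i j).

Lemma mcurve_cont m n (F F' : R -> 'M[R]_(m, n)) : mcurve F F' -> mcont F.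
Proof. by move=> cF i j; case: (cF i j). Qed.

Lemma mcont_within m n (F : R -> 'M[R]_(m, n)) :
  {within `[0, +oo[, continuous F} -> mcont F.
Proof.
move=> cF i j x; apply: (@cvg_comp _ _ _ F (fun M : 'M[R]_(m, n) => M i j)).
  exact: cF.
exact: coord_continuous.
Qed.

Lemma mcont_cst m n (M : 'M[R]_(m, n)) : mcont (fun=> M).
Proof. by move=> i j; exact: ray_cont_cst. Qed.

Lemma mcontD m n (F G : R -> 'M[R]_(m, n)) :
  mcont F -> mcont G -> mcont (fun t => F t + G t).
Proof.
move=> cF cG i j.
by apply: (ray_cont_ext (ray_contD (cF i j) (cG i j))) => t _; rewrite mxE.
Qed.

Lemma mcontN m n (F : R -> 'M[R]_(m, n)) : mcont F -> mcont (fun t => - F t).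
Proof.
move=> cF i j.
by apply: (ray_cont_ext (ray_contN (cF i j))) => t _; rewrite mxE.
Qed.

Lemma mcontB m n (F G : R -> 'M[R]_(m, n)) :
  mcont F -> mcont G -> mcont (fun t => F t - G t).
Proof. by move=> cF cG; apply: mcontD => //; exact: mcontN. Qed.

Lemma mcontM m n p (F : R -> 'M[R]_(m, n)) (G : R -> 'M[R]_(n, p)) :
  mcont F -> mcont G -> mcont (fun t => F t *m G t).
Proof.
move=> cF cG i j.
have := @ray_cont_sum _ _ (index_enum 'I_n) _ (fun k => ray_contM (cF i k) (cG k j)).
by move=> h; apply: (ray_cont_ext h) => t _; rewrite mxE.
Qed.

Lemma mcontT m n (F : R -> 'M[R]_(m, n)) : mcont F -> mcont (fun t => (F t)^T).
Proof.
move=> cF i j.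
by apply: (ray_cont_ext (cF j i)) => t _; rewrite mxE.
Qed.

Lemma vintegral_curve k (f : R -> 'cV[R]_k) : mcont f -> mcurve (vintegral f) f.
Proof.
move=> cf i j; apply: (rcurve_ext (rcurve_int (cf i 0))) => t _.
  by rewrite mxE.
by rewrite (ord1 j).
Qed.

Lemma vintegral0 k (f : R -> 'cV[R]_k) : vintegral f 0 = 0.
Proof. by apply/colP => i; rewrite !mxE set_itv1 Rintegral_set1. Qed.

Lemma mcurve_ext m n (F G F' G' : R -> 'M[R]_(m, n)) : mcurve F F' ->
  (forall t, 0 <= t -> F t = G t) ->
  (forall t, 0 < t -> F' t = G' t) -> mcurve G G'.
Proof.
move=> cF e e' i j.
by apply: (rcurve_ext (cF i j)) => t t0 /=; rewrite ?(e _ t0) ?(e' _ t0).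
Qed.

Lemma mcurve_cst m n (M : 'M[R]_(m, n)) : mcurve (fun=> M) (fun=> 0).
Proof.
move=> i j; apply: (rcurve_ext (rcurve_cst (M i j))) => // t _.
by rewrite mxE.
Qed.

Lemma mcurveD m n (F G F' G' : R -> 'M[R]_(m, n)) :
  mcurve F F' -> mcurve G G' ->
  mcurve (fun t => F t + G t) (fun t => F' t + G' t).
Proof.
move=> cF cG i j.
by apply: (rcurve_ext (rcurveD (cF i j) (cG i j))) => t _; rewrite mxE.
Qed.

Lemma mcurveN m n (F F' : R -> 'M[R]_(m, n)) :
  mcurve F F' -> mcurve (fun t => - F t) (fun t => - F' t).
Proof.
move=> cF i j.
by apply: (rcurve_ext (rcurveN (cF i j))) => t _; rewrite mxE.
Qed.

Lemma mcurveB m n (F G F' G' : R -> 'M[R]_(m, n)) :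
  mcurve F F' -> mcurve G G' ->
  mcurve (fun t => F t - G t) (fun t => F' t - G' t).
Proof. by move=> cF cG; apply: mcurveD => //; exact: mcurveN. Qed.

Lemma mcurveM m n p (F F' : R -> 'M[R]_(m, n)) (G G' : R -> 'M[R]_(n, p)) :
  mcurve F F' -> mcurve G G' ->
  mcurve (fun t => F t *m G t) (fun t => F' t *m G t + F t *m G' t).
Proof.
move=> cF cG i j.
have := rcurve_sum (index_enum 'I_n) (fun k => rcurveM (cF i k) (cG k j)).
by move=> h; apply: (rcurve_ext h) => t _; rewrite !mxE// -big_split.
Qed.

Lemma mcurveMl m n p (M : 'M[R]_(m, n)) (G G' : R -> 'M[R]_(n, p)) :
  mcurve G G' -> mcurve (fun t => M *m G t) (fun t => M *m G' t).
Proof.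
move=> cG; apply: (mcurve_ext (mcurveM (mcurve_cst M) cG)) => // t _.
by rewrite mul0mx add0r.
Qed.

Lemma mcurveMr m n p (F F' : R -> 'M[R]_(m, n)) (M : 'M[R]_(n, p)) :
  mcurve F F' -> mcurve (fun t => F t *m M) (fun t => F' t *m M).
Proof.
move=> cF; apply: (mcurve_ext (mcurveM cF (mcurve_cst M))) => // t _.
by rewrite mulmx0 addr0.
Qed.

Lemma mcurveT m n (F F' : R -> 'M[R]_(m, n)) :
  mcurve F F' -> mcurve (fun t => (F t)^T) (fun t => (F' t)^T).
Proof.
move=> cF i j.
by apply: (rcurve_ext (cF j i)) => t _; rewrite mxE.
Qed.

Lemma mcurve_const m n (F F' : R -> 'M[R]_(m, n)) : mcurve F F' ->
  (forall t, 0 < t -> F' t = 0) -> forall t, 0 <= t -> F t = F 0.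
Proof.
move=> cF F'0 t t0; apply/matrixP => i j.
by apply: (rcurve_const (cF i j)) => // s s0; rewrite F'0// mxE.
Qed.

Lemma rsmooth_det n (F : R -> 'M[R]_n) :
  (forall i j, rsmooth (fun t => F t i j)) -> rsmooth (fun t => \det (F t)).
Proof.
move=> cF; apply: rsmooth_sum => s; apply: rsmoothM.
  by exists (fun=> 0); exact: rcurve_cst.
exact: rsmooth_prod.
Qed.

(** Cramer's rule makes the inverse differentiable; the product rule applied to
    F F^-1 = 1 then gives its derivative. *)
Lemma mcurve_inv n (F F' : R -> 'M[R]_n) : mcurve F F' ->
  (forall t, 0 <= t -> F t \in unitmx) ->
  mcurve (fun t => invmx (F t)) (fun t => - (invmx (F t) *m F' t *m invmx (F t))).
Proof.
move=> cF uF.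
have /choice[G' cG] : forall ij : 'I_n * 'I_n,
    rsmooth (fun t => invmx (F t) ij.1 ij.2).
  move=> [i j]/=.
  have [f cf] : rsmooth (fun t => (\det (F t))^-1 * cofactor (F t) j i).
    apply: rsmoothM.
      apply: rsmoothV; first by apply: rsmooth_det => k l; eexists; exact: cF.
      by move=> t t0; rewrite -unitfE -unitmxE uF.
    apply: rsmoothM; first by exists (fun=> 0); exact: rcurve_cst.
    apply: rsmooth_det => k l; exists (fun t => F' t (lift j k) (lift i l)).
    by apply: (rcurve_ext (cF _ _)) => // t _; rewrite !mxE.
  exists f; apply: (rcurve_ext cf) => // t t0.
  by rewrite /invmx uF// !mxE.
pose G t := \matrix_(i, j) G' (i, j) t.
have {}cG : mcurve (fun t => invmx (F t)) G.
  by move=> i j; apply: (rcurve_ext (cG (i, j))) => // t _; rewrite mxE.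
apply: (mcurve_ext cG) => // t t0.
have c1 : mcurve (fun t => F t *m invmx (F t)) (fun=> 0).
  by apply: (mcurve_ext (mcurve_cst 1%:M)) => // s s0; rewrite mulmxV ?uF.
have e : F' t *m invmx (F t) + F t *m G t = 0.
  by apply/matrixP => i j; exact: (rcurve_unique (mcurveM cF cG i j) (c1 i j) t0).
apply/eqP; rewrite -addr_eq0 addrC; apply/eqP.
by rewrite -(mulKmx (uF _ (ltW t0)) (G t)) -mulmxA -mulmxDr e mulmx0.
Qed.

Lemma mcont_bounded m n (F : R -> 'M[R]_(m, n)) T : mcont F ->
  exists2 k : R, 0 <= k & forall t i j, 0 <= t <= T -> `|F t i j| <= k.
Proof.
move=> cF.
have /choice[k kP] : forall ij : 'I_m * 'I_n, exists k : R,
    0 <= k /\ forall t, 0 <= t <= T -> `|F t ij.1 ij.2| <= k.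
  by move=> [i j]; have [k k0 kP] := ray_cont_bounded T (cF i j); exists k.
exists (\sum_ij k ij); first by apply: sumr_ge0 => ij _; case: (kP ij).
move=> t i j tT; have [_ /(_ _ tT)/= h] := kP (i, j).
apply: (le_trans h); rewrite (bigD1 (i, j))//= lerDl.
by apply: sumr_ge0 => ij _; case: (kP ij).
Qed.

End MatrixCurves.

(** * The matrix exponential *)

Section MatrixExponential.
Context {R : realType}.
Variables (n : nat) (H : 'M[R]_n).

Let c (s : nat) i j (k : nat) : R := (H ^+ (k + s)) i j / k`!%:R.

Let rho : R := 1 + \sum_ij `|H ij.1 ij.2|.

Let rho_ge1 : 1 <= rho.
Proof. by rewrite lerDl sumr_ge0. Qed.

Let normX k i j : `|(H ^+ k) i j| <= rho ^+ k.
Proof.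
elim: k i j => [|k IH] i j.
  rewrite !expr0 -[1]/(1%:M : 'M[R]_n) mxE; case: eqP => _ /=.
    by rewrite normr1.
  by rewrite normr0.
rewrite exprSr -[_ * _ in leLHS]/(_ *m _) mxE exprSr.
apply: (le_trans (ler_norm_sum _ _ _)).
apply: (@le_trans _ _ (\sum_k0 rho ^+ k * `|H k0 j|)).
  by apply: ler_sum => l _; rewrite normrM ler_wpM2r.
rewrite -mulr_sumr ler_wpM2l ?exprn_ge0 ?(le_trans ler01)//.
apply: (@le_trans _ _ (\sum_ij `|H ij.1 ij.2|)); last by rewrite lerDr.
rewrite -(pair_bigA _ (fun i j => `|H i j|))/= exchange_big/=.
by rewrite [leRHS](bigD1 j)//= lerDl sumr_ge0// => k0 _; rewrite sumr_ge0.
Qed.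

Let cvg_c s i j (x : R) : cvgn (pseries (c s i j) x).
Proof.
apply: normed_cvg.
apply: (@series_le_cvg _ _ (fun k => rho ^+ s * exp_coeff (rho * `|x|) k)).
- by move=> k; exact: normr_ge0.
- move=> k; apply: mulr_ge0; first by rewrite exprn_ge0// (le_trans ler01).
  by apply: exp_coeff_ge0; rewrite mulr_ge0// (le_trans ler01).
- move=> k /=; rewrite /c !normrM normfV normrX (ger0_norm (x := k`!%:R))// /exp_coeff/=.
  rewrite (_ : rho ^+ s * _ = rho ^+ (k + s) * (`|x| ^+ k / k`!%:R)); last first.
    by rewrite exprMn exprD; ring.
  by rewrite mulrAC -mulrA ler_wpM2r// mulr_ge0 ?exprn_ge0// invr_ge0.
- apply: is_cvg_seriesZ; exact: is_cvg_series_exp_coeff.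
Qed.

Let diffs_c s i j : pseries_diffs (c s i j) = c s.+1 i j.
Proof.
apply/funext => k; rewrite /pseries_diffs /c addSnnS factS natrM invfM.
by rewrite mulrCA; congr (_ * _); rewrite mulVKf// pnatr_eq0.
Qed.

Let E (x : R) : 'M[R]_n := \matrix_(i, j) limn (pseries (c 0 i j) x).

Let E0 : E 0 = 1%:M.
Proof.
apply/matrixP => i j; rewrite mxE.
have -> : 1%:M i j = c 0 i j 0 by rewrite /c addn0 expr0 fact0 divr1.
apply/cvg_lim => //; apply/cvgrPdist_lt => e e0; near=> k.
rewrite /pseries /series/= (_ : \sum_(_ <= _ < _) _ = c 0 i j 0).
  by rewrite subrr normr0.
rewrite big_ltn; last by near: k; exact: nbhs_infty_gt.
rewrite expr0 mulr1 big_nat_cond big1 ?addr0// => l /andP[/andP[l0 _] _].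
by rewrite expr0n gtn_eqF// mulr0.
Unshelve. all: by end_near. Qed.

Let HE x i j : limn (pseries (c 1 i j) x) = (H *m E x) i j.
Proof.
rewrite mxE; apply/cvg_lim => //.
have -> : pseries (c 1 i j) x =
    (fun N => \sum_l H i l * pseries (c 0 l j) x N).
  apply/funext => N; rewrite /pseries/series/=.
  under [RHS]eq_bigr do rewrite mulr_sumr.
  rewrite exchange_big/=; apply: eq_bigr => k _.
  rewrite /c addn1 addn0 exprS -[H * _]/(H *m _) mxE !mulr_suml.
  by apply: eq_bigr => l _; rewrite !mulrA.
apply: cvgr_sum => l; apply: cvgM; first exact: cvg_cst.
by rewrite mxE; exact: cvg_c.
Qed.

(** The exponential series, entry by entry: the entries of H^k are bounded by
    rho^k, so each entry is a power series in time that converges everywhere and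
    can be differentiated term by term. *)
Lemma ex_linear_flow : exists E : R -> 'M[R]_n,
  E 0 = 1%:M /\ mcurve E (fun t => H *m E t).
Proof.
exists E; split => // i j.
have dE (t : R) : is_derive t 1 (fun x => E x i j) ((H *m E t) i j).
  rewrite -HE -diffs_c; under eq_fun do rewrite mxE.
  apply: (@pseries_snd_diffs _ _ (`|t| + 1)); rewrite ?diffs_c; try exact: cvg_c.
  by rewrite (ger0_norm (addr_ge0 _ _))// ltrDl.
split=> [|t _]; last exact: dE.
apply: continuous_subspaceT => t; apply/differentiable_continuous.
by apply/derivable1_diffP; case: (dE t).
Qed.

End MatrixExponential.

(** * Quadratic forms and linear differential equations *)

Section QuadraticForms.
Context {R : realType}.

Lemma dotvE k (x y : 'cV[R]_k) : dotv x y = \sum_i x i 0 * y i 0.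
Proof. by rewrite /dotv mxE; apply: eq_bigr => i _; rewrite mxE. Qed.

Lemma dotvC k (x y : 'cV[R]_k) : dotv x y = dotv y x.
Proof. by rewrite !dotvE; apply: eq_bigr => i _; rewrite mulrC. Qed.

Lemma dotvDl k (x y z : 'cV[R]_k) : dotv (x + y) z = dotv x z + dotv y z.
Proof. by rewrite /dotv linearD mulmxDl mxE. Qed.

Lemma dotvDr k (x y z : 'cV[R]_k) : dotv z (x + y) = dotv z x + dotv z y.
Proof. by rewrite dotvC dotvDl !(dotvC z). Qed.

Lemma dotvZl k a (x y : 'cV[R]_k) : dotv (a *: x) y = a * dotv x y.
Proof. by rewrite /dotv linearZ -scalemxAl mxE. Qed.

Lemma dotvZr k a (x y : 'cV[R]_k) : dotv x (a *: y) = a * dotv x y.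
Proof. by rewrite dotvC dotvZl dotvC. Qed.

Lemma dotvNl k (x y : 'cV[R]_k) : dotv (- x) y = - dotv x y.
Proof. by rewrite -scaleN1r dotvZl mulN1r. Qed.

Lemma dotvNr k (x y : 'cV[R]_k) : dotv x (- y) = - dotv x y.
Proof. by rewrite dotvC dotvNl dotvC. Qed.

Lemma dotvBr k (x y z : 'cV[R]_k) : dotv z (x - y) = dotv z x - dotv z y.
Proof. by rewrite dotvDr dotvNr. Qed.

Lemma dotvBl k (x y z : 'cV[R]_k) : dotv (x - y) z = dotv x z - dotv y z.
Proof. by rewrite dotvDl dotvNl. Qed.

Lemma dotv0r k (x : 'cV[R]_k) : dotv x 0 = 0.
Proof. by rewrite /dotv mulmx0 mxE. Qed.

Lemma dotv0l k (x : 'cV[R]_k) : dotv 0 x = 0.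
Proof. by rewrite dotvC dotv0r. Qed.

Lemma dotv_mull m n (M : 'M[R]_(m, n)) x y :
  dotv (M *m x) y = dotv x (M^T *m y).
Proof. by rewrite /dotv trmx_mul mulmxA. Qed.

Lemma dotv_ge0 k (x : 'cV[R]_k) : 0 <= dotv x x.
Proof. by rewrite dotvE sumr_ge0// => i _; rewrite -expr2 sqr_ge0. Qed.

Lemma dotv_eq0 k (x : 'cV[R]_k) : dotv x x = 0 -> x = 0.
Proof.
rewrite dotvE => /eqP; rewrite psumr_eq0; last first.
  by move=> i _; rewrite -expr2 sqr_ge0.
move=> /allP h; apply/colP => i; rewrite mxE.
have := h i (mem_index_enum i).
by rewrite -expr2 sqrf_eq0 => /eqP.
Qed.

Lemma sqr_le_dotv k (x : 'cV[R]_k) i : x i 0 ^+ 2 <= dotv x x.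
Proof.
rewrite dotvE (bigD1 i)//= -expr2 lerDl sumr_ge0// => j _.
by rewrite -expr2 sqr_ge0.
Qed.

(** Expand |a x - y|^2 >= 0 and divide by a. *)
Lemma young k (x y : 'cV[R]_k) (a : R) : 0 < a ->
  2 * dotv x y <= a * dotv x x + a^-1 * dotv y y.
Proof.
move=> a0; rewrite -subr_ge0.
have := dotv_ge0 (a *: x - y).
rewrite dotvBl !dotvBr !dotvZl !dotvZr (dotvC y x) => h.
rewrite -(pmulr_rge0 _ a0); apply: (le_trans h).
rewrite le_eqVlt; apply/orP; left; apply/eqP.
rewrite mulrBr mulrDr (mulrA a a^-1) mulfV ?gt_eqF// mul1r.
by ring.
Qed.

(** Termwise 2 |x_i y_j| <= x_i^2 + y_j^2. *)
Lemma bf_bound m n (M : 'M[R]_(m, n)) (k : R) x y :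
  (forall i j, `|M i j| <= k) ->
  `|dotv x (M *m y)| <= k / 2 * (n%:R * dotv x x + m%:R * dotv y y).
Proof.
move=> Mk; rewrite dotvE.
apply: (le_trans (ler_norm_sum _ _ _)).
have h i j : `|x i 0 * (M i j * y j 0)| <= k / 2 * (x i 0 ^+ 2 + y j 0 ^+ 2).
  have k0 : 0 <= k by apply: le_trans (Mk i j).
  rewrite mulrCA normrM; apply: (@le_trans _ _ (k * `|x i 0 * y j 0|)).
    by rewrite ler_wpM2r.
  rewrite -mulrA ler_wpM2l// normrM.
  rewrite -(real_normK (num_real (x i 0))) -(real_normK (num_real (y j 0))).
  have := sqr_ge0 (`|x i 0| - `|y j 0|); lra.
apply: (@le_trans _ _ (\sum_i \sum_j k / 2 * (x i 0 ^+ 2 + y j 0 ^+ 2))).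
  apply: ler_sum => i _; rewrite mxE mulr_sumr.
  by apply: (le_trans (ler_norm_sum _ _ _)); apply: ler_sum.
rewrite le_eqVlt; apply/orP; left; apply/eqP.
under eq_bigr do rewrite -mulr_sumr big_split/= sumr_const card_ord.
rewrite -mulr_sumr big_split/= sumr_const card_ord sumrMnl.
have e q (z : 'cV[R]_q) : dotv z z = \sum_i z i 0 ^+ 2.
  by rewrite dotvE; apply: eq_bigr => i _; rewrite expr2.
by rewrite !e !mulr_natl.
Qed.

Lemma qf_bound n (M : 'M[R]_n) (k : R) (x : 'cV[R]_n) :
  (forall i j, `|M i j| <= k) -> `|dotv x (M *m x)| <= k * n%:R * dotv x x.
Proof.
move=> /(bf_bound x x) h; apply: (le_trans h).
by rewrite le_eqVlt; apply/orP; left; apply/eqP; field.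
Qed.

Lemma mul_bound m n (M : 'M[R]_(m, n)) : exists2 K : R, 0 <= K &
  forall x, dotv (M *m x) (M *m x) <= K * dotv x x.
Proof.
pose k := \sum_ij `|(M^T *m M) ij.1 ij.2|.
exists (k * n%:R); first by rewrite mulr_ge0// sumr_ge0.
move=> x; rewrite dotv_mull mulmxA; apply: le_trans (ler_norm _) _.
apply: qf_bound => i j; rewrite /k (bigD1 (i, j))//= lerDl.
exact: sumr_ge0.
Qed.

Lemma dotv_curve k (x y x' y' : R -> 'cV[R]_k) : mcurve x x' -> mcurve y y' ->
  rcurve (fun t => dotv (x t) (y t))
    (fun t => dotv (x' t) (y t) + dotv (x t) (y' t)).
Proof.
move=> cx cy.
by apply: (rcurve_ext (mcurveM (mcurveT cx) cy 0 0)) => // t _; rewrite mxE.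
Qed.

Lemma qf_curve k (M M' : R -> 'M[R]_k) x : mcurve M M' ->
  rcurve (fun t => dotv x (M t *m x)) (fun t => dotv x (M' t *m x)).
Proof.
move=> cM; have cx := mcurve_cst x.
apply: (rcurve_ext (dotv_curve cx (mcurveMr x cM))) => // t _.
by rewrite dotv0l add0r.
Qed.

Lemma qf_conj k (M D : 'M[R]_k) x :
  dotv x (M *m D *m M^T *m x) = dotv (M^T *m x) (D *m (M^T *m x)).
Proof. by rewrite dotv_mull trmxK !mulmxA. Qed.

Lemma unitmx_inj n (M : 'M[R]_n) :
  (forall x : 'cV[R]_n, M *m x = 0 -> x = 0) -> M \in unitmx.
Proof.
move=> inj; rewrite -unitmx_tr -row_free_unit -kermx_eq0.
apply/eqP/row_matrixP => i; rewrite row0.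
have : row i (kermx M^T) *m M^T = 0 by rewrite -row_mul mulmx_ker row0.
move=> /(congr1 trmx); rewrite trmx_mul trmxK trmx0 => /inj.
by move=> /(congr1 trmx); rewrite trmxK trmx0.
Qed.

Lemma pos_unitmx k (M : 'M[R]_k) : (forall x, x != 0 -> 0 < dotv x (M *m x)) ->
  M \in unitmx.
Proof.
move=> M0; apply: unitmx_inj => x Mx; apply/eqP/negPn/negP => /M0.
by rewrite Mx dotv0r ltxx.
Qed.

(** Gronwall: the squared norm grows and decays at most exponentially. *)
Lemma linear_ode_bounds n (F : R -> 'M[R]_n) (y : R -> 'cV[R]_n) T :
  mcont F -> mcurve y (fun t => F t *m y t) -> 0 <= T ->
  exists k : R,
    dotv (y T) (y T) <= expR (k * T) * dotv (y 0) (y 0) /\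
    dotv (y 0) (y 0) <= expR (k * T) * dotv (y T) (y T).
Proof.
move=> cF cy T0; have [k k0 kP] := mcont_bounded T cF.
pose K := 2 * (k * n%:R); exists K.
pose g t := dotv (y t) (y t).
have cg : rcurve g (fun t => 2 * dotv (y t) (F t *m y t)).
  by apply: (rcurve_ext (dotv_curve cy cy)) => // t _; rewrite dotvC; ring.
have gb t : 0 < t < T -> `|2 * dotv (y t) (F t *m y t)| <= K * g t.
  move=> /andP[t0 tT]; rewrite normrM ger0_norm// /K -mulrA ler_wpM2l//.
  by apply: qf_bound => i j; rewrite kP// (ltW t0) ltW.
have cE (a : R) := rcurveM (rcurve_expR a) cg.
have E0 (a : R) : expR (a * 0) = 1 by rewrite mulr0 expR0.
split.
- have := rcurve_nonincr (cE (- K)) (lexx 0) T0.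
  rewrite E0 mul1r mulNr expRN => h.
  rewrite mulrC -ler_pdivrMr ?expR_gt0// mulrC; apply: h => t tT.
  rewrite -mulrA mulNr mulrCA -mulrN -mulrDr pmulr_rle0 ?expR_gt0//.
  have := gb t tT; rewrite ler_norml => /andP[_]; lra.
- have := rcurve_nondecr (cE K) (lexx 0) T0.
  rewrite E0 mul1r => h; apply: h => t tT.
  rewrite -mulrA mulrCA -mulrDr pmulr_rge0 ?expR_gt0//.
  have := gb t tT; rewrite ler_norml => /andP[+ _]; lra.
Qed.

(** Both directions of the exponential bound are used: from s back to 0, then
    from 0 to t. *)
Lemma linear_ode_eq0 n (F : R -> 'M[R]_n) (y : R -> 'cV[R]_n) s t :
  mcont F -> mcurve y (fun t => F t *m y t) -> 0 <= s -> 0 <= t ->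
  y s = 0 -> y t = 0.
Proof.
move=> cF cy s0 t0 ys.
have y0 : y 0 = 0.
  have [k [_]] := linear_ode_bounds cF cy s0.
  rewrite ys dotv0r mulr0 => h; apply: dotv_eq0.
  by apply/eqP; rewrite eq_le h dotv_ge0.
have [k [h _]] := linear_ode_bounds cF cy t0.
move: h; rewrite y0 dotv0r mulr0 => h; apply: dotv_eq0.
by apply/eqP; rewrite eq_le h dotv_ge0.
Qed.

End QuadraticForms.

(** * The Riccati equation and its closed-loop flow *)

Section Riccati.
Context {R : realType}.
Variables (n m p : nat) (A : 'M[R]_n) (B : 'M[R]_(n, m)) (C : 'M[R]_(p, n)).
Implicit Types (M : 'M[R]_n) (S Psi : R -> 'M[R]_n).

Definition ricc (M : 'M[R]_n) :=
  A *m M + M *m A^T + B *m B^T - M *m C^T *m C *m M.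

Definition closed_loop (M : 'M[R]_n) := A - M *m C^T *m C.

Lemma riccati_curve (S0 : 'M[R]_n) S : riccati_solution A B C S0 S ->
  mcurve S (fun t => ricc (S t)).
Proof.
move=> [_ /mcont_within cS dS] i j; split; first exact: cS.
by move=> t t0; exact: dS.
Qed.

Lemma riccT M : (ricc M)^T = ricc M^T.
Proof.
rewrite /ricc linearB/= !linearD/= !trmx_mul !trmxK !mulmxA.
by congr (_ + _ - _); rewrite addrC.
Qed.

Lemma riccati_curveT S : mcurve S (fun t => ricc (S t)) ->
  mcurve (fun t => (S t)^T) (fun t => ricc (S t)^T).
Proof.
by move=> cS; apply: (mcurve_ext (mcurveT cS)) => // t _; rewrite riccT.
Qed.

(** [Psi] is the inverse of the transition matrix of dx/dt = F(t) x from time 0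
    to time t. *)
Definition inverse_flow (F Psi : R -> 'M[R]_n) :=
  [/\ Psi 0 = 1%:M, mcurve Psi (fun t => - (Psi t *m F t)) &
      forall t, 0 <= t -> Psi t \in unitmx].

Lemma mcont_closed_loop S S' : mcurve S S' -> mcont (fun t => closed_loop (S t)).
Proof.
move=> cS; apply: (@mcurve_cont _ _ _ _ (fun t => 0 - S' t *m C^T *m C)).
apply: mcurveB; first exact: mcurve_cst.
by do 2 apply: mcurveMr.
Qed.

(** A fundamental solution is injective because a solution that vanishes at one
    time vanishes at time 0. *)
Lemma mcurve_mulr_inj (F U : R -> 'M[R]_n) (x : 'cV[R]_n) t : mcont F ->
  mcurve U (fun s => F s *m U s) -> 0 <= t -> U 0 = 1%:M -> U t *m x = 0 -> x = 0.
Proof.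
move=> cF cU t0 U0 Ut.
have cy : mcurve (fun s => U s *m x) (fun s => F s *m (U s *m x)).
  by apply: (mcurve_ext (mcurveMr x cU)) => // s _; rewrite mulmxA.
by have := linear_ode_eq0 cF cy t0 (lexx 0) Ut; rewrite U0 mul1mx.
Qed.

(** The Hamiltonian matrix linearizes the Riccati equation: if (U, V) solves the
    linear system with (U, V)(0) = (1, S(0)^T), then V - S^T U solves a
    homogeneous linear equation and so vanishes; then U^T is the inverse flow. *)
Lemma riccati_inverse_flow S : mcurve S (fun t => ricc (S t)) ->
  exists Psi, inverse_flow (fun t => closed_loop (S t)) Psi.
Proof.
move=> cS; pose Q t := (S t)^T.
have cQ : mcurve Q (fun t => ricc (Q t)) by exact: riccati_curveT.
pose H : 'M[R]_(n + n) := block_mx (- A^T) (C^T *m C) (B *m B^T) A.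
have [E [E0 cE]] := ex_linear_flow H.
pose Z t := E t *m col_mx 1%:M (Q 0).
have cZ : mcurve Z (fun t => H *m Z t).
  by apply: (mcurve_ext (mcurveMr _ cE)) => // t _; rewrite mulmxA.
pose U t := usubmx (Z t); pose V t := dsubmx (Z t).
have HZ t : H *m Z t = col_mx (- A^T *m U t + C^T *m C *m V t)
                              (B *m B^T *m U t + A *m V t).
  by rewrite -[Z t]vsubmxK mul_block_col.
have cU : mcurve U (fun t => - A^T *m U t + C^T *m C *m V t).
  move=> i j; apply: (rcurve_ext (cZ (lshift n i) j)) => t _.
    by rewrite [RHS]mxE.
  by rewrite HZ col_mxEu.
have cV : mcurve V (fun t => B *m B^T *m U t + A *m V t).
  move=> i j; apply: (rcurve_ext (cZ (rshift n i) j)) => t _.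
    by rewrite [RHS]mxE.
  by rewrite HZ col_mxEd.
have Z0 : Z 0 = col_mx 1%:M (Q 0) by rewrite /Z E0 mul1mx.
have U0 : U 0 = 1%:M by rewrite /U Z0 col_mxKu.
have V0 : V 0 = Q 0 by rewrite /V Z0 col_mxKd.
pose W t := V t - Q t *m U t.
have cW : mcurve W (fun t => closed_loop (Q t) *m W t).
  apply: (mcurve_ext (mcurveB cV (mcurveM cQ cU))) => // t _.
  rewrite /W /closed_loop /ricc !mulmxBl !mulmxDl !mulmxBr !mulmxDr !mulNmx !mulmxN !mulmxA.
  apply/matrixP => i j; rewrite !mxE; ring.
have W0 t : 0 <= t -> W t = 0.
  move=> t0; apply/matrixP => i j; rewrite [RHS]mxE.
  have cy : mcurve (fun s => W s *m delta_mx j (0 : 'I_1))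
      (fun s => closed_loop (Q s) *m (W s *m delta_mx j (0 : 'I_1))).
    by apply: (mcurve_ext (mcurveMr _ cW)) => // s _; rewrite mulmxA.
  have := linear_ode_eq0 (mcont_closed_loop cQ) cy (lexx 0) t0.
  have WE0 : W 0 = 0 by rewrite /W V0 U0 mulmx1 subrr.
  rewrite WE0 mul0mx => /(_ erefl)/(congr1 (fun y : 'cV[R]_n => y i 0)).
  by rewrite -colE [LHS]mxE [RHS]mxE.
pose F t := closed_loop (S t).
have cU' : mcurve U (fun t => - (F t)^T *m U t).
  apply: (mcurve_ext cU) => // t t0.
  have -> : V t = Q t *m U t by apply/eqP; rewrite -subr_eq0; apply/eqP/W0/ltW.
  rewrite /F /closed_loop linearB/= !trmx_mul trmxK opprB mulmxBl mulNmx !mulmxA.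
  by rewrite addrC.
exists (fun t => (U t)^T); split.
- by rewrite U0 trmx1.
- apply: (mcurve_ext (mcurveT cU')) => // t _.
  by rewrite trmx_mul linearN/= trmxK mulmxN.
- move=> t t0; rewrite unitmx_tr; apply: unitmx_inj => x.
  have cF : mcont (fun t => - (F t)^T).
    have cC : mcont (fun t => closed_loop (S t)) := mcont_closed_loop cS.
    move=> i j; have h := ray_contN (cC j i).
    by apply: (ray_cont_ext h) => s _; rewrite [RHS]mxE [in RHS]mxE.
  exact: (mcurve_mulr_inj cF cU').
Qed.

Lemma const_flow (M : 'M[R]_n) : exists Psi, inverse_flow (fun=> M) Psi.
Proof.
have [E [E0 cE]] := ex_linear_flow (- M^T).
exists (fun t => (E t)^T); split.
- by rewrite E0 trmx1.
- by apply: (mcurve_ext (mcurveT cE)) => // t _; rewrite trmx_mul linearN/= trmxK mulmxN.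
- move=> t t0; rewrite unitmx_tr; apply: unitmx_inj => x.
  apply: (mcurve_mulr_inj (F := fun=> - M^T)) => // i j.
  exact: ray_cont_cst.
Qed.

(** Conjugation by inverse flows removes the homogeneous part of a Sylvester
    equation, leaving only the transported forcing term. *)
Lemma flow_conj (F1 F2 Psi1 Psi2 D G : R -> 'M[R]_n) :
  inverse_flow F1 Psi1 -> inverse_flow F2 Psi2 ->
  mcurve D (fun t => F1 t *m D t + D t *m (F2 t)^T + G t) ->
  mcurve (fun t => Psi1 t *m D t *m (Psi2 t)^T)
    (fun t => Psi1 t *m G t *m (Psi2 t)^T).
Proof.
move=> [_ c1 _] [_ c2 _] cD.
apply: (mcurve_ext (mcurveM (mcurveM c1 cD) (mcurveT c2))) => // t _.
rewrite linearN/= trmx_mul !mulmxDr !mulmxDl !mulNmx !mulmxN !mulmxA.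
apply/matrixP => i j; rewrite !mxE; ring.
Qed.

(** The quadratic terms combine so that S1 - S2 satisfies a Sylvester equation with
    the two closed-loop generators and no forcing. *)
Lemma riccati_diff S1 S2 Psi1 Psi2 t :
  mcurve S1 (fun t => ricc (S1 t)) -> mcurve S2 (fun t => ricc (S2 t)) ->
  inverse_flow (fun t => closed_loop (S1 t)) Psi1 ->
  inverse_flow (fun t => closed_loop (S2 t)^T) Psi2 -> 0 <= t ->
  Psi1 t *m (S1 t - S2 t) *m (Psi2 t)^T = S1 0 - S2 0.
Proof.
move=> c1 c2 f1 f2 t0.
have cD : mcurve (fun t => S1 t - S2 t) (fun t =>
    closed_loop (S1 t) *m (S1 t - S2 t)
    + (S1 t - S2 t) *m (closed_loop (S2 t)^T)^T + 0).
  apply: (mcurve_ext (mcurveB c1 c2)) => // s _.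
  have -> : (closed_loop (S2 s)^T)^T = A^T - C^T *m C *m S2 s.
    by rewrite /closed_loop linearB/= !trmx_mul !trmxK mulmxA.
  rewrite /ricc /closed_loop !mulmxBl !mulmxBr !mulmxA.
  apply/matrixP => i j; rewrite !mxE; ring.
have := mcurve_const (flow_conj f1 f2 cD) _ t0.
move=> -> => [|s _]; last by rewrite mulmx0 mul0mx.
by case: f1 => -> _ _; case: f2 => -> _ _; rewrite trmx1 mulmx1 mul1mx.
Qed.

Lemma unit_conj_eq0 (M N D : 'M[R]_n) : M \in unitmx -> N \in unitmx ->
  M *m D *m N = 0 -> D = 0.
Proof.
by move=> uM uN e; rewrite -(mulKmx uM D) -(mulmxK uN (M *m D)) e mul0mx mulmx0.
Qed.

(** S and its transpose solve the same equation from the same initial value, and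
    the difference of two solutions is the transported initial difference. *)
Lemma riccati_sym S t : mcurve S (fun t => ricc (S t)) ->
  (S 0)^T = S 0 -> 0 <= t -> (S t)^T = S t.
Proof.
move=> cS S0 t0; have [Psi f] := riccati_inverse_flow cS.
have cT := riccati_curveT cS.
have f2 : inverse_flow (fun t => closed_loop ((S t)^T)^T) Psi.
  by case: f => ? c ?; split=> //; apply: (mcurve_ext c) => // s _; rewrite trmxK.
have := riccati_diff cS cT f f2 t0; rewrite S0 subrr => /unit_conj_eq0.
case: f => _ _ uP; rewrite unitmx_tr !uP// => /(_ isT isT)/eqP.
by rewrite subr_eq0 => /eqP.
Qed.

End Riccati.

(** * Lyapunov functions of stable matrices *)

Section Lyapunov.
Context {R : realType}.

Let rc := real_complex R.
Let re n m (M : 'M[R[i]]_(n, m)) : 'M[R]_(n, m) := map_mx (@complex.Re R) M.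
Let im n m (M : 'M[R[i]]_(n, m)) : 'M[R]_(n, m) := map_mx (@complex.Im R) M.

Let Re_sum (I : Type) (s : seq I) (f : I -> R[i]) :
  complex.Re (\sum_(i <- s) f i) = \sum_(i <- s) complex.Re (f i).
Proof. by apply: (big_morph (@complex.Re R)) => // -[a b] [c d]. Qed.

Let Im_sum (I : Type) (s : seq I) (f : I -> R[i]) :
  complex.Im (\sum_(i <- s) f i) = \sum_(i <- s) complex.Im (f i).
Proof. by apply: (big_morph (@complex.Im R)) => // -[a b] [c d]. Qed.

Let re_mul n m p (M : 'M[R[i]]_(n, m)) (N : 'M[R[i]]_(m, p)) :
  re (M *m N) = re M *m re N - im M *m im N.
Proof.
apply/matrixP => i j; rewrite !mxE Re_sum -sumrB; apply: eq_bigr => k _.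
by rewrite !mxE; case: (M i k) => a b; case: (N k j).
Qed.

Let im_mul n m p (M : 'M[R[i]]_(n, m)) (N : 'M[R[i]]_(m, p)) :
  im (M *m N) = re M *m im N + im M *m re N.
Proof.
apply/matrixP => i j; rewrite !mxE Im_sum -big_split; apply: eq_bigr => k _.
by rewrite !mxE; case: (M i k) => a b; case: (N k j) => c d /=; rewrite [b * c]mulrC (mulrC c).
Qed.

(** Schur form over R[i]; the diagonal consists of eigenvalues. *)
Let stable_triangular n (M : 'M[R]_n) : stable M -> (0 < n)%N ->
  exists P L : 'M[R[i]]_n,
  [/\ P \in unitmx, is_trig_mx L, P *m map_mx rc M = L *m P &
      forall i, complex.Re (L i i) < 0].
Proof.
move=> sM n0; have [P uP tP] := Schur (map_mx rc M) n0.
have {}uP : P \in unitmx by exact: unitarymx_unit.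
pose L := P *m map_mx rc M *m invmx P.
have tL : is_trig_mx L.
  by move: tP; rewrite /similar_to/= conjumx.
have PL : P *m map_mx rc M = L *m P by rewrite mulmxKV.
exists P, L; split => // i; apply: sM.
have : eigenvalue L (L i i).
  rewrite eigenvalue_root_char char_poly_trig// /root horner_prod.
  by rewrite (bigD1 i)//= hornerXsubC subrr mul0r.
move=> /eigenvalueP[v vL v0]; apply/eigenvalueP; exists (v *m P).
  by rewrite -mulmxA PL mulmxA vL scalemxAl.
apply: contra_neq v0 => vP; by rewrite -(mulmxK uP v) vP mul0mx.
Qed.

(** Conjugating a triangular matrix by diag(eps^i) shrinks its off-diagonal part
    and keeps its diagonal. *)
Let stable_near_diagonal n (M : 'M[R]_n) : stable M -> (0 < n)%N ->
  exists2 g : R, 0 < g & forall k : R, 0 < k ->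
  exists N L : 'M[R[i]]_n,
  [/\ N \in unitmx, N *m map_mx rc M = L *m N,
      forall i, complex.Re (L i i) <= - g &
      forall i j, i != j -> `|complex.Re (L i j)| <= k /\ `|complex.Im (L i j)| <= k].
Proof.
move=> sM n0; have [P [L [uP /is_trig_mxP tL PL negL]]] := stable_triangular sM n0.
have [g g0 gP] : exists2 g : R, 0 < g & forall i, complex.Re (L i i) <= - g.
  exists (\big[Order.min/1]_i (- complex.Re (L i i))).
    by apply/bigmin_gtP; split=> // i _; rewrite oppr_gt0.
  by move=> i; rewrite lerNr bigmin_le_cond.
exists g => // k k0.
pose c := 1 + \sum_ij (`|complex.Re (L ij.1 ij.2)| + `|complex.Im (L ij.1 ij.2)|).
have c1 : 1 <= c by rewrite lerDl sumr_ge0// => ij _; rewrite addr_ge0.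
have cP i j : `|complex.Re (L i j)| + `|complex.Im (L i j)| <= c.
  by rewrite /c (bigD1 (i, j))//= addrCA lerDl addr_ge0// sumr_ge0.
have c0 : 0 < c by exact: lt_le_trans c1.
pose e := Order.min 1 (k / c).
have e0 : 0 < e by rewrite lt_min ltr01 divr_gt0.
have e1 : e <= 1 by rewrite ge_min lexx.
have ek : e * c <= k.
  by rewrite -ler_pdivlMr// ge_min lexx orbT.
pose D : 'M[R[i]]_n := diag_mx (\row_i rc (e ^+ i)).
pose L' : 'M[R[i]]_n := \matrix_(i, j) (rc (e ^+ (i - j)) * L i j).
exists (D *m P), L'; split.
- rewrite unitmx_mul uP andbT unitmxE det_diag unitfE; apply/prodf_neq0 => i _.
  by rewrite mxE fmorph_eq0 expf_neq0// gt_eqF.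
- rewrite -mulmxA PL !mulmxA; congr (_ *m _).
  apply/matrixP => i j; rewrite mul_diag_mx mul_mx_diag !mxE.
  have [ij|ji] := ltnP i j; first by rewrite tL// !(mulr0, mul0r).
  by rewrite mulrAC -rmorphM -exprD subnK.
- have rc1 : rc 1 = 1 by [].
  by move=> i; rewrite mxE subnn expr0 rc1 mul1r.
- move=> i j ij; rewrite mxE.
  have [lij|ji] := ltnP i j.
    by rewrite tL// mulr0 /= normr0; split; exact: ltW.
  have {}ji : (j < i)%N by rewrite ltn_neqAle eq_sym ij ji.
  have el : e ^+ (i - j) <= e.
    by rewrite -[leRHS]expr1 ler_wiXn2l// ?(ltW e0)// subn_gt0.
  have h a : `|a| <= c -> `|e ^+ (i - j) * a| <= k.
    move=> ac; rewrite normrM (ger0_norm (exprn_ge0 _ (ltW e0))).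
    by apply: le_trans ek; rewrite ler_pM// exprn_ge0// ltW.
  have := cP i j; case: (L i j) => a b /= ab.
  rewrite !mul0r subr0 addr0; split; apply: h; apply: le_trans ab.
    by rewrite lerDl.
  by rewrite lerDr.
Qed.

(** Writing N x = u + i v for the complex coordinates in which M is nearly
    diagonal, |u|^2 + |v|^2 is a Lyapunov function. *)
Lemma stable_lyapunov n (M : 'M[R]_n) : stable M ->
  exists Pi : 'M[R]_n, exists2 d : R, 0 < d & [/\ Pi^T = Pi,
    forall x, d * dotv x x <= dotv x (Pi *m x) &
    forall x, 2 * dotv x (Pi *m (M *m x)) <= - d * dotv x x].
Proof.
case: n M => [|n] M sM.
  have v0 (x : 'cV[R]_0) : x = 0 by apply/colP => -[].
  exists 0, 1 => //; split; first by rewrite trmx0.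
    by move=> x; rewrite (v0 x) !dotv0l mulr0.
  by move=> x; rewrite (v0 x) !dotv0l !mulr0.
have [g g0 hN] := stable_near_diagonal sM (ltn0Sn n).
(* With off-diagonal entries at most k, the four off-diagonal forms add up to at
   most half of the diagonal dissipation. *)
pose k := g / (4 * n.+1%:R).
have k0 : 0 < k by rewrite divr_gt0// mulr_gt0// ltr0n.
have [N [L [uN NL dL oL]]] := hN k k0.
pose Nr := re N; pose Ni := im N.
have remap : re (map_mx rc M) = M by apply/matrixP => i j; rewrite !mxE.
have immap : im (map_mx rc M) = 0 by apply/matrixP => i j; rewrite !mxE.
have eqr : Nr *m M = re L *m Nr - im L *m Ni.
  by have := congr1 (@re _ _) NL; rewrite !re_mul remap immap mulmx0 subr0.
have eqi : Ni *m M = re L *m Ni + im L *m Nr.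
  by have := congr1 (@im _ _) NL; rewrite !im_mul remap immap mulmx0 add0r.
pose Pi := Nr^T *m Nr + Ni^T *m Ni.
have qPi x y : dotv x (Pi *m y) =
    dotv (Nr *m x) (Nr *m y) + dotv (Ni *m x) (Ni *m y).
  by rewrite !dotv_mull /Pi mulmxDl dotvDr !mulmxA.
(* x = Re (N^-1 (u + i v)) *)
have [K K0 hK] : exists2 K : R, 0 < K & forall x, dotv x x <= K * dotv x (Pi *m x).
  pose Kr := re (invmx N); pose Ki := im (invmx N).
  have e1 : Kr *m Nr - Ki *m Ni = 1%:M.
    rewrite -re_mul mulVmx//; apply/matrixP => i j.
    by rewrite !mxE; case: (i == j).
  have [a a0 ha] := mul_bound Kr; have [b b0 hb] := mul_bound Ki.
  exists (2 * (1 + a + b)); first by lra.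
  move=> x; rewrite qPi; set u := Nr *m x; set v := Ni *m x.
  have -> : dotv x x = dotv (Kr *m u - Ki *m v) (Kr *m u - Ki *m v).
    by rewrite !mulmxA -mulmxBl e1 mul1mx.
  rewrite dotvBl !dotvBr (dotvC (Ki *m v) (Kr *m u)).
  have := young (Kr *m u) (- (Ki *m v)) ltr01.
  rewrite invr1 !mul1r !dotvNr !dotvNl opprK.
  have := ha u; have := hb v; have := dotv_ge0 u; have := dotv_ge0 v.
  have := mulr_ge0 a0 (dotv_ge0 v); have := mulr_ge0 b0 (dotv_ge0 u).
  lra.
have hM x : 2 * dotv x (Pi *m (M *m x)) <= - g * dotv x (Pi *m x).
  rewrite !qPi !(mulmxA _ M) eqr eqi mulmxBl mulmxDl -!mulmxA.
  set u := Nr *m x; set v := Ni *m x.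
  pose Dr := diag_mx (\row_i re L i i); pose Di := diag_mx (\row_i im L i i).
  pose Er := re L - Dr; pose Ei := im L - Di.
  have Erk i j : `|Er i j| <= k.
    rewrite !mxE; case: eqVneq => [->|/oL[h _]].
      by rewrite mulr1n subrr normr0 ltW.
    by rewrite mulr0n subr0.
  have Eik i j : `|Ei i j| <= k.
    rewrite !mxE; case: eqVneq => [->|/oL[_ h]].
      by rewrite mulr1n subrr normr0 ltW.
    by rewrite mulr0n subr0.
  have -> : re L = Dr + Er by rewrite addrC subrK.
  have -> : im L = Di + Ei by rewrite addrC subrK.
  rewrite !(mulmxDl Dr) !(mulmxDl Di) dotvBr !dotvDr.
  have Dr_le w : dotv w (Dr *m w) <= - g * dotv w w.
    rewrite !dotvE mulr_sumr; apply: ler_sum => i _.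
    rewrite mul_diag_mx !mxE mulrCA ler_wpM2r// -expr2 ?sqr_ge0//.
  have DiC : dotv u (Di *m v) = dotv v (Di *m u).
    by rewrite dotvC dotv_mull tr_diag_mx.
  have := qf_bound u Erk; have := qf_bound v Erk.
  have := bf_bound u v Eik; have := bf_bound v u Eik.
  rewrite !ler_norml => /andP[a1 a2] /andP[a3 a4] /andP[a5 a6] /andP[a7 a8].
  have kn : k * n.+1%:R = g / 4.
    rewrite /k; have : n.+1%:R != 0 :> R by rewrite pnatr_eq0.
    by move: (n.+1%:R) => q q0; field.
  have kn2 (y z : R) : k / 2 * (n.+1%:R * y + n.+1%:R * z) = g / 8 * (y + z).
    by rewrite -mulrDr mulrA (mulrAC k) kn; field.
  move: a1 a2 a3 a4 a5 a6 a7 a8; rewrite !kn2 !kn.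
  have := Dr_le u; have := Dr_le v; have := dotv_ge0 u; have := dotv_ge0 v.
  rewrite DiC; set p1 := dotv u u; set p2 := dotv v v.
  have gp1 := mulr_ge0 (ltW g0) (dotv_ge0 u); have gp2 := mulr_ge0 (ltW g0) (dotv_ge0 v).
  rewrite -/p1 -/p2 in gp1 gp2 *.
  lra.
exists Pi; exists (Order.min K^-1 (g / K)).
  by rewrite lt_min invr_gt0 K0 divr_gt0.
split.
- by rewrite /Pi linearD/= !trmx_mul !trmxK.
- move=> x; apply: (@le_trans _ _ (K^-1 * dotv x x)).
    by rewrite ler_wpM2r ?dotv_ge0// ge_min lexx.
  by rewrite mulrC ler_pdivrMr// mulrC.
- move=> x; apply: (le_trans (hM x)); rewrite !mulNr lerN2.
  apply: (@le_trans _ _ (g / K * dotv x x)).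
    by rewrite ler_wpM2r ?dotv_ge0// ge_min lexx orbT.
  by rewrite -mulrA ler_wpM2l ?(ltW g0)// mulrC ler_pdivrMr// mulrC.
Qed.

End Lyapunov.

(** * Asymptotics of the Riccati equation *)

Section RiccatiAsymptotics.
Context {R : realType}.
Variables (n m p : nat) (A : 'M[R]_n) (B : 'M[R]_(n, m)) (C : 'M[R]_(p, n)).

Local Notation ricc := (ricc A B C).
Local Notation closed_loop := (closed_loop A C).

(** Linear matrix differential equations preserve the positive cone. *)
Lemma lyapunov_ode_ge (F Psi D G : R -> 'M[R]_n) t x :
  inverse_flow F Psi ->
  mcurve D (fun t => F t *m D t + D t *m (F t)^T + G t) ->
  (forall t y, 0 < t -> 0 <= dotv y (G t *m y)) -> 0 <= t ->
  dotv x (D 0 *m x) <= dotv x (Psi t *m D t *m (Psi t)^T *m x).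
Proof.
move=> fP cD G0 t0; have cQ := qf_curve x (flow_conj fP fP cD).
have := rcurve_nondecr cQ (lexx 0) t0.
case: fP => -> _ _; rewrite trmx1 mulmx1 mul1mx; apply=> s /andP[s0 _].
by rewrite qf_conj G0.
Qed.

(** Test the monotone conjugate of D on Psi^{-*} x. *)
Lemma flow_psd (F Psi D G : R -> 'M[R]_n) t x :
  inverse_flow F Psi ->
  mcurve D (fun t => F t *m D t + D t *m (F t)^T + G t) ->
  (forall t y, 0 < t -> 0 <= dotv y (G t *m y)) ->
  (forall y, 0 <= dotv y (D 0 *m y)) -> 0 <= t ->
  0 <= dotv x (D t *m x).
Proof.
move=> fP cD G0 D0 t0; pose z := (invmx (Psi t))^T *m x.
have -> : x = (Psi t)^T *m z.
  by rewrite /z mulmxA -trmx_mul mulVmx ?trmx1 ?mul1mx//; case: fP => _ _ ->.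
by rewrite -qf_conj; apply: le_trans (D0 z) _; exact: lyapunov_ode_ge fP cD _ _.
Qed.

Lemma gram_ge0 k (N : 'M[R]_(n, k)) x : 0 <= dotv x (N *m N^T *m x).
Proof. by have := dotv_ge0 (N^T *m x); rewrite dotv_mull trmxK mulmxA. Qed.

(** Positivity of S tested on w - c^-1 S w gives |S w|^2 <= c w* S w. *)
Lemma psd_norm_le (S : 'M[R]_n) (c : R) (w : 'cV[R]_n) : S^T = S ->
  0 < c -> (forall x, 0 <= dotv x (S *m x)) ->
  (forall x, dotv x (S *m x) <= c * dotv x x) ->
  dotv (S *m w) (S *m w) <= c ^+ 2 * dotv w w.
Proof.
move=> sS c0 S0 Sc; set z := S *m w.
have wz : dotv w (S *m z) = dotv z z by rewrite -{1}sS -dotv_mull.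
have := S0 (w - c^-1 *: z).
rewrite mulmxBr -scalemxAr dotvBr !dotvBl !dotvZl !dotvZr wz -/z => h.
have := Sc z; have := Sc w; rewrite -/z => h1 h2.
have e : c^-1 * (c^-1 * dotv z (S *m z)) <= c^-1 * dotv z z.
  by rewrite ler_wpM2l ?invr_ge0 ?(ltW c0)// ler_pdivrMl.
have {h e} : c^-1 * dotv z z <= dotv w z by lra.
rewrite ler_pdivrMl// => h; apply: (le_trans h).
by rewrite expr2 -mulrA ler_wpM2l// ltW.
Qed.

(** Writing A = F + S C* C, with F the closed loop, leaves S C* C S with a positive
    sign, so that the forcing of F S + S F* is positive semidefinite. *)
Lemma riccati_lyapunov (S : R -> 'M[R]_n) : mcurve S (fun t => ricc (S t)) ->
  (S 0)^T = S 0 ->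
  mcurve S (fun t => closed_loop (S t) *m S t + S t *m (closed_loop (S t))^T
    + (B *m B^T + (S t *m C^T) *m (S t *m C^T)^T)).
Proof.
move=> hS S0; apply: (mcurve_ext hS) => // t t0.
have sS := riccati_sym hS S0 (ltW t0).
rewrite /ricc /closed_loop linearB/= !trmx_mul !trmxK sS.
rewrite !mulmxBl !mulmxBr !mulmxA.
apply/matrixP => i j; rewrite !mxE; ring.
Qed.

Section Solution.
Variables (S0 : 'M[R]_n) (S : R -> 'M[R]_n).
Hypotheses (hS : mcurve S (fun t => ricc (S t))) (hS0 : S 0 = S0)
  (S0pos : pos_def S0).

Lemma solution_sym t : 0 <= t -> (S t)^T = S t.
Proof. by apply: (riccati_sym hS); rewrite hS0; case: S0pos. Qed.

Lemma pos_def_ge0 (M : 'M[R]_n) x : pos_def M -> 0 <= dotv x (M *m x).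
Proof.
move=> [_ M0]; have [->|/M0/ltW//] := eqVneq x 0.
by rewrite mulmx0 dotv0r.
Qed.

Let G t := B *m B^T + (S t *m C^T) *m (S t *m C^T)^T.

Let G0 t x : 0 <= dotv x (G t *m x).
Proof. by rewrite mulmxDl dotvDr addr_ge0 ?gram_ge0. Qed.

Let lyapS : mcurve S (fun t => closed_loop (S t) *m S t
  + S t *m (closed_loop (S t))^T + G t).
Proof. by apply: riccati_lyapunov hS _; rewrite hS0; case: S0pos. Qed.

Lemma solution_psd t x : 0 <= t -> 0 <= dotv x (S t *m x).
Proof.
have [Psi fP] := riccati_inverse_flow hS.
apply: (flow_psd x fP lyapS) => [s y _|y]; first exact: G0.
by rewrite hS0; exact: pos_def_ge0.
Qed.

Hypothesis hdet : detectable A C.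

(** With K such that A - KC is stable, c Pi^-1 - S satisfies a linear equation
    with generator A - KC and nonnegative forcing as soon as c is large. *)
Lemma solution_bounded : exists2 c : R, 0 < c &
  forall t x, 0 <= t -> dotv x (S t *m x) <= c * dotv x x.
Proof.
have [K sM] := hdet; set M := A - K *m C in sM.
have [Pi [d d0 [sPi Pi_ge PiM]]] := stable_lyapunov sM.
have Pi_unit : Pi \in unitmx.
  apply: pos_unitmx => x x0; apply: lt_le_trans (Pi_ge x).
  rewrite mulr_gt0// lt_neqAle dotv_ge0 andbT eq_sym.
  by apply: contra_neq x0; exact: dotv_eq0.
have [k k0 kP] := mul_bound Pi.
pose L := invmx Pi.
have sL : L^T = L by rewrite trmx_inv sPi.
pose e := d / (k + 1).
have e0 : 0 < e by rewrite divr_gt0// ltr_wpDl.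
have Pi_lb y : e * dotv (Pi *m y) (Pi *m y) <= d * dotv y y.
  rewrite /e -mulrA ler_wpM2l ?(ltW d0)// mulrC ler_pdivrMr ?ltr_wpDl//.
  by rewrite mulrC (le_trans (kP y))// ler_wpM2r ?dotv_ge0// lerDl.
have L_ge x : e * dotv x x <= dotv x (L *m x).
  pose y := L *m x; have -> : x = Pi *m y by rewrite mulKVmx.
  by rewrite mulKmx// dotvC; apply: le_trans (Pi_ge y); exact: Pi_lb.
have LM_le x : 2 * dotv x (M *m (L *m x)) <= - e * dotv x x.
  pose y := L *m x; have -> : x = Pi *m y by rewrite mulKVmx.
  rewrite mulKmx// dotv_mull sPi; apply: le_trans (PiM y) _.
  by rewrite !mulNr lerN2; exact: Pi_lb.
have [b1 b10 hb1] := mul_bound B^T; have [b2 b20 hb2] := mul_bound K^T.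
have [b3 b30 hb3] : exists2 b3 : R, 0 <= b3 &
    forall x, dotv x (S0 *m x) <= b3 * dotv x x.
  exists ((\sum_ij `|S0 ij.1 ij.2|) * n%:R); first by rewrite mulr_ge0// sumr_ge0.
  move=> x; apply: le_trans (ler_norm _) _; apply: qf_bound => i j.
  by rewrite (bigD1 (i, j))//= lerDl sumr_ge0.
(* b1 and b2 absorb the terms BB* and KK* of the forcing, b3 the initial value. *)
pose c := (b1 + b2 + b3) / e.
have ce : c * e = b1 + b2 + b3 by rewrite /c divfK// gt_eqF.
have c0 : 0 <= c by rewrite divr_ge0 ?(ltW e0)// !addr_ge0.
have [PsiM fM] := const_flow M.
pose D t := c *: L - S t.
pose H t := K - S t *m C^T.
pose GD t := - (c *: (M *m L + L *m M^T)) - B *m B^T - K *m K^T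
  + H t *m (H t)^T.
have cD : mcurve D (fun t => M *m D t + D t *m M^T + GD t).
  apply: (mcurve_ext (mcurveB (mcurve_cst (c *: L)) hS)) => // t t0.
  have sS := solution_sym (ltW t0).
  rewrite /D /GD /H [(K - S t *m C^T)^T]linearB/= [(S t *m C^T)^T]trmx_mul trmxK sS.
  rewrite [M^T]linearB/= [(K *m C)^T]trmx_mul /M /ricc.
  rewrite !(mulmxBl, mulmxBr) -!scalemxAl -!scalemxAr !mulmxA.
  apply/matrixP => i j; rewrite !mxE; ring.
have GD0 t x : 0 <= dotv x (GD t *m x).
  pose X1 := M *m L + L *m M^T.
  rewrite /GD -/X1 mulmxDl dotvDr addr_ge0 ?gram_ge0//.
  rewrite !mulmxBl !mulNmx !dotvBr dotvNr -scalemxAl dotvZr /X1 mulmxDl dotvDr.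
  rewrite -!mulmxA.
  have -> : dotv x (L *m (M^T *m x)) = dotv x (M *m (L *m x)).
    by rewrite -[in LHS]sL -dotv_mull -dotv_mull dotvC.
  have h1 := hb1 x; have h2 := hb2 x.
  rewrite dotv_mull trmxK in h1; rewrite dotv_mull trmxK in h2.
  have h3 := ler_wpM2l c0 (LM_le x).
  rewrite mulNr mulrN (mulrA c e) ce in h3.
  have := mulr_ge0 b30 (dotv_ge0 x); lra.
have D0 x : 0 <= dotv x (D 0 *m x).
  rewrite /D hS0 mulmxBl -scalemxAl dotvBr dotvZr subr_ge0.
  apply: (le_trans (hb3 x)).
  have := ler_wpM2l c0 (L_ge x); rewrite mulrA ce.
  have := mulr_ge0 b10 (dotv_ge0 x); have := mulr_ge0 b20 (dotv_ge0 x); lra.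
have [l l0 hl] : exists2 l : R, 0 <= l & forall x, dotv x (L *m x) <= l * dotv x x.
  exists ((\sum_ij `|L ij.1 ij.2|) * n%:R); first by rewrite mulr_ge0// sumr_ge0.
  move=> x; apply: le_trans (ler_norm _) _; apply: qf_bound => i j.
  by rewrite (bigD1 (i, j))//= lerDl sumr_ge0.
exists (c * l + 1); first by rewrite ltr_wpDl// mulr_ge0.
move=> t x t0; have := flow_psd x fM cD (fun s y _ => GD0 s y) D0 t0.
rewrite /D mulmxBl -scalemxAl dotvBr dotvZr.
have := ler_wpM2l c0 (hl x); have := dotv_ge0 x; lra.
Qed.

Variable Psi : R -> 'M[R]_n.
Hypothesis fP : inverse_flow (fun t => closed_loop (S t)) Psi.

Lemma flow_curve : mcurve (fun t => invmx (Psi t))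
  (fun t => closed_loop (S t) *m invmx (Psi t)).
Proof.
have [_ cP uP] := fP; apply: (mcurve_ext (mcurve_inv cP uP)) => // t t0.
by rewrite mulmxN mulNmx opprK mulKmx// uP// ltW.
Qed.

(** The information x* S^-1 x dissipates the output energy |C x|^2 along the
    closed-loop flow, so the output is square integrable; by detectability and
    boundedness of S the state then tends to 0. *)
Lemma flow_decay (x0 : 'cV[R]_n) :
  dotv (invmx (Psi t) *m x0) (invmx (Psi t) *m x0) @[t --> +oo] --> (0 : R).
Proof.
have [Psi0 cP uP] := fP.
pose x t := invmx (Psi t) *m x0.
have cx : mcurve x (fun t => closed_loop (S t) *m x t).
  by apply: (mcurve_ext (mcurveMr x0 flow_curve)) => // t _; rewrite mulmxA.
(* v t = x0* N^-1 x0 equals x* S^-1 x, but N is invertible because it increases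
   from S 0. *)
pose N t := Psi t *m S t *m (Psi t)^T.
have cN : mcurve N (fun t => Psi t *m G t *m (Psi t)^T) by exact: flow_conj fP fP lyapS.
have N_ge t y : 0 <= t -> dotv y (S0 *m y) <= dotv y (N t *m y).
  move=> t0; rewrite -hS0.
  exact: (lyapunov_ode_ge y fP lyapS (fun s y _ => G0 s y) t0).
have uN t : 0 <= t -> N t \in unitmx.
  move=> t0; apply: pos_unitmx => y y0; apply: lt_le_trans (N_ge t y t0).
  by case: S0pos => _; exact.
have sN t : 0 <= t -> (N t)^T = N t.
  by move=> t0; rewrite /N !trmx_mul trmxK solution_sym// mulmxA.
pose v t := dotv x0 (invmx (N t) *m x0).
have cv := qf_curve x0 (mcurve_inv cN uN); rewrite -/v in cv.
have v_ge0 t : 0 <= t -> 0 <= v t.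
  move=> t0; have e : N t *m (invmx (N t) *m x0) = x0 by rewrite mulKVmx ?uN.
  rewrite /v -{1}e; set y := invmx (N t) *m x0.
  by rewrite dotvC; apply: le_trans (N_ge t y t0); exact: pos_def_ge0.
have v'_le t : 0 < t ->
    dotv x0 (- (invmx (N t) *m (Psi t *m G t *m (Psi t)^T) *m invmx (N t)) *m x0)
    <= - dotv (C *m x t) (C *m x t).
  move=> t0; have t0' := ltW t0.
  pose w := (Psi t)^T *m (invmx (N t) *m x0).
  have Sw : S t *m w = x t.
    have e : N t *m (invmx (N t) *m x0) = x0 by rewrite mulKVmx ?uN.
    rewrite /w /x -[in RHS]e; set y := invmx (N t) *m x0.
    by rewrite /N -!mulmxA mulKmx// uP.
  rewrite mulNmx dotvNr lerN2.
  have -> : dotv x0 (invmx (N t) *m (Psi t *m G t *m (Psi t)^T) *m invmx (N t) *m x0)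
      = dotv w (G t *m w).
    have eN : invmx (N t) = (invmx (N t))^T by rewrite trmx_inv sN.
    by rewrite /w !dotv_mull trmxK -eN !mulmxA.
  have -> : C *m x t = (S t *m C^T)^T *m w.
    by rewrite trmx_mul trmxK solution_sym// -mulmxA Sw.
  rewrite mulmxDl dotvDr dotv_mull trmxK mulmxA lerDr.
  exact: gram_ge0.
have [K sM] := hdet; set M := A - K *m C in sM.
have [Pi [d d0 [sPi Pi_ge PiM]]] := stable_lyapunov sM.
have [c c0 Sc] := solution_bounded.
have [k1 k10 hk1] := mul_bound Pi; have [k2 k20 hk2] := mul_bound K.
have [k3 k30 hk3] := mul_bound C^T.
have [k4 k40 hk4] : exists2 k4 : R, 0 < k4 & forall y, dotv y (Pi *m y) <= k4 * dotv y y.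
  exists ((\sum_ij `|Pi ij.1 ij.2|) * n%:R + 1); first by rewrite ltr_wpDl// mulr_ge0// sumr_ge0.
  move=> y; rewrite mulrDl mul1r -[leLHS]addr0 lerD ?dotv_ge0//.
  apply: le_trans (ler_norm _) _; apply: qf_bound => i j.
  by rewrite (bigD1 (i, j))//= lerDl sumr_ge0.
pose kap := k1 * (2 * (k2 + c ^+ 2 * k3)).
have kap0 : 0 <= kap by rewrite !mulr_ge0// addr_ge0// mulr_ge0// sqr_ge0.
pose H t := K - S t *m C^T.
have Hbd t z : 0 <= t -> dotv (Pi *m (H t *m z)) (Pi *m (H t *m z)) <= kap * dotv z z.
  move=> t0; apply: (le_trans (hk1 _)); rewrite /kap -mulrA ler_wpM2l//.
  rewrite /H mulmxBl -mulmxA; set a := K *m z; set b := S t *m _.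
  have ha := hk2 z; rewrite -/a in ha.
  have hb : dotv b b <= c ^+ 2 * (k3 * dotv z z).
    apply: (le_trans (psd_norm_le (C^T *m z) (solution_sym t0) c0 _ _)).
    - by move=> y; exact: solution_psd.
    - by move=> y; exact: Sc.
    - by rewrite ler_wpM2l ?sqr_ge0.
  rewrite dotvBl !dotvBr (dotvC b a).
  have := young a (- b) ltr01; rewrite invr1 !mul1r !dotvNr !dotvNl opprK.
  lra.
have cg : rcurve (fun t => dotv (x t) (Pi *m x t))
    (fun t => 2 * dotv (x t) (Pi *m (closed_loop (S t) *m x t))).
  apply: (rcurve_ext (dotv_curve cx (mcurveMl Pi cx))) => // t _.
  by rewrite -{1}sPi -dotv_mull dotvC -mulr2n mulr_natl.
(* Young's inequality splits the cross term of the derivative of x* Pi x into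
   half of the dissipation d |x|^2 and (2 kap / d) |C x|^2; the latter is
   absorbed by the multiple 2 kap / d of the information v. *)
have cl := rcurveZ (2 * kap / d) cv.
have lam0 : 0 <= 2 * kap / d by rewrite divr_ge0 ?(ltW d0)// mulr_ge0.
have dk0 : 0 < d / 2 / k4 by rewrite !divr_gt0.
have hg := decay_to0 dk0 cg cl.
have {hg} : dotv (x t) (Pi *m x t) @[t --> +oo] --> (0 : R).
  apply: hg.
  - by move=> t _; apply: le_trans (Pi_ge _); rewrite mulr_ge0 ?dotv_ge0// ltW.
  - by move=> t t0; rewrite mulr_ge0// v_ge0.
  - move=> t t0; rewrite mulr_ge0_le0//; apply: (le_trans (v'_le _ t0)).
    by rewrite oppr_le0 dotv_ge0.
  move=> t t0.
  have h1 := ler_wpM2l lam0 (v'_le t t0).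
  have -> : closed_loop (S t) *m x t = M *m x t + H t *m (C *m x t).
    rewrite /closed_loop /M /H !mulmxBl !mulmxA.
    by rewrite addrA subrK.
  rewrite mulmxDr dotvDr mulrDr.
  have h2 := PiM (x t).
  have h3 := young (x t) (Pi *m (H t *m (C *m x t))) (divr_gt0 d0 (ltr0n R 2)).
  have h4 := Hbd t (C *m x t) (ltW t0).
  have h5 : (d / 2)^-1 * dotv (Pi *m (H t *m (C *m x t))) (Pi *m (H t *m (C *m x t)))
      <= 2 * kap / d * dotv (C *m x t) (C *m x t).
    rewrite (_ : (d / 2)^-1 = 2 / d); last by rewrite invfM invrK mulrC.
    rewrite [leRHS](_ : _ = 2 / d * (kap * dotv (C *m x t) (C *m x t))); last by ring.
    by rewrite ler_wpM2l// divr_ge0// ltW.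
  have h6 : d / 2 / k4 * dotv (x t) (Pi *m x t) <= d / 2 * dotv (x t) (x t).
    rewrite -mulrA ler_wpM2l ?divr_ge0 ?(ltW d0)// mulrC ler_pdivrMr//.
    by rewrite mulrC hk4.
  rewrite mulNr; lra.
move=> hg.
have : d^-1 * dotv (x t) (Pi *m x t) @[t --> +oo] --> d^-1 * (0 : R).
  by apply: cvgM => //; exact: cvg_cst.
rewrite mulr0; apply: squeeze_cvgr (cvg_cst _) => //.
near=> t; rewrite dotv_ge0/= mulrC ler_pdivlMr// mulrC; exact: Pi_ge.
Unshelve. all: by end_near. Qed.

(** Apply the decay of the state to the columns of the transition matrix. *)
Lemma flow_entry_decay i j : invmx (Psi t) i j @[t --> +oo] --> (0 : R).
Proof.
have := flow_decay (delta_mx j 0) => /cvgrPdist_lt h.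
apply/cvgrPdist_lt => e e0; have := h (e ^+ 2) (exprn_gt0 _ e0).
apply: filterS => t; rewrite !sub0r !normrN (ger0_norm (dotv_ge0 _)) => ht.
rewrite -(@ltr_pXn2r _ 2%N)// ?nnegrE ?(ltW e0)// real_normK ?num_real//.
apply: le_lt_trans ht; have := sqr_le_dotv (invmx (Psi t) *m delta_mx j 0) i.
by rewrite -colE mxE.
Qed.

(** The solution restarted at time r exceeds the original one by at most
    Phi (S r - S 0) Phi*, which is small uniformly in r. *)
Lemma solution_almost_nonincr x : exists2 e : R -> R,
  e t @[t --> +oo] --> (0 : R) & forall r t, 0 <= r -> 0 <= t ->
  dotv x (S (r + t) *m x) <= dotv x (S t *m x) + e t.
Proof.
have [c c0 Sc] := solution_bounded.
pose y t := (invmx (Psi t))^T *m x.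
exists (fun t => c * dotv (y t) (y t)).
  under eq_fun do rewrite mulrC; apply: cvgM0 (cvg_cst c).
  under eq_fun do rewrite dotvE; apply: cvgr_sum0 => i.
  have yi : y t i 0 @[t --> +oo] --> (0 : R).
    under eq_fun do rewrite mxE; apply: cvgr_sum0 => k.
    apply: cvgM0 (cvg_cst _); under eq_fun do rewrite mxE.
    exact: flow_entry_decay.
  exact: (cvgM0 yi yi).
move=> r t r0 t0.
pose D t := S t - S (r + t).
have cD : mcurve D (fun t => closed_loop (S t) *m D t
    + D t *m (closed_loop (S t))^T + (D t *m C^T) *m (D t *m C^T)^T).
  have cS2 : mcurve (fun t => S (r + t)) (fun t => ricc (S (r + t))).
    by move=> i j; exact: (rcurve_shift r0 (hS i j)).
  apply: (mcurve_ext (mcurveB hS cS2)) => // s s0.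
  have s1 := solution_sym (ltW s0); have s2 := solution_sym (addr_ge0 r0 (ltW s0)).
  rewrite /D [(closed_loop _)^T]linearB/= [(S s *m _ *m _)^T]trmx_mul [(S s *m C^T)^T]trmx_mul.
  rewrite [(_ *m C^T)^T]trmx_mul [(S s - _)^T]linearB/= !trmxK s1 s2 /ricc /closed_loop.
  rewrite !(mulmxBl, mulmxBr) !mulmxA.
  apply/matrixP => i j; rewrite !mxE; ring.
have := lyapunov_ode_ge (y t) fP cD (fun s z _ => gram_ge0 _ z) t0.
rewrite qf_conj.
have -> : (Psi t)^T *m y t = x.
  by rewrite /y mulmxA -trmx_mul mulVmx ?trmx1 ?mul1mx//; case: fP => _ _ ->.
rewrite /D addr0 !mulmxBl !dotvBr hS0.
have := Sc r (y t) r0; have := pos_def_ge0 (y t) S0pos; lra.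
Qed.

End Solution.

(** The limit is the infimum of q + e: a late value of q exceeds an early one by
    at most e of the early time. *)
Lemma almost_nonincr_cvg (q e : R -> R) : (forall t, 0 <= t -> 0 <= q t) ->
  e t @[t --> +oo] --> (0 : R) ->
  (forall r t, 0 <= r -> 0 <= t -> q (r + t) <= q t + e t) ->
  exists l : R, q t @[t --> +oo] --> l.
Proof.
move=> q0 e0 qe.
pose V := [set q t + e t | t in [set t | 0 <= t]].
have hV : has_inf V.
  split; first by exists (q 0 + e 0), 0 => //=; exact: lexx.
  exists 0 => _ [t/= t0 <-]; apply: le_trans (qe 0 t (lexx 0) t0).
  by rewrite add0r q0.
exists (inf V); apply/cvgrPdist_le => a a0.
have [_ [s /= s0 <-] sV] := inf_adherent a0 hV.
near=> t.
have st : s <= t by near: t; apply: nbhs_pinfty_ge; exact: num_real.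
have t0 := le_trans s0 st.
have et : `|0 - e t| <= a.
  near: t; have /cvgrPdist_le := e0; exact.
have := qe (t - s) s; rewrite subr_ge0 subrK => /(_ st s0) h.
have : inf V <= q t + e t by apply: ge_inf; [case: hV|exists t].
move: et; rewrite !ler_norml => /andP[a1 a2] h2.
by apply/andP; split; lra.
Unshelve. all: by end_near. Qed.

(** Each quadratic form converges; polarization then gives the entries. *)
Lemma riccati_cvg (S : R -> 'M[R]_n) : detectable A C ->
  mcurve S (fun t => ricc (S t)) -> pos_def (S 0) ->
  exists Sinf : 'M[R]_n, forall i j, S t i j @[t --> +oo] --> Sinf i j.
Proof.
move=> hdet cS S0; have [Psi fP] := riccati_inverse_flow cS.
have hq x : exists l : R, dotv x (S t *m x) @[t --> +oo] --> l.
  have [e e0 he] := solution_almost_nonincr cS erefl S0 hdet fP x.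
  apply: almost_nonincr_cvg e0 he => t t0.
  exact: (solution_psd cS erefl S0).
have [l lP] := choice hq.
pose d i : 'cV[R]_n := delta_mx i 0.
(* Polarization. *)
exists (\matrix_(i, j) ((l (d i + d j) - l (d i) - l (d j)) / 2)) => i j.
rewrite mxE.
have qd k r t : dotv (d k) (S t *m d r) = S t k r.
  by rewrite /dotv trmx_delta -rowE -colE !mxE.
have h : (dotv (d i + d j) (S t *m (d i + d j)) - dotv (d i) (S t *m d i)
    - dotv (d j) (S t *m d j)) / 2 @[t --> +oo] -->
    (l (d i + d j) - l (d i) - l (d j)) / 2.
  by apply: cvgM; [do 2 (apply: cvgB => //)|exact: cvg_cst].
apply: cvg_trans h; apply: near_eq_cvg; near=> t.
have t0 : 0 <= t by near: t; apply: nbhs_pinfty_ge; exact: num_real.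
rewrite mulmxDr dotvDl !dotvDr !qd.
have -> : S t j i = S t i j.
  by rewrite -[in LHS](solution_sym cS erefl S0 t0) mxE.
by field.
Unshelve. all: by end_near. Qed.

Lemma conj_decay (Phi1 Phi2 : R -> 'M[R]_n) (D : 'M[R]_n) i j :
  (forall i j, Phi1 t i j @[t --> +oo] --> (0 : R)) ->
  (forall i j, Phi2 t i j @[t --> +oo] --> (0 : R)) ->
  (Phi1 t *m D *m (Phi2 t)^T) i j @[t --> +oo] --> (0 : R).
Proof.
move=> h1 h2; under eq_fun do rewrite mxE.
apply: cvgr_sum0 => k; apply: (@cvgM0 _ _ _ _ _ _ 0).
  under eq_fun do rewrite mxE; apply: cvgr_sum0 => l.
  exact: cvgM0 (h1 i l) (cvg_cst _).
under eq_fun do rewrite mxE.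
exact: h2.
Qed.

(** The two closed-loop transition matrices tend to 0 and carry the initial
    difference to the current one. *)
Lemma riccati_diff_decay (S1 S2 : R -> 'M[R]_n) i j : detectable A C ->
  mcurve S1 (fun t => ricc (S1 t)) -> pos_def (S1 0) ->
  mcurve S2 (fun t => ricc (S2 t)) -> pos_def (S2 0) ->
  S1 t i j - S2 t i j @[t --> +oo] --> (0 : R).
Proof.
move=> hdet c1 p1 c2 p2.
have [Psi1 f1] := riccati_inverse_flow c1.
have [Psi2 f2] := riccati_inverse_flow c2.
have f2' : inverse_flow (fun t => closed_loop (S2 t)^T) Psi2.
  case: f2 => e cP uP; split=> //; apply: (mcurve_ext cP) => // t t0.
  by rewrite (solution_sym c2 erefl p2 (ltW t0)).
have h := @conj_decay (fun t => invmx (Psi1 t)) (fun t => invmx (Psi2 t))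
  (S1 0 - S2 0) i j (flow_entry_decay c1 erefl p1 hdet f1)
  (flow_entry_decay c2 erefl p2 hdet f2).
apply: cvg_trans h; apply: near_eq_cvg; near=> t.
have t0 : 0 <= t by near: t; apply: nbhs_pinfty_ge; exact: num_real.
rewrite -(riccati_diff c1 c2 f1 f2' t0).
have u1 : Psi1 t \in unitmx by case: f1 => _ _ ->.
have u2 : Psi2 t \in unitmx by case: f2 => _ _ ->.
rewrite trmx_inv mulmxA mulmxK ?unitmx_tr// mulKmx//.
by rewrite !mxE.
Unshelve. all: by end_near. Qed.

End RiccatiAsymptotics.

Lemma mx_cvg (R : realType) m n (T : Type) (F : set_system T) {FF : Filter F}
    (f : T -> 'M[R]_(m, n)) (M : 'M[R]_(m, n)) :
  (forall i j, f x i j @[x --> F] --> M i j) -> f x @[x --> F] --> M.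
Proof.
move=> fM; apply/cvg_ballP => e e0.
have h : \forall x \near F, forall ij : 'I_m * 'I_n, ball (M ij.1 ij.2) e (f x ij.1 ij.2).
  apply: filter_forall => -[i j]; have /cvg_ballP := fM i j; exact.
by apply: filterS h => x hx; split=> // i j; exact: (hx (i, j)).
Qed.

(** * Left-endpoint sums along uniform partitions *)

Section PartitionSums.
Context {R : realType}.

(** Heine's theorem, in the form needed for uniform partitions. *)
Lemma ray_cont_uniform (y : R -> R) (t eta : R) : ray_cont y -> 0 < eta ->
  exists2 dl : R, 0 < dl & forall a b, 0 <= a <= t -> 0 <= b <= t ->
    `|a - b| < dl -> `|y a - y b| <= eta.
Proof.
move=> /subspace_continuousP cy eta0.
have /compact_near_coveringP h := @segment_compact R 0 t.
pose P (dl x : R) := 0 <= x <= t -> forall b, 0 <= b <= t ->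
    `|x - b| < dl -> `|y x - y b| <= eta.
have nP : \forall dl \near (0 : R)^'+, `[0, t] `<=` P dl.
  apply: h => x; rewrite /= in_itv/= => /andP[x0 xt].
  have /cvgrPdist_le/(_ _ (divr_gt0 eta0 (ltr0n R 2))) : y z @[z --> within `[0, +oo[ (nbhs x)] --> y x.
    by apply: cy; rewrite /= in_itv/= andbT.
  move=> /nbhs_ballP[r /= r0 hr].
  have {}hr z : 0 <= z -> `|x - z| < r -> `|y x - y z| <= eta / 2.
    by move=> z0 xz; apply: hr => //=; rewrite in_itv/= andbT.
  near=> z dl => z0t b b0t zb.
  have xz : `|x - z| < r / 2 by near: z; apply: (@cvgr_dist_lt _ _ _ _ _ id x) => //; rewrite divr_gt0.
  have dr : dl < r / 2 by near: dl; apply: nbhs_right_lt; rewrite divr_gt0.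
  have h1 : `|y x - y z| <= eta / 2.
    by apply: hr; [case/andP: z0t|rewrite (lt_le_trans xz)// ler_pdivrMr// ler_peMr ?(ltW r0)// ler1n].
  have h2 : `|y x - y b| <= eta / 2.
    apply: hr; first by case/andP: b0t.
    apply: (le_lt_trans (ler_distD z x b)); rewrite (splitr r).
    by apply: ltrD => //; exact: lt_trans zb dr.
  rewrite (_ : y z - y b = (y x - y b) - (y x - y z)); last by ring.
  apply: (le_trans (ler_normB _ _)); lra.
have [dl [dl0 hdl]] : exists dl : R, 0 < dl /\ `[0, t] `<=` P dl.
  near (0 : R)^'+ => dl; exists dl; split => //.
  by near: dl; exact: nP.
exists dl => // a b at0 bt; apply: hdl => //.
Unshelve. all: by end_near. Qed.

Definition node (t : R) (N i : nat) := t * i%:R / N.+1%:R.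

Lemma node0 t N : node t N 0 = 0.
Proof. by rewrite /node mulr0 mul0r. Qed.

Lemma node_last t N : node t N N.+1 = t.
Proof. by rewrite /node mulfK// pnatr_eq0. Qed.

Lemma nodeS t N i : node t N i.+1 - node t N i = t / N.+1%:R.
Proof. by rewrite /node -mulrBl -mulrBr -natr1 addrAC subrr add0r mulr1. Qed.

Lemma mesh_mul (t : R) N : N.+1%:R * (t / N.+1%:R) = t.
Proof. by rewrite mulrC divfK// pnatr_eq0. Qed.

Lemma node_le t N i j : 0 <= t -> (i <= j)%N -> node t N i <= node t N j.
Proof.
by move=> t0 ij; rewrite /node ler_wpM2r// ler_wpM2l// ler_nat.
Qed.

Lemma node_ge0 t N i : 0 <= t -> 0 <= node t N i.
Proof. by move=> t0; rewrite -(node0 t N) node_le. Qed.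

Definition node_sum (g y : R -> R) (t : R) (N : nat) :=
  \sum_(0 <= i < N.+1) g (node t N i) * (y (node t N i.+1) - y (node t N i)).

Lemma mesh_eventually (t dl : R) : 0 < dl -> \forall N \near \oo, t / N.+1%:R < dl.
Proof.
move=> dl0; near=> N; rewrite ltr_pdivrMr// mulrC -ltr_pdivrMr//.
have : (`|t / dl| < N%:R).
  by near: N; exact: nbhs_infty_gtr.
move=> h; apply: le_lt_trans (ler_norm _) _; apply: (lt_trans h).
by rewrite ltr_nat.
Unshelve. all: by end_near. Qed.

(** Local errors of relative size err over N+1 steps of length h add up to at most
    err times the total length. *)
Lemma telescope_err (u : nat -> R) (err h : R) N (v : nat -> R) :
  (forall i, (i <= N)%N -> `|u i - (v i.+1 - v i)| <= err * h) ->
  `|\sum_(0 <= i < N.+1) u i - (v N.+1 - v 0)| <= err * (N.+1%:R * h).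
Proof.
move=> uv; rewrite -telescope_sumr// -sumrB.
apply: le_trans (ler_norm_sum _ _ _) _.
apply: (@le_trans _ _ (\sum_(0 <= i < N.+1) err * h)).
  by rewrite !big_mkord; apply: ler_sum => i _; apply: uv; rewrite -ltnS.
by rewrite sumr_const_nat subn0 mulr_natl mulrnAr.
Qed.

(** Compared with the increments of the primitive q, each term of the sum has an
    error controlled by the modulus of continuity of f. *)
Lemma riemann_sum_cvg (q f : R -> R) t : rcurve q f -> ray_cont f -> 0 <= t ->
  node_sum f (fun t => t) t N @[N --> \oo] --> q t - q 0.
Proof.
move=> cq cf t0; apply/cvgrPdist_le => e e0.
have t1 : 0 < t + 1 by rewrite ltr_wpDl.
have [dl dl0 fu] := @ray_cont_uniform f t (e / (t + 1)) cf (divr_gt0 e0 t1).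
near=> N; rewrite distrC.
have tN : t / N.+1%:R < dl by near: N; exact: mesh_eventually.
have := @telescope_err (fun i => f (node t N i) * (node t N i.+1 - node t N i))
  (e / (t + 1)) (t / N.+1%:R) N (fun i => q (node t N i)).
rewrite node_last node0 => h; apply: le_trans (h _) _; last first.
  by rewrite mesh_mul mulrAC ler_pdivrMr// ler_wpM2l ?(ltW e0)// lerDl.
move=> i iN; rewrite -(nodeS t N i).
set a := node t N i; set b := node t N i.+1.
have ab : a <= b by rewrite node_le.
have a0 : 0 <= a by exact: node_ge0.
have bt : b <= t by rewrite -[leRHS](node_last t N) node_le.
have c1 := rcurveB (rcurveZ (f a) rcurve_id) cq.
have := rcurve_lip (k := e / (t + 1)) a0 ab c1.
rewrite (_ : _ - _ - _ = f a * (b - a) - (q b - q a)); last by ring.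
apply=> x /andP[ax xb]; rewrite mulr1; apply: fu.
- by rewrite a0 (le_trans ab bt).
- by rewrite (le_trans a0 (ltW ax)) (le_trans (ltW xb) bt).
- rewrite distrC ger0_norm ?subr_ge0 ?(ltW ax)//.
  apply: lt_trans tN; rewrite -(nodeS t N i) -/a -/b; lra.
Unshelve. all: by end_near. Qed.

(** Summation by parts: left sums of g dy converge for continuous y of unbounded
    variation, because g has bounded derivative. *)
Lemma stieltjes_sum_cvg (g g' y b : R -> R) t : rcurve g g' -> ray_cont g' ->
  ray_cont y -> rcurve b (fun t => g' t * y t) -> y 0 = 0 -> b 0 = 0 -> 0 <= t ->
  node_sum g y t N @[N --> \oo] --> g t * y t - b t.
Proof.
move=> cg cg' cy cb y0 b0 t0; apply/cvgrPdist_le => e e0.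
have [k k0 kP] := ray_cont_bounded t cg'.
pose eta := e / ((k + 1) * (t + 1)).
have kt0 : 0 < (k + 1) * (t + 1) by rewrite mulr_gt0// ltr_wpDl.
have eta0 : 0 < eta by rewrite divr_gt0.
have [dl dl0 yu] := @ray_cont_uniform y t eta cy eta0.
near=> N; rewrite distrC.
have tN : t / N.+1%:R < dl by near: N; exact: mesh_eventually.
have := @telescope_err
  (fun i => g (node t N i) * (y (node t N i.+1) - y (node t N i)))
  (k * eta) (t / N.+1%:R) N
  (fun i => g (node t N i) * y (node t N i) - b (node t N i)).
rewrite node_last node0 y0 b0 mulr0 !subr0 => h; apply: le_trans (h _) _; last first.
  rewrite mesh_mul /eta mulrA mulrAC ler_pdivrMr//.
  have kt : k * t <= (k + 1) * (t + 1) by rewrite ler_pM// lerDl.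
  have := ler_wpM2l (ltW e0) kt; lra.
move=> i iN; rewrite -(nodeS t N i).
set a := node t N i; set c := node t N i.+1.
have ac : a <= c by rewrite node_le.
have a0 : 0 <= a by exact: node_ge0.
have ct : c <= t by rewrite -[leRHS](node_last t N) node_le.
have c1 := rcurveB cb (rcurveZ (y c) cg).
have := rcurve_lip (k := k * eta) a0 ac c1.
rewrite (_ : _ - _ - _ = g a * (y c - y a) - (g c * y c - b c - (g a * y a - b a))); last by ring.
apply=> x /andP[ax xc]; rewrite (_ : _ - _ = g' x * (y x - y c)); last by ring.
have xt : 0 <= x <= t by rewrite (le_trans a0 (ltW ax)) (le_trans (ltW xc) ct).
rewrite normrM ler_pM// ?kP//; apply: yu => //.
- by rewrite (le_trans a0 ac).
- rewrite distrC ger0_norm ?subr_ge0 ?(ltW xc)//.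
  apply: lt_trans tN; rewrite -(nodeS t N i) -/a -/c; lra.
Unshelve. all: by end_near. Qed.

End PartitionSums.

(** * The filter along a path *)

Section PathwiseRepresentation.
Context {R : realType}.

Definition mnode_sum n k (G : R -> 'M[R]_(n, k)) (y : R -> 'cV[R]_k) (t : R)
    (N : nat) : 'cV[R]_n :=
  \sum_(0 <= i < N.+1) G (node t N i) *m (y (node t N i.+1) - y (node t N i)).

Lemma mnode_sumE n k (G : R -> 'M[R]_(n, k)) y t N i :
  mnode_sum G y t N i 0 =
  \sum_j node_sum (fun s => G s i j) (fun s => y s j 0) t N.
Proof.
rewrite /mnode_sum summxE exchange_big/=; apply: eq_bigr => l _.
by rewrite mxE; apply: eq_bigr => j _; rewrite !mxE.
Qed.

(** Matrix form of the convergence by summation by parts. The primitive b of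
    G' y is arbitrary because primitives vanishing at 0 are unique. *)
Lemma mnode_sum_cvg n k (G G' : R -> 'M[R]_(n, k)) (y : R -> 'cV[R]_k) b t i :
  mcurve G G' -> mcont G' -> mcont y -> mcurve b (fun t => G' t *m y t) ->
  y 0 = 0 -> b 0 = 0 -> 0 <= t ->
  mnode_sum G y t N i 0 @[N --> \oo] --> (G t *m y t - b t) i 0.
Proof.
move=> cG cG' cy cb y0 b0 t0.
pose bj (j : 'I_k) t := \int[lebesgue_measure]_(s in `[0, t]) (G' s i j * y s j 0).
have cbj j : rcurve (bj j) (fun s => G' s i j * y s j 0).
  by apply: rcurve_int; exact: ray_contM.
have bj0 j : bj j 0 = 0 by rewrite /bj set_itv1 Rintegral_set1.
have -> : (G t *m y t - b t) i 0 = \sum_j (G t i j * y t j 0 - bj j t).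
  rewrite sumrB !mxE; congr (_ - _).
  have c0 := rcurveB (cb i 0) (rcurve_sum (index_enum 'I_k) cbj).
  apply/eqP; rewrite -subr_eq0 (rcurve_const c0 _ t0) => [|s s0].
    by rewrite b0 mxE sub0r oppr_eq0 big1// => j _; rewrite bj0.
  by rewrite mxE subrr.
under eq_fun do rewrite mnode_sumE.
apply: cvgr_sum => j.
apply: (stieltjes_sum_cvg (cG i j) (cG' i j) (cy j 0) (cbj j)) => //.
by rewrite y0 mxE.
Qed.

Variables (n m p : nat) (A : 'M[R]_n) (B : 'M[R]_(n, m)) (C : 'M[R]_(p, n)).
Local Notation ricc := (ricc A B C).
Local Notation closed_loop := (closed_loop A C).

Variables (S Psi : R -> 'M[R]_n).
Hypothesis hS : mcurve S (fun t => ricc (S t)).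
Hypothesis fP : inverse_flow (fun t => closed_loop (S t)) Psi.

Definition gain t := S t *m C^T.
Definition gain' t := ricc (S t) *m C^T.

Lemma gain_curve : mcurve gain gain'. Proof. exact: mcurveMr. Qed.

Lemma ricc_cont : mcont (fun t => ricc (S t)).
Proof.
have cS := mcurve_cont hS.
have cT : mcont (fun=> C^T) by exact: mcont_cst.
have cC : mcont (fun=> C) by exact: mcont_cst.
apply: mcontB; first apply: mcontD; first apply: mcontD.
- by apply: mcontM => //; exact: mcont_cst.
- by apply: mcontM => //; exact: mcont_cst.
- exact: mcont_cst.
- by do 3 (apply: mcontM => //).
Qed.

Lemma gain'_cont : mcont gain'.
Proof. by apply: mcontM; [exact: ricc_cont|exact: mcont_cst]. Qed.

Lemma loop_cont : mcont (fun t => closed_loop (S t)).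
Proof. exact: mcont_closed_loop hS. Qed.

Definition dPsi t := - (Psi t *m closed_loop (S t)).

Lemma dPsi_cont : mcont dPsi.
Proof.
apply: mcontN; apply: mcontM; last exact: loop_cont.
by case: fP => _ /mcurve_cont.
Qed.

(** The integrated filter equation for a path z of the filter driven by the
    observation path y, with the Ito integral integrated by parts. *)
Definition filter_path (z0 : 'cV[R]_n) (z : R -> 'cV[R]_n) (y : R -> 'cV[R]_p) :=
  forall t, 0 <= t -> z t = z0
    + vintegral (fun s => A *m z s - gain s *m (C *m z s)) t
    + (gain t *m y t - vintegral (fun s => gain' s *m y s) t).

Section Paths.
Variables (z0 : 'cV[R]_n) (z : R -> 'cV[R]_n) (y : R -> 'cV[R]_p).
Hypotheses (cz : mcont z) (cy : mcont y) (y0 : y 0 = 0) (hz : filter_path z0 z y).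

Let a t := z t - gain t *m y t.

(** Removing the gain times the observation leaves a differentiable path. *)
Let a_curve : mcurve a (fun t => closed_loop (S t) *m z t - gain' t *m y t).
Proof.
have cg := mcurve_cont gain_curve.
have c1 : mcont (fun s => A *m z s - gain s *m (C *m z s)).
  by apply: mcontB; apply: mcontM => //; [exact: mcont_cst|apply: mcontM => //; exact: mcont_cst].
have c2 : mcont (fun s => gain' s *m y s) by apply: mcontM => //; exact: gain'_cont.
have c := mcurveD (mcurve_cst z0) (mcurveB (vintegral_curve c1) (vintegral_curve c2)).
apply: (mcurve_ext c) => t t0.
  rewrite /a hz//; move: (vintegral _ t) (vintegral _ t) (_ *m y t) => V1 V2 Q.
  by apply/matrixP => k l; rewrite !mxE; ring.
by rewrite add0r /closed_loop mulmxBl !mulmxA.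
Qed.

Let a0 : a 0 = z0.
Proof. by rewrite /a y0 mulmx0 subr0 hz// !vintegral0 y0 mulmx0 subr0 !addr0. Qed.

(** Variation of constants, D (Psi z) = Psi (gain dy), read through left sums. The
    left-hand side depends on the observation path up to time t only. *)
Lemma filter_sum_cvg t i : 0 <= t ->
  mnode_sum (fun s => Psi s *m gain s) y t N i 0 @[N --> \oo]
    --> (Psi t *m z t - z0) i 0.
Proof.
move=> t0; have [Psi0 cP _] := fP.
have cPa := mcurveM cP a_curve.
pose b t := z0 - Psi t *m a t.
have cP' : mcurve Psi dPsi by [].
have cG := mcurveM cP' gain_curve.
have cb : mcurve b (fun t => (dPsi t *m gain t + Psi t *m gain' t) *m y t).
  apply: (mcurve_ext (mcurveB (mcurve_cst z0) cPa)) => // s s0.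
  rewrite /dPsi /a sub0r.
  move: (closed_loop (S s)) (gain s) (gain' s) (z s) (y s) (Psi s) => F g g' zs ys Ps.
  rewrite !(mulmxBr, mulmxDl, mulNmx) !mulmxA.
  by apply/matrixP => k l; rewrite !mxE; ring.
have -> : Psi t *m z t - z0 = Psi t *m gain t *m y t - b t.
  by rewrite /b /a mulmxBr !mulmxA; apply/matrixP => k l; rewrite !mxE; ring.
apply: (mnode_sum_cvg cG _ cy cb) => //.
- apply: mcontD; apply: mcontM.
  + exact: dPsi_cont.
  + exact: mcurve_cont gain_curve.
  + exact: mcurve_cont cP.
  + exact: gain'_cont.
- by rewrite /b a0 Psi0 mul1mx subrr.
Qed.

Variables (x : R -> 'cV[R]_n) (w : R -> 'cV[R]_m) (v : R -> 'cV[R]_p).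
Hypotheses (cx : mcont x) (cw : mcont w) (cv : mcont v) (w0 : w 0 = 0) (v0 : v 0 = 0).
Hypothesis hx : forall t, 0 <= t ->
  x t = x 0 + vintegral (fun s => A *m x s) t + B *m w t.
Hypothesis hy : forall t, 0 <= t -> y t = vintegral (fun s => C *m x s) t + v t.

(** The error x - z solves a linear equation driven by the noises alone, since
    the observation enters x - z only through A - S C*C. *)
Lemma error_sum_cvg t i : 0 <= t ->
  mnode_sum (fun s => Psi s *m B) w t N i 0
  - mnode_sum (fun s => Psi s *m gain s) v t N i 0 @[N --> \oo]
    --> (Psi t *m (x t - z t) - (x 0 - z0)) i 0.
Proof.
move=> t0; have [Psi0 cP _] := fP.
have cP' : mcurve Psi dPsi by [].
have cG := mcurveM cP' gain_curve; have cGB := mcurveMr B cP'.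
have cG' : mcont (fun t => dPsi t *m gain t + Psi t *m gain' t).
  apply: mcontD; apply: mcontM.
  + exact: dPsi_cont.
  + exact: mcurve_cont gain_curve.
  + exact: mcurve_cont cP.
  + exact: gain'_cont.
have cGB' : mcont (fun t => dPsi t *m B).
  by apply: mcontM; [exact: dPsi_cont|exact: mcont_cst].
pose b1 := vintegral (fun s => dPsi s *m B *m w s).
pose b2 := vintegral (fun s => (dPsi s *m gain s + Psi s *m gain' s) *m v s).
have cb1 : mcurve b1 (fun s => dPsi s *m B *m w s).
  by apply: vintegral_curve; exact: mcontM.
have cb2 : mcurve b2 (fun s => (dPsi s *m gain s + Psi s *m gain' s) *m v s).
  by apply: vintegral_curve; exact: mcontM.
pose xt t := x t - B *m w t; pose yt t := y t - v t.
have cxt : mcurve xt (fun t => A *m x t).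
  have cAx : mcont (fun s => A *m x s) by apply: mcontM => //; exact: mcont_cst.
  apply: (mcurve_ext (mcurveD (mcurve_cst (x 0)) (vintegral_curve cAx))) => s s0.
    by rewrite /xt (hx s0) addrK.
  by rewrite add0r.
have cyt : mcurve yt (fun t => C *m x t).
  have cCx : mcont (fun s => C *m x s) by apply: mcontM => //; exact: mcont_cst.
  apply: (mcurve_ext (vintegral_curve cCx)) => s s0 //.
  by rewrite /yt (hy s0) addrK.
(* Psi (x - z) minus the integral of Psi B dw plus that of Psi gain dv, both by
   parts, is constant: x - B w and y - v are differentiable, and
   x - z - B w + gain v = (x - B w) - a - gain (y - v). *)
have cc := mcurveD (mcurveM cP' (mcurveB (mcurveB cxt a_curve) (mcurveM gain_curve cyt)))
  (mcurveB cb1 cb2).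
have := mcurve_const cc _ t0.
rewrite Psi0 mul1mx /b1 /b2 !vintegral0 subrr addr0 a0 /xt w0 mulmx0 subr0.
rewrite /yt y0 v0 subrr mulmx0 subr0 -/b1 -/b2 => e.
have {}e : Psi t *m (x t - z t) - (x 0 - z0) =
    (Psi t *m B *m w t - b1 t) - (Psi t *m gain t *m v t - b2 t).
  rewrite -e; last first.
    move=> s s0 /=.
    have -> : A *m x s = closed_loop (S s) *m x s + gain s *m (C *m x s).
      by rewrite /closed_loop /gain mulmxBl !mulmxA subrK.
    rewrite /a /dPsi /xt /yt /=.
    move: (closed_loop (S s)) (gain s) (gain' s) (z s) (y s) (Psi s) => F g g' zs ys Ps.
    move: (x s) (w s) (v s) => xs ws vs.
    rewrite !(mulmxBr, mulmxBl, mulmxDr, mulmxDl, mulNmx, mulmxN) !mulmxA.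
    move: (Ps *m F *m xs) (Ps *m F *m B *m ws) (Ps *m F *m zs) (Ps *m F *m g *m ys).
    move: (Ps *m F *m g *m vs) (Ps *m g *m C *m xs) (Ps *m g' *m ys) (Ps *m g' *m vs).
    move=> M1 M2 M3 M4 M5 M6 M7 M8.
    by apply/matrixP => k l; rewrite !mxE; ring.
  rewrite /a; move: (b1 t) (b2 t) (gain t) (z t) (y t) (Psi t) (x t) (w t) (v t).
  move=> b1t b2t g zs ys Ps xs ws vs.
  rewrite !(mulmxBr, mulmxDr, mulmxN) !mulmxA.
  by apply/matrixP => k l; rewrite !mxE; ring.
have cvB := mnode_sum_cvg (i := i) cGB cGB' cw cb1 w0 (vintegral0 _) t0.
have cvG := mnode_sum_cvg (i := i) cG cG' cv cb2 v0 (vintegral0 _) t0.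
have -> : (Psi t *m (x t - z t) - (x 0 - z0)) i 0 =
   (Psi t *m B *m w t - b1 t) i 0 - (Psi t *m gain t *m v t - b2 t) i 0.
  by rewrite e [LHS]mxE [X in _ + X = _]mxE.
by apply: cvgB.
Qed.

End Paths.

End PathwiseRepresentation.

(** * Square-integrable random variables *)

Section SquareIntegrable.
Context {d : measure_display} {T : measurableType d} {R : realType}.
Variable mu : probability T R.
Implicit Types f g h : T -> R.

Definition itg f := mu.-integrable setT (EFin \o f).
Definition ex f : R := \int[mu]_w f w.

Lemma itg_meas f : itg f -> measurable_fun setT f.
Proof. by move=> /integrableP[/measurable_EFinP]. Qed.

Lemma itg_le f g : measurable_fun setT f -> itg g ->
  (forall w, `|f w| <= g w) -> itg f.
Proof.
move=> mf ig fg; apply: (le_integrable _ _ _ ig) => //.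
  exact/measurable_EFinP.
by move=> w _ /=; rewrite lee_fin (le_trans (fg w))// ler_norm.
Qed.

Lemma itg_cst (c : R) : itg (fun=> c).
Proof. exact: finite_measure_integrable_cst. Qed.

Lemma itgD f g : itg f -> itg g -> itg (fun w => f w + g w).
Proof. by move=> hf hg; exact: integrableD hf hg. Qed.

Lemma itgZ (c : R) f : itg f -> itg (fun w => c * f w).
Proof. by move=> hf; exact: (integrableZl measurableT c hf). Qed.

Lemma itgN f : itg f -> itg (fun w => - f w).
Proof. by move=> /(itgZ (-1)); under eq_fun do rewrite mulN1r. Qed.

Lemma itgB f g : itg f -> itg g -> itg (fun w => f w - g w).
Proof. by move=> hf hg; apply: itgD => //; exact: itgN. Qed.

Lemma exD f g : itg f -> itg g -> ex (fun w => f w + g w) = ex f + ex g.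
Proof. by move=> hf hg; exact: RintegralD. Qed.

Lemma exZ (c : R) f : itg f -> ex (fun w => c * f w) = c * ex f.
Proof. by move=> hf; exact: RintegralZl. Qed.

Lemma exB f g : itg f -> itg g -> ex (fun w => f w - g w) = ex f - ex g.
Proof. by move=> hf hg; exact: RintegralB. Qed.

Lemma ex_cst (c : R) : ex (fun=> c) = c.
Proof.
rewrite /ex Rintegral_cst// (_ : fine _ = 1) ?mulr1//.
by transitivity (fine (1%E : \bar R)) => //; congr fine; exact: probability_setT.
Qed.

Lemma ex_EFin f : itg f -> (\int[mu]_w (f w)%:E)%E = (ex f)%:E.
Proof. by move=> hf; rewrite /ex /Rintegral fineK//; exact: integrable_fin_num. Qed.

Lemma ex_le f g : itg f -> itg g -> (forall w, f w <= g w) -> ex f <= ex g.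
Proof. by move=> hf hg fg; exact: le_Rintegral. Qed.

Lemma ex_norm_le f : itg f -> `|ex f| <= ex (fun w => `|f w|).
Proof. by move=> hf; exact: le_normr_Rintegral. Qed.

Lemma itg_norm f : itg f -> itg (fun w => `|f w|).
Proof.
move=> hf; have mf := itg_meas hf.
by have := integrable_abse hf.
Qed.

Lemma ex_ae_eq f g : measurable_fun setT f -> measurable_fun setT g ->
  {ae mu, forall w, f w = g w} -> ex f = ex g.
Proof.
move=> mf mg fg; congr fine; apply: ae_eq_integral => //.
- exact/measurable_EFinP.
- exact/measurable_EFinP.
- by apply: filterS fg => w /= -> _.
Qed.

(** Membership in L^2; the expectation of a product is then the inner product
    [ip]. *)
Definition isq f := measurable_fun setT f /\ itg (fun w => f w ^+ 2).

Lemma isq_meas f : isq f -> measurable_fun setT f. Proof. by case. Qed.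

Lemma isq_mul f g : isq f -> isq g -> itg (fun w => f w * g w).
Proof.
move=> [mf hf] [mg hg]; apply: (itg_le _ (itgD hf hg)).
  exact: measurable_funM.
move=> w; rewrite normrM -(real_normK (num_real (f w))) -(real_normK (num_real (g w))).
have := sqr_ge0 (`|f w| - `|g w|); have := sqr_ge0 (`|f w| + `|g w|); lra.
Qed.

Lemma isq_cst (c : R) : isq (fun=> c).
Proof. by split; [exact: measurable_cst|exact: itg_cst]. Qed.

Lemma isq_itg f : isq f -> itg f.
Proof.
by move=> /(isq_mul (isq_cst 1)); under eq_fun do rewrite mul1r.
Qed.

Lemma isqZ (c : R) f : isq f -> isq (fun w => c * f w).
Proof.
move=> [mf hf]; split; first by apply: measurable_funM => //; exact: measurable_cst.
by under eq_fun do rewrite exprMn; exact: itgZ.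
Qed.

Lemma isqD f g : isq f -> isq g -> isq (fun w => f w + g w).
Proof.
move=> hf hg; split; first by apply: measurable_funD; [case: hf|case: hg].
under eq_fun do rewrite sqrrD.
apply: itgD; last by case: hg.
apply: itgD; first by case: hf.
under eq_fun do rewrite -mulr_natl; apply: itgZ; exact: isq_mul.
Qed.

Lemma isqN f : isq f -> isq (fun w => - f w).
Proof. by move=> /(isqZ (-1)); under eq_fun do rewrite mulN1r. Qed.

Lemma isqB f g : isq f -> isq g -> isq (fun w => f w - g w).
Proof. by move=> hf hg; apply: isqD => //; exact: isqN. Qed.

Lemma isq_sum (I : Type) (s : seq I) (F : I -> T -> R) :
  (forall i, isq (F i)) -> isq (fun w => \sum_(i <- s) F i w).
Proof.
move=> hF; elim: s => [|i s IH].
  by under eq_fun do rewrite big_nil; exact: isq_cst.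
by under eq_fun do rewrite big_cons; exact: isqD.
Qed.

Lemma isq_bounded f (K : R) : measurable_fun setT f -> (forall w, `|f w| <= K) ->
  isq f.
Proof.
move=> mf fK; split => //; apply: (itg_le _ (itg_cst (K ^+ 2))).
  exact: measurable_funX.
by move=> w; rewrite normrX lerXn2r ?nnegrE// (le_trans _ (fK w)).
Qed.

Definition ip f g := ex (fun w => f w * g w).

Lemma ipC f g : ip f g = ip g f.
Proof. by congr (ex _); apply/funext => w; rewrite mulrC. Qed.

Lemma ipDl f g h : isq f -> isq g -> isq h ->
  ip (fun w => f w + g w) h = ip f h + ip g h.
Proof.
move=> hf hg hh; rewrite /ip; under eq_fun do rewrite mulrDl.
by apply: exD; exact: isq_mul.
Qed.

Lemma ipZl (c : R) f g : isq f -> isq g -> ip (fun w => c * f w) g = c * ip f g.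
Proof.
move=> hf hg; rewrite /ip; under eq_fun do rewrite -mulrA.
by apply: exZ; exact: isq_mul.
Qed.

Lemma ip_suml (I : Type) (s : seq I) (F : I -> T -> R) g :
  (forall i, isq (F i)) -> isq g ->
  ip (fun w => \sum_(i <- s) F i w) g = \sum_(i <- s) ip (F i) g.
Proof.
move=> hF hg; elim: s => [|i s IH].
  rewrite big_nil /ip; under eq_fun do rewrite big_nil mul0r.
  exact: ex_cst.
under [X in ip X]eq_fun do rewrite big_cons.
by rewrite big_cons ipDl ?IH//; exact: isq_sum.
Qed.

(** Pythagoras. *)
Lemma ip_sum_orth (s : seq nat) (F : nat -> T -> R) : uniq s ->
  (forall i, isq (F i)) ->
  (forall i j, i \in s -> j \in s -> i != j -> ip (F i) (F j) = 0) ->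
  ip (fun w => \sum_(i <- s) F i w) (fun w => \sum_(i <- s) F i w) =
  \sum_(i <- s) ip (F i) (F i).
Proof.
move=> us hF orth; rewrite ip_suml//; last exact: isq_sum.
rewrite big_seq [RHS]big_seq; apply: eq_bigr => i si.
rewrite ipC ip_suml// (big_rem i)//= big1_seq ?addr0// => j /andP[_ js].
rewrite orth//; first exact: mem_rem js.
by move: js; rewrite (rem_filter _ us) mem_filter => /andP[].
Qed.

(** The sum counts the multiples of 1/(N+1) below x, so it rounds x down to such a
    multiple. *)
Lemma level_set_approx (x : R) N : 0 <= x <= 1 ->
  `|x - \sum_(j < N.+1) N.+1%:R^-1 * (j.+1%:R / N.+1%:R <= x)%R%:R| <= N.+1%:R^-1.
Proof.
move=> /andP[x0 x1].
have N0 : 0 < N.+1%:R :> R by rewrite ltr0n.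
pose m := Num.truncn (x * N.+1%:R).
have /andP[m1 m2] : m%:R <= x * N.+1%:R < m.+1%:R.
  by apply: truncn_itv; rewrite mulr_ge0// ltW.
have mN : (m <= N.+1)%N.
  rewrite -(ler_nat R); apply: (le_trans m1).
  by rewrite ler_piMl// ltW.
have -> : \sum_(j < N.+1) N.+1%:R^-1 * (j.+1%:R / N.+1%:R <= x)%R%:R = N.+1%:R^-1 * m%:R :> R.
  rewrite -mulr_sumr; congr (_ * _).
  under eq_bigr => j _.
    have -> : (j.+1%:R / N.+1%:R <= x) = (j < m)%N.
      rewrite ler_pdivrMr//; apply/idP/idP => h.
        by rewrite -ltnS -(ltr_nat R); exact: le_lt_trans m2.
      by apply: le_trans m1; rewrite ler_nat.
    over.
  rewrite -natr_sum -(big_mkord xpredT (fun j => nat_of_bool (j < m)%N)).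
  congr (_%:R); rewrite -[RHS](minn_idPr mN).
  elim: N.+1 => [|k IH]; first by rewrite big_geq// min0n.
  rewrite big_nat_recr//= IH; have [km|mk] := ltnP k m.
    by rewrite (minn_idPl km) addn1.
  by rewrite (minn_idPr (leqW mk)) addn0.
rewrite -(ler_pM2l N0) mulfV ?gt_eqF// -[X in X * `|_|](gtr0_norm N0) -normrM.
rewrite mulrBr mulVKf ?gt_eqF// mulrC ger0_norm ?subr_ge0// lerBlDr addrC.
by rewrite natr1 ltW.
Qed.

(** The variable h is a uniform limit of combinations of indicators of events of h,
    each of which is orthogonal to f. *)
Lemma ex_level_orth h f : measurable_fun setT h -> (forall w, 0 <= h w <= 1) ->
  itg f -> (forall U : set R, measurable U -> \int[mu]_(w in h @^-1` U) f w = 0) ->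
  ex (fun w => h w * f w) = 0.
Proof.
move=> mh h01 hf orth.
have hbd w : `|h w| <= 1 by case/andP: (h01 w) => a b; rewrite ger0_norm.
have mf := itg_meas hf.
have hhf : itg (fun w => h w * f w).
  apply: (itg_le _ (itg_norm hf)); first exact: measurable_funM.
  by move=> w; rewrite normrM ler_piMl.
have bound N : `|ex (fun w => h w * f w)| <= N.+1%:R^-1 * ex (fun w => `|f w|).
  pose A j : set T := h @^-1` `[j.+1%:R / N.+1%:R, +oo[.
  have mA j : measurable (A j).
    by rewrite -[A j]setTI; apply: mh => //; exact: measurable_itv.
  pose c j w : R := N.+1%:R^-1 * (j.+1%:R / N.+1%:R <= h w)%R%:R.
  have cE j w : c j w = N.+1%:R^-1 * \1_(A j) w.
    have e : (w \in A j) = (j.+1%:R / N.+1%:R <= h w).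
      by apply/idP/idP => [/set_mem|hj]; [|apply/mem_set]; rewrite /A/= in_itv/= andbT.
    by rewrite /c indicE e.
  have h1 j : itg (fun w => c j w * f w) /\ ex (fun w => c j w * f w) = 0.
    have i1 : itg (fun w => \1_(A j) w * f w).
      apply: (itg_le _ (itg_norm hf)); first exact: measurable_funM.
      by move=> w; rewrite normrM ler_piMl// indicE; case: (_ \in _); rewrite ?normr1 ?normr0.
    have e : (fun w => c j w * f w) = (fun w => N.+1%:R^-1 * (\1_(A j) w * f w)).
      by apply/funext => w; rewrite cE mulrA.
    rewrite e; split; first exact: itgZ.
    rewrite exZ// [X in _ * X](_ : _ = 0) ?mulr0//.
    rewrite -[RHS](orth _ (measurable_itv `[j.+1%:R / N.+1%:R, +oo[)).
    rewrite [RHS]Rintegral_mkcond; congr (Rintegral _ _ _).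
    apply/funext => w; rewrite patchE indicE.
    by rewrite -/(A j); case: (w \in A j); rewrite ?mul1r ?mul0r.
  pose hN w := \sum_(j < N.+1) c j w.
  have [i2 e2] : itg (fun w => hN w * f w) /\ ex (fun w => hN w * f w) = 0.
    rewrite /hN; under eq_fun do rewrite mulr_suml.
    elim: (index_enum _) => [|j s [IH1 IH2]].
      by under eq_fun do rewrite big_nil; split; [exact: itg_cst|exact: ex_cst].
    have [j1 j2] := h1 j.
    under eq_fun do rewrite big_cons.
    by split; [exact: itgD|rewrite exD// j2 IH2 addr0].
  have -> : ex (fun w => h w * f w) = ex (fun w => h w * f w - hN w * f w).
    by rewrite exB// e2 subr0.
  have i3 := itgB hhf i2.
  apply: (le_trans (ex_norm_le i3)); rewrite -exZ ?(itg_norm hf)//.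
  apply: ex_le; [exact: itg_norm|by apply: itgZ; exact: itg_norm|].
  move=> w; rewrite -mulrBl normrM ler_wpM2r//; exact: level_set_approx.
apply/eqP; rewrite -normr_le0; apply/ler_addgt0Pl => e e0; rewrite addr0.
pose I1 := ex (fun w => `|f w|).
have I10 : 0 <= I1 by apply: Rintegral_ge0.
near \oo => N.
apply: (le_trans (bound N)); rewrite -/I1 mulrC ler_pdivrMr// mulrC.
rewrite -ler_pdivrMr//; apply: (@le_trans _ _ N%:R); last by rewrite ler_nat.
by near: N; exact: nbhs_infty_ger.
Unshelve. all: by end_near. Qed.

End SquareIntegrable.

(** * Orthogonality to a generated sigma-algebra *)

Section Orthogonality.
Context {d : measure_display} {T : measurableType d} {R : realType}.
Variable mu : probability T R.
Implicit Types f g h X Y : T -> R.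

Local Notation itg := (itg mu).
Local Notation ex := (ex mu).
Local Notation isq := (isq mu).
Local Notation ip := (ip mu).

Lemma ex_dominated (fN : nat -> T -> R) f g :
  (forall N, measurable_fun setT (fN N)) -> measurable_fun setT f -> itg g ->
  {ae mu, forall w, fN N w @[N --> \oo] --> f w} ->
  (forall N w, `|fN N w| <= g w) -> ex (fN N) @[N --> \oo] --> ex f.
Proof.
move=> mfN mf ig fNf fg.
have [] := @dominated_convergence _ T R mu setT measurableT
  (fun N w => (fN N w)%:E) (fun w => (f w)%:E) (fun w => (g w)%:E).
- by move=> N; exact/measurable_EFinP.
- exact/measurable_EFinP.
- by apply: filterS fNf => w h _; apply/fine_cvgP; split; [exact: nearW|exact: h].
- exact: ig.
- by apply: aeW => w N _ /=; rewrite lee_fin.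
move=> hf _ cv; rewrite /ex /Rintegral; apply: fine_cvg.
by rewrite fineK//; exact: integrable_fin_num hf.
Qed.

(** A continuous truncation at level K. Being a function of its argument, it
    turns a variable into a bounded one without new events, and its continuity
    preserves almost sure limits. *)
Definition squash (K x : R) := K * x / (K + `|x|).

Lemma squash_cont K : 0 < K -> continuous (squash K).
Proof.
move=> K0 x; apply: cvgM; first by apply: cvgM; [exact: cvg_cst|exact: cvg_id].
apply: cvgV; first by rewrite gt_eqF// ltr_pwDl.
by apply: cvgD; [exact: cvg_cst|apply: cvg_norm; exact: cvg_id].
Qed.

Lemma squash_le K x : 0 < K -> `|squash K x| <= K /\ `|squash K x| <= `|x|.
Proof.
move=> K0; have Kx : 0 < K + `|x| by rewrite ltr_pwDl.
rewrite /squash !normrM normfV (gtr0_norm K0) (gtr0_norm Kx).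
split; rewrite ler_pdivrMr//.
  by rewrite mulrDr lerDr mulr_ge0// ltW.
by rewrite mulrDr mulrC lerDl mulr_ge0.
Qed.

Lemma squash_cvg x : squash N.+1%:R x @[N --> \oo] --> x.
Proof.
apply/cvgrPdist_le => e e0; near=> N.
have N0 : 0 < N.+1%:R :> R by rewrite ltr0n.
have Nx : 0 < N.+1%:R + `|x| by rewrite ltr_pwDl.
rewrite (_ : x - _ = x * `|x| / (N.+1%:R + `|x|)); last first.
  by rewrite /squash; field; rewrite gt_eqF// ?natr1.
rewrite !normrM normfV normr_id (gtr0_norm Nx) ler_pdivrMr//.
apply: (@le_trans _ _ (e * N.+1%:R)); last by rewrite ler_wpM2l ?(ltW e0)// lerDl.
rewrite -ler_pdivrMl//; apply: (@le_trans _ _ N%:R); last by rewrite ler_nat.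
by near: N; exact: nbhs_infty_ger.
Unshelve. all: by end_near. Qed.

(** A bounded truncation of XN N is a function of XN N, hence orthogonal to Y. Let
    N tend to infinity at a fixed level, dominated by a multiple of |Y|, and then
    the level, dominated by |X Y|. *)
Lemma orth_limit X Y (XN : nat -> T -> R) : isq X -> isq Y ->
  (forall N, measurable_fun setT (XN N)) ->
  {ae mu, forall w, XN N w @[N --> \oo] --> X w} ->
  (forall N (U : set R), measurable U -> \int[mu]_(w in XN N @^-1` U) Y w = 0) ->
  ip X Y = 0.
Proof.
move=> hX hY mXN XNX orth.
have mX := isq_meas hX; have mY := isq_meas hY; have iY := isq_itg hY.
have msq K : 0 < K -> measurable_fun setT (squash K).
  by move=> K0; apply: continuous_measurable_fun; exact: squash_cont.
have exY : ex Y = 0.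
  by rewrite -(orth 0 setT) ?preimage_setT.
(* squash K has values in [-K, K]; rescale them to [0, 1]. *)
have step K N : 0 < K -> ex (fun w => squash K (XN N w) * Y w) = 0.
  move=> K0; pose h w := (squash K (XN N w) + K) / (2 * K).
  have K20 : 0 < 2 * K by rewrite mulr_gt0.
  have mphi : measurable_fun setT (fun x : R => (squash K x + K) / (2 * K)).
    apply: measurable_funM; last exact: measurable_cst.
    by apply: measurable_funD; [exact: msq|exact: measurable_cst].
  have mh : measurable_fun setT h by exact: (measurableT_comp mphi (mXN N)).
  have h01 w : 0 <= h w <= 1.
    have [+ _] := squash_le (XN N w) K0; rewrite ler_norml => /andP[a b].
    by rewrite /h ler_pdivrMr// divr_ge0 ?(ltW K20)//=; lra.
  have := @ex_level_orth _ _ _ mu h Y mh h01 iY.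
  move=> /(_ _)-h0; have {}h0 : ex (fun w => h w * Y w) = 0.
    apply: h0 => U mU.
    rewrite (_ : h @^-1` U = XN N @^-1` ((fun x : R => (squash K x + K) / (2 * K)) @^-1` U))//.
    by apply: orth; rewrite -[_ @^-1` _]setTI; exact: mphi.
  have ihY : itg (fun w => h w * Y w).
    apply: isq_mul => //; apply: (@isq_bounded _ _ _ _ _ 1) => // w.
    by case/andP: (h01 w) => a b; rewrite ger0_norm.
  have -> : (fun w => squash K (XN N w) * Y w) =
      (fun w => 2 * K * (h w * Y w) - K * Y w).
    by apply/funext => w; rewrite /h; field; rewrite gt_eqF.
  rewrite exB ?exZ ?h0 ?exY ?mulr0 ?subrr//; exact: itgZ.
have step2 K : 0 < K -> ex (fun w => squash K (X w) * Y w) = 0.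
  move=> K0.
  have cv : ex (fun w => squash K (XN N w) * Y w) @[N --> \oo]
      --> ex (fun w => squash K (X w) * Y w).
    apply: (@ex_dominated _ _ (fun w => K * `|Y w|)).
    - move=> N; apply: measurable_funM => //.
      exact: (measurableT_comp (msq _ K0) (mXN N)).
    - apply: measurable_funM => //; exact: (measurableT_comp (msq _ K0) mX).
    - apply: itgZ; exact: itg_norm.
    - apply: filterS XNX => w h; apply: cvgM; last exact: cvg_cst.
      by apply: (cvg_comp _ _ h); exact: squash_cont.
    - move=> N w; rewrite normrM ler_wpM2r//.
      by case: (squash_le (XN N w) K0).
  rewrite (_ : (fun N => _) = fun=> 0) in cv; last by apply/funext => N; exact: step.
  by apply: (cvg_unique _ cv) => //; exact: cvg_cst.
have cv : ex (fun w => squash N.+1%:R (X w) * Y w) @[N --> \oo] --> ip X Y.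
  have N0 N : 0 < N.+1%:R :> R by rewrite ltr0n.
  apply: (@ex_dominated _ _ (fun w => `|X w * Y w|)).
  - by move=> N; apply: measurable_funM => //; exact: (measurableT_comp (msq _ (N0 N)) mX).
  - exact: measurable_funM.
  - by apply: itg_norm; exact: isq_mul.
  - by apply: aeW => w; apply: cvgM; [exact: squash_cvg|exact: cvg_cst].
  - move=> N w; rewrite (normrM (squash _ _)) (normrM (X w)) ler_wpM2r//.
    by case: (squash_le (X w) (N0 N)).
rewrite (_ : (fun N => _) = fun=> 0) in cv; last by apply/funext => N; exact: step2.
by apply: (cvg_unique _ cv) => //; exact: cvg_cst.
Qed.

Definition adapted (G : set (set T)) f :=
  forall U : set R, measurable U -> G (f @^-1` U).

(** Orthogonality is extended from indicators to square-integrable variables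
    twice, once on each side. *)
Lemma indep_orth (F G : set (set T)) f g : independent2 mu F G ->
  isq f -> isq g -> adapted F f -> adapted G g -> ex g = 0 -> ip f g = 0.
Proof.
move=> ind hf hg af ag g0.
apply: (@orth_limit f g (fun=> f)) => //.
- by move=> N; exact: isq_meas hf.
- by apply: aeW => w; exact: cvg_cst.
move=> N U mU; set E := f @^-1` U.
have mf := isq_meas hf; have mg := isq_meas hg.
have mE : measurable E by rewrite -[E]setTI; exact: mf.
have FE : F E by exact: af.
(* It is enough that 1_E - mu E is orthogonal to g, which is centered. *)
pose Y w : R := \1_E w - fine (mu E).
have i1 : isq (fun w => \1_E w : R).
  apply: (@isq_bounded _ _ _ _ _ 1) => [|w].
    exact: measurable_indic.
  by rewrite /= indicE; case: (_ \in _); rewrite ?normr1 ?normr0.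
have hY : isq Y by apply: isqB => //; exact: isq_cst.
have muE_fin V : measurable V -> mu V = (fine (mu V))%:E.
  by move=> mV; rewrite fineK//; exact: fin_num_measure.
have gY : ip g Y = 0.
  apply: (@orth_limit g Y (fun=> g)) => //.
    by apply: aeW => w; exact: cvg_cst.
  move=> _ V mV; set D := g @^-1` V.
  have mD : measurable D by rewrite -[D]setTI; exact: mg.
  have iD f' : itg f' -> mu.-integrable D (EFin \o f').
    by move=> h; apply: integrableS h.
  rewrite RintegralB//; last 2 first.
    by apply: iD; exact: isq_itg.
    by apply: iD; exact: itg_cst.
  rewrite Rintegral_cst// /Rintegral integral_indic//.
  have e : mu (E `&` D) = (mu E * mu D)%E := ind _ _ FE (ag _ mV).
  transitivity (fine (mu E * mu D) - fine (mu E) * fine (mu D)).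
    by congr (fine _ - _).
  by rewrite fineM ?fin_num_measure ?subrr.
move: gY; rewrite /ip /Y; under eq_fun do rewrite mulrBr (mulrC _ (fine _)).
rewrite exB; last 2 first.
- exact: isq_mul.
- by apply: itgZ; exact: isq_itg.
rewrite exZ; last exact: isq_itg.
rewrite g0 mulr0 subr0 => e; rewrite -e Rintegral_mkcond; congr (Rintegral _ _ _).
by apply/funext => w; rewrite patchE indicE; case: (w \in E); rewrite ?mulr1 ?mulr0.
Qed.

End Orthogonality.

(** * Second moment of the normal law *)

Section Gaussian.
Context {R : realType}.

(** With u = y / 2 the right-hand side is (e^u - e^-u)^2, and e^u - e^-u >= 2 u
    for u >= 0 since its derivative e^u + e^-u is at least 2. *)
Lemma sqr_le_exp (y : R) : y ^+ 2 <= expR y + expR (- y) - 2.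
Proof.
wlog y0 : y / 0 <= y.
  move=> h; have [/h//|/ltW y0] := leP 0 y.
  have := h (- y); rewrite oppr_ge0 sqrrN opprK => /(_ y0).
  by rewrite (addrC (expR (- y))).
pose u := y / 2; have u0 : 0 <= u by rewrite divr_ge0.
have c1 := rcurveB (rcurveB (rcurve_expR (1 : R)) (rcurve_expR (- 1))) (rcurveZ 2 rcurve_id).
have := rcurve_nondecr c1 (lexx 0) u0.
rewrite !mulr0 expR0 subrr subr0 => h.
have {}h : 2 * u <= expR u - expR (- u).
  rewrite -subr_ge0; move: h; rewrite mul1r mulN1r; apply=> x _.
  rewrite !mul1r !mulN1r opprK mulr1.
  have e : expR x * expR (- x) = 1 by rewrite -expRD subrr expR0.
  have : (expR x + expR (- x)) ^+ 2 >= 4.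
    rewrite (_ : _ ^+ 2 = (expR x - expR (- x)) ^+ 2 + 4 * (expR x * expR (- x))); last by ring.
    by rewrite e mulr1 lerDr sqr_ge0.
  have S0 : 0 < expR x + expR (- x) by rewrite addr_gt0 ?expR_gt0.
  move=> S4; suff : 2 <= expR x + expR (- x) by lra.
  rewrite -(@ler_pXn2r _ 2%N)// ?nnegrE ?(ltW S0)//; apply: le_trans S4.
  by rewrite expr2 -natrM.
have e1 : expR y = expR u * expR u by rewrite -expRD -splitr.
have e2 : expR (- y) = expR (- u) * expR (- u) by rewrite -expRD -opprD -splitr.
have e3 : expR u * expR (- u) = 1 by rewrite -expRD subrr expR0.
rewrite e1 e2.
have : (2 * u) ^+ 2 <= (expR u - expR (- u)) ^+ 2.
  rewrite lerXn2r// nnegrE; first by rewrite mulr_ge0.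
  by apply: le_trans h; rewrite mulr_ge0.
rewrite sqrrB e3 mulrC divfK//; rewrite !expr2; lra.
Qed.

Local Notation leb := (@lebesgue_measure R).

(** The density is almost everywhere the Radon-Nikodym derivative, by uniqueness. *)
Lemma ge0_integral_normal (m s : R) (f : R -> R) : measurable_fun setT f ->
  (forall x, 0 <= f x) ->
  (\int[normal_prob m s]_x (f x)%:E = \int[leb]_x (f x * normal_pdf m s x)%:E)%E.
Proof.
move=> mf f0.
have dom := @normal_prob_dominates R m s.
have mfE : measurable_fun setT (EFin \o f) by exact/measurable_EFinP.
have f0E x : (0 <= (EFin \o f) x)%E by rewrite lee_fin.
rewrite -[LHS](Radon_Nikodym_SigmaFinite.change_of_variables dom f0E measurableT mfE).
have mRN := measurable_int _ (Radon_Nikodym_SigmaFinite.f_integrable dom).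
have mpdf : measurable_fun setT (EFin \o normal_pdf m s).
  by apply/measurable_EFinP; exact: measurable_normal_pdf.
under [RHS]eq_integral do rewrite EFinM.
apply: ae_eq_integral => //.
- exact: emeasurable_funM.
- exact: emeasurable_funM.
- apply: ae_eqe_mul2l => /=.
  apply: integral_ae_eq => //=.
  + exact: Radon_Nikodym_SigmaFinite.f_integrable.
  + by move=> E _ mE; rewrite -Radon_Nikodym_SigmaFinite.f_integral.
Qed.

Lemma measurable_expRM (a : R) : measurable_fun setT (fun x : R => expR (a * x)).
Proof.
have ma : measurable_fun setT (fun x : R => a * x).
  by apply: measurable_funM => //; exact: measurable_cst.
exact: (measurableT_comp (@measurable_expR R) ma).
Qed.

(** Completing the square. *)
Lemma normal_exp_moment (s a : R) : s != 0 ->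
  (\int[normal_prob 0 s]_x (expR (a * x))%:E = (expR (a ^+ 2 * s ^+ 2 / 2))%:E)%E.
Proof.
move=> s0; rewrite ge0_integral_normal//; last exact: measurable_expRM.
have e x : expR (a * x) * normal_pdf 0 s x =
    expR (a ^+ 2 * s ^+ 2 / 2) * normal_pdf (a * s ^+ 2) s x.
  rewrite !normal_pdfE// /normal_fun mulrCA [RHS]mulrCA; congr (_ * _).
  by rewrite -!expRD; congr expR; field.
transitivity (\int[leb]_x ((expR (a ^+ 2 * s ^+ 2 / 2))%:E
    * (normal_pdf (a * s ^+ 2) s x)%:E))%E.
  by apply: eq_integral => x _; rewrite e EFinM.
rewrite integralZl//; last exact: integrable_normal_pdf.
by rewrite integral_normal_pdf// mule1.
Qed.

(** The second moment is read off the exponential moments: y^2 <= e^y + e^-y - 2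
    at y = a x, then a tends to 0. *)
Lemma normal_second_moment (s : R) : s != 0 ->
  (\int[normal_prob 0 s]_x (x ^+ 2)%:E <= (s ^+ 2)%:E)%E.
Proof.
move=> s0.
pose N : probability _ R := normal_prob 0 s.
set I := (\int[_]_x _)%E.
have s20 : 0 < s ^+ 2 by rewrite exprn_even_gt0.
have mexp (a : R) : measurable_fun setT (fun x : R => (expR (a * x))%:E).
  by apply/measurable_EFinP; exact: measurable_expRM.
have msq : measurable_fun setT (fun x : R => (x ^+ 2)%:E).
  by apply/measurable_EFinP; exact: measurable_funX.
have bound (a : R) : ((a ^+ 2)%:E * I + 2%:E <= (2 * expR (a ^+ 2 * s ^+ 2 / 2))%:E)%E.
  rewrite /I -ge0_integralZl//; last 2 first.
  - by move=> x _; rewrite lee_fin sqr_ge0.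
  - by rewrite lee_fin sqr_ge0.
  have e2 : (\int[N]_x (2%:E) = 2%:E)%E.
    by rewrite integral_cst// [X in (_ * X)%E](probability_setT N) mule1.
  have m2 : measurable_fun setT (fun x : R => (a ^+ 2)%:E * (x ^+ 2)%:E)%E.
    by apply: emeasurable_funM => //; exact: measurable_cst.
  rewrite -[X in (_ + X)%E]e2 -ge0_integralD//; last first.
    by move=> x _; rewrite -EFinM lee_fin mulr_ge0 ?sqr_ge0.
  have -> : (2 * expR (a ^+ 2 * s ^+ 2 / 2))%:E =
      (\int[N]_x ((expR (a * x))%:E + (expR (- a * x))%:E))%E.
    rewrite ge0_integralD//; [|exact: mexp|exact: mexp].
    by rewrite !normal_exp_moment// sqrrN -EFinD; congr EFin; ring.
  apply: ge0_le_integral => //.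
  - by move=> x _; rewrite -EFinM -EFinD lee_fin addr_ge0// mulr_ge0 ?sqr_ge0.
  - by apply: emeasurable_funD => //; exact: measurable_cst.
  - by apply: emeasurable_funD; exact: mexp.
  - move=> x _; rewrite -EFinM -!EFinD lee_fin -exprMn mulNr.
    have := sqr_le_exp (a * x); lra.
have I0 : (0 <= I)%E by apply: integral_ge0 => x _; rewrite lee_fin sqr_ge0.
(* with u = a^2 s^2 / 2 the bound reads I <= s^2 (e^u - 1) / u <= s^2 e^u *)
have bound2 (u : R) : 0 < u -> (I <= (s ^+ 2 * expR u)%:E)%E.
  move=> u0; pose a := Num.sqrt (2 * u) / s.
  have a2 : a ^+ 2 * s ^+ 2 = 2 * u.
    by rewrite /a exprMn exprVn divfK ?expf_neq0// sqr_sqrtr// mulr_ge0// ltW.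
  have a20 : 0 < a ^+ 2 by rewrite -(pmulr_lgt0 _ s20) a2 mulr_gt0.
  move: I0 (bound a); rewrite a2 (_ : 2 * u / 2 = u); last by field.
  move: (I) => J; case: J => [r| |] //=; last by rewrite gt0_muley ?lte_fin.
  rewrite -EFinM -EFinD !lee_fin => r0 h.
  have h2 : expR u - 1 <= u * expR u.
    have := expR_ge1Dx (- u); rewrite expRN -(ler_pM2r (expR_gt0 u)) mulVf ?gt_eqF ?expR_gt0//.
    rewrite mulrDl mul1r mulNr; lra.
  rewrite -(ler_pM2l a20) mulrA a2; lra.
apply/lee_addgt0Pr => e e0.
have : expR x @[x --> (0 : R)^'+] --> expR (0 : R).
  by apply: cvg_at_right_filter; exact: continuous_expR.
rewrite expR0 => /cvgrPdist_le/(_ (e / s ^+ 2) (divr_gt0 e0 s20)) h.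
near (0 : R)^'+ => u.
apply: (le_trans (bound2 u _)); first by near: u; exact: nbhs_right_gt.
rewrite -EFinD lee_fin.
have : `|1 - expR u| <= e / s ^+ 2 by near: u; exact: h.
rewrite ler_norml => /andP[a _].
have h2 : expR u <= 1 + e / s ^+ 2 by lra.
have := ler_wpM2l (ltW s20) h2; rewrite mulrDr mulr1 mulrCA mulfV ?mulr1//.
by rewrite gt_eqF.
Unshelve. all: by end_near. Qed.

End Gaussian.

(** * Gaussian increments and adapted variables *)

Section ProcessLemmas.
Context {d : measure_display} {T : measurableType d} {R : realType}.
Variable mu : probability T R.
Implicit Types f g : T -> R.

Local Notation itg := (itg mu).
Local Notation ex := (ex mu).
Local Notation isq := (isq mu).
Local Notation ip := (ip mu).

Lemma isq_lt_pinfty (f : T -> R) : measurable_fun setT f ->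
  (\int[mu]_w (f w ^+ 2)%:E < +oo)%E -> isq f.
Proof.
move=> mf fin; split => //; apply/integrableP; split.
  by apply/measurable_EFinP; exact: measurable_funX.
apply: le_lt_trans fin; rewrite le_eqVlt; apply/orP; left; apply/eqP.
by apply: eq_integral => w _ /=; rewrite ger0_norm ?sqr_ge0.
Qed.

(** The mean vanishes because Z and -Z have the same law. *)
Lemma gaussian_scalar (Z : T -> R) (v : R) : measurable_fun setT Z -> 0 <= v ->
  (forall U : set R, measurable U -> mu (Z @^-1` U) = gaussian_law 0 v U) ->
  (forall U : set R, measurable U ->
     mu ((fun w => - Z w) @^-1` U) = gaussian_law 0 v U) ->
  [/\ isq Z, ex Z = 0 & ip Z Z <= v].
Proof.
move=> mZ v0 lawZ lawNZ.
have mN : measurable_fun setT (fun w => - Z w) by exact: measurable_funN.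
have msq : measurable_fun setT (fun x : R => (x ^+ 2)%:E).
  by apply/measurable_EFinP; exact: measurable_funX.
have le_v : (\int[mu]_w (Z w ^+ 2)%:E <= v%:E)%E.
  have [ve0|vn0] := eqVneq v 0.
    have -> : (\int[mu]_w (Z w ^+ 2)%:E = \int[pushforward mu Z]_x (x ^+ 2)%:E)%E.
      by rewrite ge0_integral_pushforward// => x _; rewrite lee_fin sqr_ge0.
    rewrite (@eq_measure_integral _ _ _ _ (\d_(0 : R))); last first.
      move=> U mU _; transitivity (gaussian_law 0 v U); first exact: lawZ.
      by rewrite /gaussian_law ve0 eqxx.
    by rewrite integral_dirac// diracT mul1e expr0n/= ve0.
  have sv : Num.sqrt v != 0 by rewrite sqrtr_eq0 -ltNge lt_neqAle eq_sym vn0.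
  pose Z' : T -> measurableTypeR R := Z.
  have mZ' : measurable_fun setT Z' by exact: mZ.
  have msq' : measurable_fun setT (fun x : measurableTypeR R => (x ^+ 2)%:E) by exact: msq.
  have -> : (\int[mu]_w (Z w ^+ 2)%:E =
      \int[normal_prob 0 (Num.sqrt v)]_x (x ^+ 2)%:E)%E.
    transitivity (\int[pushforward mu Z']_x (x ^+ 2)%:E)%E.
      by rewrite ge0_integral_pushforward// => x _; rewrite lee_fin sqr_ge0.
    apply: eq_measure_integral => U mU _.
    transitivity (gaussian_law 0 v U); first exact: lawZ.
    by rewrite /gaussian_law (negbTE vn0).
  by apply: le_trans (normal_second_moment sv) _; rewrite sqr_sqrtr.
have sZ : isq Z by apply: isq_lt_pinfty => //; exact: le_lt_trans le_v (ltry _).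
split=> //.
- have eN : ex Z = ex (fun w => - Z w).
    have iZ := isq_itg sZ; have iN : itg (fun w => - Z w) by exact: itgN.
    congr fine.
    have -> : (\int[mu]_w (Z w)%:E = \int[pushforward mu Z]_x x%:E)%E.
      by rewrite integral_pushforward.
    have -> : (\int[mu]_w (- Z w)%:E = \int[pushforward mu (fun w => - Z w)%R]_x x%:E)%E.
      by rewrite integral_pushforward.
    apply: eq_measure_integral => U mU _.
    by transitivity (gaussian_law 0 v U);
      [exact: lawZ|exact/esym/lawNZ].
  have : ex (fun w => - Z w) = - ex Z.
    rewrite -[RHS]mulN1r -exZ; last exact: isq_itg.
    by congr (ex _); apply/funext => w; rewrite mulN1r.
  rewrite -eN; lra.
- rewrite -lee_fin -ex_EFin; last exact: isq_mul.
  by under eq_integral do rewrite -expr2.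
Qed.

Lemma adaptedP (gens : set (set T)) (f : T -> R) :
  adapted (<<s gens>>) f <-> measurable_fun setT (f : g_sigma_algebraType gens -> R).
Proof.
split=> [af _ U mU|mf U mU]; first by rewrite setTI; exact: af.
by have := mf measurableT U mU; rewrite setTI.
Qed.

Lemma sigma_process_coord k (D : set R) (Z : R -> T -> 'cV[R]_k) t i : D t ->
  adapted (sigma_process D Z) (fun w => Z t w i 0).
Proof. by move=> Dt U mU; apply: sub_gen_smallest; exists t, i, U. Qed.

Lemma adapted_cst (gens : set (set T)) (c : R) : adapted (<<s gens>>) (fun=> c).
Proof. by apply/adaptedP; exact: measurable_cst. Qed.

Lemma adaptedD (gens : set (set T)) f g : adapted (<<s gens>>) f ->
  adapted (<<s gens>>) g -> adapted (<<s gens>>) (fun w => f w + g w).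
Proof. by move=> /adaptedP mf /adaptedP mg; apply/adaptedP; exact: measurable_funD. Qed.

Lemma adaptedM (gens : set (set T)) f g : adapted (<<s gens>>) f ->
  adapted (<<s gens>>) g -> adapted (<<s gens>>) (fun w => f w * g w).
Proof. by move=> /adaptedP mf /adaptedP mg; apply/adaptedP; exact: measurable_funM. Qed.

Lemma adaptedB (gens : set (set T)) f g : adapted (<<s gens>>) f ->
  adapted (<<s gens>>) g -> adapted (<<s gens>>) (fun w => f w - g w).
Proof. by move=> /adaptedP mf /adaptedP mg; apply/adaptedP; exact: measurable_funB. Qed.

Lemma adapted_sum (gens : set (set T)) (I : Type) (s : seq I) (F : I -> T -> R) :
  (forall i, adapted (<<s gens>>) (F i)) ->
  adapted (<<s gens>>) (fun w => \sum_(i <- s) F i w).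
Proof.
move=> hF; elim: s => [|i s IH].
  by under eq_fun do rewrite big_nil; exact: adapted_cst.
by under eq_fun do rewrite big_cons; exact: adaptedD.
Qed.

Lemma adapted_dotv (gens : set (set T)) k (a : 'cV[R]_k) (Z : T -> 'cV[R]_k) :
  (forall i, adapted (<<s gens>>) (fun w => Z w i 0)) ->
  adapted (<<s gens>>) (fun w => dotv a (Z w)).
Proof.
move=> hZ; under eq_fun do rewrite dotvE.
by apply: adapted_sum => i; apply: adaptedM => //; exact: adapted_cst.
Qed.

Lemma adapted_incr k (D : set R) (Z : R -> T -> 'cV[R]_k) (a : 'cV[R]_k) s t :
  D s -> D t -> adapted (sigma_process D Z) (fun w => dotv a (Z t w - Z s w)).
Proof.
move=> Ds Dt; apply: adapted_dotv => i.
rewrite (_ : (fun w => _) = fun w => Z t w i 0 - Z s w i 0); last first.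
  by apply/funext => w; rewrite !mxE.
by apply: adaptedB; exact: sigma_process_coord.
Qed.

Lemma measurable_dotv k (a : 'cV[R]_k) (Z : T -> 'cV[R]_k) : random_vector Z ->
  measurable_fun setT (fun w => dotv a (Z w)).
Proof.
move=> mZ; under eq_fun do rewrite dotvE.
by apply: measurable_sum => i; apply: measurable_funM => //; exact: measurable_cst.
Qed.

Lemma random_vectorB k (Z1 Z2 : T -> 'cV[R]_k) : random_vector Z1 ->
  random_vector Z2 -> random_vector (fun w => Z1 w - Z2 w).
Proof.
move=> m1 m2 i.
rewrite (_ : (fun w => _) = fun w => Z1 w i 0 - Z2 w i 0); last first.
  by apply/funext => w; rewrite !mxE.
exact: measurable_funB.
Qed.

(** Directions a and -a are both tested, for the symmetry that makes the mean
    vanish. *)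
Lemma wiener_incr k (W : R -> T -> 'cV[R]_k) s t (a : 'cV[R]_k) :
  wiener mu W -> 0 <= s -> s < t ->
  let f w := dotv a (W t w - W s w) in
  [/\ isq f, ex f = 0 & ip f f <= (t - s) * dotv a a].
Proof.
move=> [[mW _] _ gW _] s0 st f.
have [|mWst _ law] := gW s t; first by rewrite s0 st.
have e b : dotv b ((t - s)%:M *m b) = (t - s) * dotv b b.
  by rewrite mul_scalar_mx dotvZr.
apply: gaussian_scalar.
- exact: measurable_dotv.
- by rewrite mulr_ge0 ?dotv_ge0// subr_ge0 ltW.
- by move=> U mU; have := law a U mU; rewrite dotv0r e.
- move=> U mU; have := law (- a) U mU.
  rewrite dotv0r e dotvNl dotvNr opprK => <-; congr (mu _).
  by apply/seteqP; split => w /=; rewrite /f dotvNl.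
Qed.

(** Take the third event to be the whole space. *)
Lemma independent3_pairs (I1 I2 I3 : set (set T)) :
  independent3 mu (<<s I1>>) (<<s I2>>) (<<s I3>>) ->
  [/\ independent2 mu (<<s I1>>) (<<s I2>>),
      independent2 mu (<<s I1>>) (<<s I3>>) &
      independent2 mu (<<s I2>>) (<<s I3>>)].
Proof.
move=> ind.
have sT I : (<<s I>>) [set: T].
  by have := @measurableT _ (g_sigma_algebraType I).
have m1 : mu [set: T] = 1%E := probability_setT mu.
split=> E E' hE hE'.
- have := ind _ _ _ hE hE' (sT I3); rewrite setIT => ->.
  by rewrite m1 mule1.
- have := ind _ _ _ hE (sT I2) hE'; rewrite setIT => ->.
  by rewrite m1 mule1.
- have := ind _ _ _ (sT I1) hE hE'; rewrite setTI => ->.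
  by rewrite m1 mul1e.
Qed.

End ProcessLemmas.

(** * Second moment of the noise sums *)

Section NoiseMoments.
Context {d : measure_display} {T : measurableType d} {R : realType}.
Variable mu : probability T R.

Local Notation ex := (ex mu).
Local Notation isq := (isq mu).
Local Notation ip := (ip mu).

Lemma ex_sum (I : Type) (s : seq I) (F : I -> T -> R) :
  (forall i, isq (F i)) -> ex (fun w => \sum_(i <- s) F i w) = \sum_(i <- s) ex (F i).
Proof.
move=> hF; elim: s => [|i s IH].
  by rewrite big_nil; under [X in ex X]eq_fun do rewrite big_nil; exact: ex_cst.
under [X in ex X]eq_fun do rewrite big_cons.
rewrite big_cons exD ?IH//; apply: isq_itg => //; exact: isq_sum.
Qed.

Lemma ip_add_orth (f g : T -> R) : isq f -> isq g -> ip f g = 0 ->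
  ip (fun w => f w + g w) (fun w => f w + g w) = ip f f + ip g g.
Proof.
move=> hf hg o; have hfg := isqD hf hg.
rewrite ipDl// (ipC mu f) (ipC mu g) !ipDl// (ipC mu g f) o.
by rewrite addr0 add0r.
Qed.

Definition wincr k (W : R -> T -> 'cV[R]_k) (t : R) (N : nat) (a : nat -> 'cV[R]_k)
    (i : nat) (w : T) : R :=
  dotv (a i) (W (node t N i.+1) w - W (node t N i) w).

Section OneWiener.
Variables (k : nat) (W : R -> T -> 'cV[R]_k) (t : R) (N : nat) (a : nat -> 'cV[R]_k).
Hypotheses (hW : wiener mu W) (t0 : 0 < t).

Let nodes_lt i : node t N i < node t N i.+1.
Proof. by rewrite -subr_gt0 nodeS divr_gt0. Qed.

Lemma wincrP i : [/\ isq (wincr W t N a i), ex (wincr W t N a i) = 0 &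
  ip (wincr W t N a i) (wincr W t N a i) <= t / N.+1%:R * dotv (a i) (a i)].
Proof.
rewrite -(nodeS t N i); apply: wiener_incr => //.
exact: node_ge0 (ltW t0).
Qed.

Lemma wincr_adapted i : adapted (sigma_process `[0, +oo[ W) (wincr W t N a i).
Proof.
by apply: adapted_incr; rewrite /= in_itv/= andbT node_ge0// ltW.
Qed.

(** The later increment is independent of the past and centered. *)
Lemma wincr_orth i j : i != j -> ip (wincr W t N a i) (wincr W t N a j) = 0.
Proof.
wlog ij : i j / (i < j)%N.
  move=> h ij; have [lij|lji|e] := ltngtP i j; first exact: h.
    by rewrite ipC h// eq_sym.
  by rewrite e eqxx in ij.
move=> _; have [si _ _] := wincrP i; have [sj ej _] := wincrP j.
have [_ _ _ ind] := hW.
have h : 0 <= node t N j < node t N j.+1 by rewrite nodes_lt (node_ge0 _ _ (ltW t0)).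
apply: (indep_orth (ind _ _ h)) => //.
- apply: adapted_incr; rewrite /= in_itv/= (node_ge0 _ _ (ltW t0))/=.
    exact: node_le (ltW t0) (ltnW ij).
  exact: node_le (ltW t0) ij.
- exact: (adapted_dotv (a j) (fun l => sigma_process_coord (Z := fun r w => W r w - W (node t N j) w) l erefl)).
Qed.

Definition wsum w := \sum_(0 <= i < N.+1) wincr W t N a i w.

Lemma wsumP : [/\ isq wsum, ex wsum = 0,
  adapted (sigma_process `[0, +oo[ W) wsum &
  ip wsum wsum <= \sum_(0 <= i < N.+1) t / N.+1%:R * dotv (a i) (a i)].
Proof.
have sq i : isq (wincr W t N a i) by case: (wincrP i).
split.
- exact: isq_sum.
- by rewrite ex_sum// big1// => i _; case: (wincrP i).
- by apply: adapted_sum => i; exact: wincr_adapted.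
- rewrite /wsum ip_sum_orth ?iota_uniq//; last by move=> i j _ _; exact: wincr_orth.
  by apply: ler_sum => i _; case: (wincrP i).
Qed.

End OneWiener.

(** The initial error and the two noise sums are pairwise independent, and the noise
    sums are centered; so their second moments add. *)
Lemma noise_moment n m p (X : R -> T -> 'cV[R]_n) (W : R -> T -> 'cV[R]_m)
    (V : R -> T -> 'cV[R]_p) (z u : 'cV[R]_n) (t : R) (N : nat)
    (a : nat -> 'cV[R]_m) (b : nat -> 'cV[R]_p) :
  wiener mu W -> wiener mu V -> 0 < t ->
  independent3 mu (sigma_process [set 0] X)
    (sigma_process `[0, +oo[ W) (sigma_process `[0, +oo[ V) ->
  isq (fun w => dotv u (X 0 w - z)) ->
  let zeta w := dotv u (X 0 w - z) + (wsum W t N a w + wsum V t N b w) in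
  isq zeta /\ ip zeta zeta <=
    ip (fun w => dotv u (X 0 w - z)) (fun w => dotv u (X 0 w - z)) +
    \sum_(0 <= i < N.+1) (dotv (a i) (a i) + dotv (b i) (b i)) * (t / N.+1%:R).
Proof.
move=> hW hV t0 ind sX zeta.
have [iXW iXV iWV] := independent3_pairs ind.
have [sW eW aW vW] := wsumP N a hW t0.
have [sV eV aV vV] := wsumP N b hV t0.
pose e w := dotv u (X 0 w - z).
have aX : adapted (sigma_process [set 0] X) e.
  apply: adapted_dotv => i.
  rewrite (_ : (fun w => _) = fun w => X 0 w i 0 - z i 0); last first.
    by apply/funext => w; rewrite !mxE.
  by apply: adaptedB; [exact: sigma_process_coord|exact: adapted_cst].
have sWV : isq (fun w => wsum W t N a w + wsum V t N b w) by exact: isqD.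
have o1 : ip e (wsum W t N a) = 0 by exact: (indep_orth iXW).
have o2 : ip e (wsum V t N b) = 0 by exact: (indep_orth iXV).
have o3 : ip (wsum W t N a) (wsum V t N b) = 0 by exact: (indep_orth iWV).
split; first exact: isqD.
have o : ip e (fun w => wsum W t N a w + wsum V t N b w) = 0.
  by rewrite ipC ipDl// (ipC mu _ e) o1 (ipC mu _ e) o2 addr0.
rewrite /zeta ip_add_orth// lerD2l ip_add_orth//.
rewrite (eq_bigr (fun i => t / N.+1%:R * dotv (a i) (a i)
  + t / N.+1%:R * dotv (b i) (b i))); last first.
  by move=> i _; rewrite mulrDl !(mulrC _ (t / _)).
by rewrite big_split/= lerD.
Qed.

End NoiseMoments.

(** * The Ito integral of a smooth integrand *)

Section ItoIntegral.
Context {d : measure_display} {T : measurableType d} {R : realType}.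
Variable mu : probability T R.

Lemma measurable_enorm k (Z : T -> 'cV[R]_k) : random_vector Z ->
  measurable_fun setT (fun w => enorm (Z w)).
Proof.
move=> mZ.
have mq : measurable_fun setT (fun w => dotv (Z w) (Z w)).
  under eq_fun do rewrite dotvE.
  by apply: measurable_sum => i; exact: measurable_funM.
have ms : measurable_fun setT (Num.sqrt : R -> R).
  by apply: continuous_measurable_fun; exact: sqrt_continuous.
exact: (measurableT_comp ms mq).
Qed.

Lemma abs_le_enorm k (x : 'cV[R]_k) i : `|x i 0| <= enorm x.
Proof.
rewrite -(@ler_pXn2r _ 2%N) ?nnegrE// ?sqrtr_ge0// real_normK ?num_real//.
by rewrite /enorm sqr_sqrtr ?dotv_ge0// sqr_le_dotv.
Qed.

(** If the limit in probability L of XN were at distance at least 1/(k+1) from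
    XN w for all large N, then w would lie in an intersection of events of
    arbitrarily small probability. *)
Lemma cvg_prob_ae_unique k (XN : nat -> T -> 'cV[R]_k) (L Z : T -> 'cV[R]_k) :
  (forall N, random_vector (XN N)) -> random_vector L ->
  (forall eps : R, 0 < eps -> \forall N \near \oo,
     (mu [set w | (eps <= enorm (XN N w - L w))%R] <= eps%:E)%E) ->
  {ae mu, forall w, forall i, XN N w i 0 @[N --> \oo] --> Z w i 0} ->
  {ae mu, forall w, L w = Z w}.
Proof.
move=> mXN mL prob XNZ.
pose E l N := [set w | ((l.+1%:R : R)^-1 <= enorm (XN N w - L w))%R].
have mE l N : measurable (E l N).
  have mf := measurable_enorm (random_vectorB (mXN N) mL).
  have := mf measurableT _ (measurable_itv `[(l.+1%:R : R)^-1, +oo[).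
  rewrite setTI; congr (measurable _); apply/seteqP.
  by split=> w; rewrite /E/= in_itv/= andbT.
(* F l M is contained in every E l N with N >= M, hence negligible. *)
pose F l M := \bigcap_N E l (M + N)%N.
have mF l M : measurable (F l M) by apply: bigcapT_measurable => N; exact: mE.
have F0 l M : mu.-negligible (F l M).
  apply/negligibleP => //; apply/eqP; rewrite eq_le measure_ge0 andbT.
  apply/lee_addgt0Pr => e e0; rewrite add0e.
  pose eta := Order.min e (l.+1%:R : R)^-1.
  have eta0 : 0 < eta by rewrite lt_min e0 invr_gt0 ltr0n.
  near \oo => N.
  have h : (mu [set w | (eta <= enorm (XN N w - L w))%R] <= eta%:E)%E.
    by near: N; exact: prob.
  have MN : (M <= N)%N by near: N; exact: nbhs_infty_ge.
  apply: (@le_trans _ _ (mu (E l N))).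
    apply: le_measure; rewrite ?inE//.
    by move=> w /(_ (N - M)%N I); rewrite subnKC.
  apply: (@le_trans _ _ eta%:E); last by rewrite lee_fin ge_min lexx.
  apply: le_trans h; apply: le_measure; rewrite ?inE//.
    have mf := measurable_enorm (random_vectorB (mXN N) mL).
    have := mf measurableT _ (measurable_itv `[eta, +oo[).
    rewrite setTI; congr (measurable _); apply/seteqP.
    by split=> w; rewrite /= in_itv/= andbT.
  by move=> w; rewrite /E/=; apply: le_trans; rewrite ge_min lexx orbT.
have nF : {ae mu, forall w, forall l M, ~ F l M w}.
  apply: (negligibleS (A := \bigcup_l \bigcup_M F l M)).
    move=> w /= h; have [l hl] := contrapT (fun h' => h (fun l M hF => h' (ex_intro _ l (ex_intro _ M hF)))).
    by case: hl => M hF; exists l => //; exists M.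
  by apply: negligible_bigcup => l; exact: negligible_bigcup.
apply: filterS2 nF XNZ => w nFw cv; apply/colP => i.
apply/eqP; rewrite eq_sym -subr_eq0 -normr_le0; apply/ler_addgt0Pl => e e0; rewrite addr0.
near \oo => l.
have le : (l.+1%:R : R)^-1 <= e / 2.
  rewrite -[leRHS]invrK lef_pV2 ?posrE ?invr_gt0 ?divr_gt0// ?ltr0n//.
  apply: (@le_trans _ _ l%:R); last by rewrite ler_nat.
  by near: l; exact: nbhs_infty_ger.
have /cvgrPdist_le/(_ _ (divr_gt0 e0 (ltr0n R 2)))[M _ hM] := cv i.
have : ~ F l M w by exact: nFw.
move=> /existsNP[N /not_implyP[_ /negP]]; rewrite -ltNge => h.
have h1 : `|Z w i 0 - XN (M + N)%N w i 0| <= e / 2 by apply: hM; rewrite /= leq_addr.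
have h2 := abs_le_enorm (XN (M + N)%N w - L w) i.
rewrite !mxE in h2.
apply: (le_trans (ler_distD (XN (M + N)%N w i 0) _ _)).
rewrite (splitr e) lerD//; apply: (le_trans h2); apply: le_trans le.
exact: ltW.
Unshelve. all: by end_near. Qed.

(** The uniform partition in the encoding used by [itv_partition]. *)
Definition nodes (t : R) (N : nat) : seq R := [seq node t N i.+1 | i <- iota 0 N.+1].

Lemma nth_nodes t N i : (i <= N.+1)%N -> nth 0 (0 :: nodes t N) i = node t N i.
Proof.
case: i => [|i] iN; first by rewrite /= node0.
by rewrite /= (nth_map 0%N) ?size_iota// nth_iota.
Qed.

Lemma nodes_partition t N : 0 < t -> itv_partition 0 t (nodes t N).
Proof.
move=> t0; split.
  apply/(pathP 0) => i; rewrite size_map size_iota => iN.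
  have -> : nth 0 (nodes t N) i = node t N i.+1 by rewrite -(@nth_nodes t N i.+1).
  rewrite (nth_nodes t (ltnW iN)) -subr_gt0 nodeS divr_gt0//.
rewrite (last_nth 0) size_map size_iota nth_nodes//.
by rewrite node_last.
Qed.

Lemma left_sum_nodes n p (H : R -> 'M[R]_(n, p)) (Y : R -> T -> 'cV[R]_p) t N w :
  left_sum H Y (nodes t N) w = mnode_sum H (fun s => Y s w) t N.
Proof.
rewrite /left_sum /mnode_sum size_map size_iota big_mkord.
by apply: eq_bigr => i _; rewrite !nth_nodes// ltnW.
Qed.

Lemma random_vector_mnode_sum n p (H : R -> 'M[R]_(n, p)) (Y : R -> T -> 'cV[R]_p) t N :
  0 <= t -> (forall s, 0 <= s -> random_vector (Y s)) ->
  random_vector (fun w => mnode_sum H (fun s => Y s w) t N).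
Proof.
move=> t0 mY i; under eq_fun do rewrite mnode_sumE /node_sum.
apply: measurable_sum => j; apply: measurable_sum => l.
apply: measurable_funM; first exact: measurable_cst.
by apply: measurable_funB; apply: mY; exact: node_ge0.
Qed.

(** Left sums along uniform partitions converge to J in probability and to the
    pathwise expression almost surely. *)
Lemma ito_by_parts n p (H H' : R -> 'M[R]_(n, p)) (Y : R -> T -> 'cV[R]_p) t J :
  mcurve H H' -> mcont H' -> 0 < t -> (forall s, 0 <= s -> random_vector (Y s)) ->
  {ae mu, forall w, mcont (fun s => Y s w) /\ Y 0 w = 0} ->
  ito_integral mu H Y t J ->
  {ae mu, forall w, J w =
    H t *m Y t w - vintegral (fun s => H' s *m Y s w) t}.
Proof.
move=> cH cH' t0 mY goodY [mJ itoJ].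
apply: (@cvg_prob_ae_unique _ (fun N w => mnode_sum H (fun s => Y s w) t N)) => //.
- by move=> N; apply: random_vector_mnode_sum => //; exact: ltW.
- move=> eps eps0; have [dl dl0 h] := itoJ eps eps0.
  near=> N; have tN : t / N.+1%:R < dl by near: N; exact: mesh_eventually.
  under [X in mu X]eq_set do rewrite -left_sum_nodes.
  apply: h; first exact: nodes_partition.
  move=> i; rewrite size_map size_iota => iN.
  by rewrite !nth_nodes// ?(ltnW iN)// nodeS.
- apply: filterS goodY => w [cY Y0] i.
  have cHY : mcont (fun s => H' s *m Y s w) by exact: mcontM.
  exact: (mnode_sum_cvg (i := i) cH cH' cY (vintegral_curve cHY) Y0 (vintegral0 _) (ltW t0)).
Unshelve. all: by end_near. Qed.

(** A countable dense set of times, so that almost sure equality of continuous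
    paths at each time gives almost sure equality at all times. *)
Definition rtime (ij : nat * nat) : R := ij.1.+1%:R / ij.2.+1%:R.

Lemma rtime_gt0 ij : 0 < rtime ij.
Proof. by rewrite /rtime divr_gt0. Qed.

Lemma ray_cont_dense (f : R -> R) : ray_cont f -> (forall ij, f (rtime ij) = 0) ->
  forall t, 0 <= t -> f t = 0.
Proof.
move=> /subspace_continuousP cf f0 t t0; apply/eqP; rewrite -normr_le0.
apply/ler_addgt0Pl => e e0; rewrite addr0.
have t0' : `[0, +oo[%classic t by rewrite /= in_itv/= andbT.
have /cvgrPdist_le/(_ e e0) := cf t t0'.
move=> /nbhs_ballP[r /= r0 hr].
near \oo => j.
have jr : (j.+1%:R : R)^-1 < r.
  rewrite -[ltRHS]invrK ltf_pV2 ?posrE ?invr_gt0 ?ltr0n//.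
  apply: (@lt_trans _ _ j%:R); last by rewrite ltr_nat.
  by near: j; exact: nbhs_infty_gtr.
have j0 : 0 < j.+1%:R :> R by rewrite ltr0n.
pose i := Num.truncn (t * j.+1%:R).
have /andP[i1 i2] : i%:R <= t * j.+1%:R < i.+1%:R.
  by apply: truncn_itv; rewrite mulr_ge0// ltW.
have a1 : t <= rtime (i, j) by rewrite /rtime/= ler_pdivlMr// ltW.
have a2 : rtime (i, j) <= t + j.+1%:R^-1.
  rewrite /rtime/= ler_pdivrMr// mulrDl mulVf ?gt_eqF// -natr1 lerD2r//.
suff : `|f t - f (rtime (i, j))| <= e by rewrite f0 subr0.
apply: hr.
- rewrite /ball/= distrC ger0_norm ?subr_ge0//.
  by rewrite ltrBlDl (le_lt_trans a2)// ltrD2l.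
- by rewrite in_itv/= andbT ltW// rtime_gt0.
Unshelve. all: by end_near. Qed.

(** A pointwise limit may lose second moment but cannot gain any; the finiteness
    of the limit moment is part of the conclusion. *)
Lemma fatou_ip (fN : nat -> T -> R) (f : T -> R) (cN : nat -> R) (c : R) :
  (forall N, isq mu (fN N)) -> measurable_fun setT f ->
  {ae mu, forall w, fN N w @[N --> \oo] --> f w} ->
  (forall N, ip mu (fN N) (fN N) <= cN N) -> cN N @[N --> \oo] --> c ->
  isq mu f /\ ip mu f f <= c.
Proof.
move=> sN mf fNf leN cNc.
pose g N w := (fN N w ^+ 2)%:E.
have mg N : measurable_fun setT (g N).
  by apply/measurable_EFinP; apply: measurable_funX; case: (sN N).
have mf2 : measurable_fun setT (fun w => (f w ^+ 2)%:E).
  by apply/measurable_EFinP; exact: measurable_funX.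
have e1 : (\int[mu]_w (f w ^+ 2)%:E = \int[mu]_w limn_einf (g^~ w))%E.
  apply: ae_eq_integral => //.
    by apply: measurableT_comp => //; apply: measurable_fun_limn_esup => N; exact: measurableT_comp.
  apply: filterS fNf => w cw _.
  have : g N w @[N --> \oo] --> (f w ^+ 2)%:E.
    apply/fine_cvgP; split; first exact: nearW.
    rewrite expr2 (_ : fine \o _ = fun N => fN N w * fN N w); first exact: cvgM.
    by apply/funext => N; rewrite /= expr2.
  by move=> /cvg_limn_einf_sup[-> _].
have le1 : (\int[mu]_w (f w ^+ 2)%:E <= c%:E)%E.
  rewrite e1; apply: (le_trans (fatou mu measurableT mg _)).
    by move=> N w _; rewrite lee_fin sqr_ge0.
  have cE : (cN N)%:E @[N --> \oo] --> c%:E.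
    by apply/fine_cvgP; split; [exact: nearW|exact: cNc].
  rewrite limn_einf_lim -(cvg_lim _ cE)//.
  apply: lee_lim; [exact: is_cvg_einfs|by apply/cvg_ex; exists c%:E|].
  apply: nearW => N; apply: (@le_trans _ _ (\int[mu]_w g N w)%E).
    by apply: ereal_inf_lbound; exists N => //=.
  have <- : ((ip mu (fN N) (fN N))%:E = \int[mu]_w g N w)%E.
    rewrite -ex_EFin; last exact: isq_mul.
    by apply: eq_integral => w _; rewrite /g expr2.
  by rewrite lee_fin.
have sf : isq mu f by apply: isq_lt_pinfty => //; exact: le_lt_trans le1 (ltry _).
split=> //; rewrite -lee_fin -ex_EFin; last exact: isq_mul.
by under eq_integral do rewrite -expr2.
Qed.

End ItoIntegral.

(** * The error of a filter *)

Lemma dotv_mnode_sum (R : realType) n k (G : R -> 'M[R]_(n, k)) y t N u :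
  dotv u (mnode_sum G y t N) =
  \sum_(0 <= i < N.+1) dotv ((G (node t N i))^T *m u)
    (y (node t N i.+1) - y (node t N i)).
Proof.
rewrite /mnode_sum; elim: (index_iota 0 N.+1) => [|i s IH].
  by rewrite !big_nil dotv0r.
rewrite [in LHS]big_cons [LHS]dotvDr IH [in RHS]big_cons; congr (_ + _).
by rewrite dotv_mull trmxK.
Qed.

Section FilterError.
Context {d : measure_display} {T : measurableType d} {R : realType}.
Variable mu : probability T R.
Variables (n m p : nat) (A : 'M[R]_n) (B : 'M[R]_(n, m)) (C : 'M[R]_(p, n)).
Variables (W : R -> T -> 'cV[R]_m) (V : R -> T -> 'cV[R]_p).
Variables (X : R -> T -> 'cV[R]_n) (Y : R -> T -> 'cV[R]_p).
Hypotheses (hW : wiener mu W) (hV : wiener mu V).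
Hypothesis hXY : signal_observation mu A B C W V X Y.

Lemma process_mcont k (Z : R -> T -> 'cV[R]_k) : continuous_process mu Z ->
  {ae mu, forall w, mcont (fun s => Z s w)}.
Proof. by move=> [_]; apply: filterS => w /mcont_within. Qed.

Lemma observation_start : {ae mu, forall w, mcont (fun s => Y s w) /\ Y 0 w = 0}.
Proof.
have [_ cY _ eqY] := hXY; have [_ V0 _ _] := hV.
apply: filterS3 (process_mcont cY) eqY V0 => w cYw eY V0w; split=> //.
by rewrite eY// vintegral0 V0w addr0.
Qed.

Variables (S : R -> 'M[R]_n) (z0 : 'cV[R]_n) (Z : R -> T -> 'cV[R]_n).
Hypothesis hS : mcurve S (fun t => ricc A B C (S t)).
Hypothesis hZ : kalman_solution mu A C Y S z0 Z.

(** The filter equation holds almost surely at each time; both sides are continuous,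
    so a countable dense set of times gives it along the whole path. *)
Lemma filter_path_ae : {ae mu, forall w, mcont (fun s => Z s w) /\
  filter_path A B C S z0 (fun s => Z s w) (fun s => Y s w)}.
Proof.
have [cZ _ eqZ] := hZ; have [_ [mY _] _ _] := hXY.
pose rhs t w := z0
    + vintegral (fun s => A *m Z s w - gain C S s *m (C *m Z s w)) t
    + (gain C S t *m Y t w - vintegral (fun s => gain' A B C S s *m Y s w) t).
have at_time ij : {ae mu, forall w, Z (rtime ij) w = rhs (rtime ij) w}.
  have t0 : 0 < rtime ij :> R := rtime_gt0 ij.
  have [J itoJ eqJ] := eqZ _ (ltW t0).
  have JE := ito_by_parts (gain_curve hS) (gain'_cont hS) t0 mY observation_start itoJ.
  by apply: filterS2 JE eqJ => w -> ->.
have all_times : {ae mu, forall w, forall i j, Z (rtime (i, j)) w = rhs (rtime (i, j)) w}.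
  by apply: ae_foralln => i; apply: ae_foralln => j; exact: at_time.
apply: filterS3 (process_mcont cZ) observation_start all_times.
move=> w cZw [cYw Y0w] eqw; split=> // t t0.
have crhs : mcont (fun s => rhs s w).
  have cg : mcont (gain C S) := mcurve_cont (gain_curve hS).
  apply: mcontD; first apply: mcontD.
  - exact: mcont_cst.
  - apply: mcurve_cont (vintegral_curve _).
    apply: mcontB; apply: mcontM => //; first exact: mcont_cst.
    by apply: mcontM => //; exact: mcont_cst.
  - apply: mcontB; first exact: mcontM.
    apply: mcurve_cont (vintegral_curve _).
    by apply: mcontM => //; exact: gain'_cont.
have cD : mcont (fun s => Z s w - rhs s w) by exact: mcontB.
suff: Z t w - rhs t w = 0 by exact: subr0_eq.
apply/colP => i; rewrite [RHS]mxE.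
apply: (ray_cont_dense (cD i 0)) t0 => -[k l].
by rewrite eqw subrr mxE.
Qed.

Variable Psi : R -> 'M[R]_n.
Hypothesis fP : inverse_flow (fun t => closed_loop A C (S t)) Psi.

(** The filter is almost surely a limit of linear functions of finitely many
    values of the observation. *)
Lemma filter_limit t i : 0 <= t ->
  {ae mu, forall w, (invmx (Psi t) *m (z0
      + mnode_sum (fun s => Psi s *m gain C S s) (fun s => Y s w) t N)) i 0
    @[N --> \oo] --> Z t w i 0}.
Proof.
move=> t0; apply: filterS2 filter_path_ae observation_start.
move=> w [cZw hw] [cYw Y0w].
have cv j := filter_sum_cvg hS fP cZw cYw Y0w hw (i := j) t0.
have uP : Psi t \in unitmx by case: fP => _ _ ->.
have -> : Z t w i 0 = (invmx (Psi t) *m (z0 + (Psi t *m Z t w - z0))) i 0.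
  by rewrite addrC subrK mulKmx.
rewrite mxE; under eq_fun do rewrite mxE.
apply: cvgr_sum => j; apply: cvgM; first exact: cvg_cst.
rewrite mxE; under eq_fun do rewrite mxE.
by apply: cvgD; [exact: cvg_cst|exact: cv].
Qed.

Hypothesis hindep : independent3 mu (sigma_process [set 0] X)
  (sigma_process `[0, +oo[ W) (sigma_process `[0, +oo[ V).
Hypothesis X0sq : forall u, isq mu (fun w => dotv u (X 0 w - z0)).
Variable Q0 : 'M[R]_n.
Hypothesis X0mom : forall u,
  ip mu (fun w => dotv u (X 0 w - z0)) (fun w => dotv u (X 0 w - z0))
  = dotv u (Q0 *m u).
Hypothesis S0sym : (S 0)^T = S 0.

(** Transported by Psi, the error is the limit of the initial error plus left sums
    of Psi B dW - Psi S C* dV. The second moments of these sums are bounded by Riemann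
    sums of the derivative of Psi S Psi*, and Fatou's lemma passes to the limit. *)
Lemma error_moment t (x : 'cV[R]_n) : 0 < t ->
  isq mu (fun w => dotv x (X t w - Z t w)) /\
  ip mu (fun w => dotv x (X t w - Z t w)) (fun w => dotv x (X t w - Z t w)) <=
  dotv x (invmx (Psi t) *m (Q0 - S 0) *m (invmx (Psi t))^T *m x) + dotv x (S t *m x).
Proof.
move=> t0; have t0' := ltW t0.
have [cX _ eqX eqY] := hXY; have [mX _] := cX.
have [Psi0 cP uP] := fP; have uPt := uP _ t0'.
pose u := (invmx (Psi t))^T *m x.
pose a N i := (Psi (node t N i) *m B)^T *m u.
pose b N i := - ((Psi (node t N i) *m gain C S (node t N i))^T *m u).
pose zeta N w := dotv u (X 0 w - z0) + (wsum W t N (a N) w + wsum V t N (b N) w).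
have zE N w : zeta N w = dotv u (X 0 w - z0)
    + (dotv u (mnode_sum (fun s => Psi s *m B) (fun s => W s w) t N)
     - dotv u (mnode_sum (fun s => Psi s *m gain C S s) (fun s => V s w) t N)).
  rewrite /zeta; congr (_ + _); rewrite !dotv_mnode_sum /wsum /wincr -sumrB -big_split.
  by apply: eq_bigr => i _; rewrite dotvNl.
pose G s := Psi s *m (B *m B^T + gain C S s *m (gain C S s)^T) *m (Psi s)^T.
pose cN N := dotv u (Q0 *m u) + node_sum (fun s => dotv u (G s *m u)) (fun s => s) t N.
have mom N : isq mu (zeta N) /\ ip mu (zeta N) (zeta N) <= cN N.
  have [s1 s2] := noise_moment N (a N) (b N) hW hV t0 hindep (X0sq u).
  split=> //; apply: (le_trans s2); rewrite X0mom lerD2l.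
  rewrite le_eqVlt; apply/orP; left; apply/eqP; apply: eq_bigr => i _.
  rewrite nodeS /a /b dotvNl dotvNr opprK; congr (_ * _).
  rewrite /G mulmxDr mulmxDl mulmxDl dotvDr; congr (_ + _).
    by rewrite dotv_mull trmxK [(Psi _ *m _)^T]trmx_mul !mulmxA.
  by rewrite dotv_mull trmxK [(Psi _ *m _)^T]trmx_mul !mulmxA.
have cq : rcurve (fun s => dotv u (Psi s *m S s *m (Psi s)^T *m u))
    (fun s => dotv u (G s *m u)).
  exact: qf_curve (flow_conj fP fP (riccati_lyapunov hS S0sym)).
have cvN : cN N @[N --> \oo] --> dotv u (Q0 *m u)
    + (dotv u (Psi t *m S t *m (Psi t)^T *m u) - dotv u (S 0 *m u)).
  have cg : mcont (gain C S) := mcurve_cont (gain_curve hS).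
  have cPsi : mcont Psi := mcurve_cont cP.
  have cG : mcont G.
    apply: mcontM; last exact: mcontT.
    apply: mcontM => //; apply: mcontD; first exact: mcont_cst.
    by apply: mcontM => //; exact: mcontT.
  have cf : ray_cont (fun s => dotv u (G s *m u)).
    have h : mcont (fun s => u^T *m (G s *m u)).
      apply: mcontM; first exact: mcont_cst.
      by apply: mcontM => //; exact: mcont_cst.
    exact: h.
  apply: cvgD; first exact: cvg_cst.
  have := riemann_sum_cvg cq cf t0'.
  by rewrite Psi0 trmx1 mulmx1 mul1mx.
have cvz : {ae mu, forall w, zeta N w @[N --> \oo] --> dotv x (X t w - Z t w)}.
  have [/process_mcont cW W0 _ _] := hW; have [/process_mcont cV V0 _ _] := hV.
  apply: filterS3 (filterI filter_path_ae observation_start)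
    (filterI cW (filterI W0 (filterI cV V0)))
    (filterI (process_mcont cX) (filterI eqX eqY)).
  move=> w [[cZw hw] [cYw Y0w]] [cWw [W0w [cVw V0w]]] [cXw [eXw eYw]].
  have -> : dotv x (X t w - Z t w) = dotv u (X 0 w - z0)
      + dotv u (Psi t *m (X t w - Z t w) - (X 0 w - z0)).
    by rewrite -dotvDr subrKC /u dotv_mull trmxK mulKmx//.
  under eq_fun do rewrite zE.
  apply: cvgD; first exact: cvg_cst.
  rewrite dotvE; under eq_fun do rewrite !dotvE -sumrB.
  apply: cvgr_sum => i; under eq_fun do rewrite -mulrBr.
  apply: cvgM; first exact: cvg_cst.
  exact: (error_sum_cvg hS fP cZw cYw Y0w hw cXw cWw cVw W0w V0w eXw eYw (i := i) t0').
have mXZ : measurable_fun setT (fun w => dotv x (X t w - Z t w)).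
  have [[mZ _] _ _] := hZ.
  by apply: measurable_dotv; apply: random_vectorB; [exact: mX|exact: mZ].
have [h1 h2] := fatou_ip (fun N => (mom N).1) mXZ cvz (fun N => (mom N).2) cvN.
split=> //; apply: (le_trans h2).
rewrite !qf_conj -/u mulmxBl dotvBr.
have -> : (Psi t)^T *m u = x by rewrite /u mulmxA -trmx_mul mulVmx// trmx1 mul1mx.
by rewrite addrA addrAC.
Qed.

End FilterError.

(** * Covariances and conditional expectations *)

Section FilterComparison.
Context {d : measure_display} {T : measurableType d} {R : realType}.
Variable mu : probability T R.

(** The covariance is finite on the diagonal, which gives square integrability. *)
Lemma covariance_ip n (X Z : R -> T -> 'cV[R]_n) S t i j : 0 <= t ->
  random_vector (X t) -> random_vector (Z t) -> error_covariance mu X Z S ->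
  isq mu (fun w => (X t w - Z t w) i 0) /\
  ip mu (fun w => (X t w - Z t w) i 0) (fun w => (X t w - Z t w) j 0) = S t i j.
Proof.
move=> t0 mX mZ hS.
have hE k l : (\int[mu]_w ((X t w - Z t w) k 0 * (X t w - Z t w) l 0)%:E)%E
    = (S t k l)%:E.
  by have := hS t k l t0; rewrite unlock.
split; last by rewrite /ip /ex /Rintegral hE.
apply: isq_lt_pinfty; first exact: random_vectorB.
by under eq_integral do rewrite expr2; rewrite hE ltry.
Qed.

(** The two integrals over E are finite and equal. *)
Lemma cond_orth k (G : set (set T)) (X Z : T -> 'cV[R]_k) (E : set T) i :
  cond_expectation mu G X Z -> measurable E -> G E ->
  \int[mu]_(w in E) (X w - Z w) i 0 = 0.
Proof.
move=> /(_ i)[iX iZ _ eqE] mE GE.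
rewrite (_ : (fun w => _) = fun w => X w i 0 - Z w i 0); last first.
  by apply/funext => w; rewrite !mxE.
have sub f : itg mu f -> mu.-integrable E (EFin \o f).
  by move=> h; apply: (integrableS _ _ _ h).
by rewrite RintegralB//; [rewrite /Rintegral (eqE _ GE) subrr|exact: sub..].
Qed.

Lemma ip_dotv n (f : T -> 'cV[R]_n) (Q : 'M[R]_n) u :
  (forall i, isq mu (fun w => f w i 0)) ->
  (forall i j, ip mu (fun w => f w i 0) (fun w => f w j 0) = Q i j) ->
  isq mu (fun w => dotv u (f w)) /\
  ip mu (fun w => dotv u (f w)) (fun w => dotv u (f w)) = dotv u (Q *m u).
Proof.
move=> sq fQ.
have sqz i : isq mu (fun w => u i 0 * f w i 0) by exact: isqZ.
under [X in isq _ X]eq_fun do rewrite dotvE.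
have -> : (fun w => dotv u (f w)) = fun w => \sum_i u i 0 * f w i 0.
  by apply/funext => w; rewrite dotvE.
have sqs : isq mu (fun w => \sum_i u i 0 * f w i 0) by exact: isq_sum.
split=> //; rewrite ip_suml// dotvE; apply: eq_bigr => i _.
rewrite ipZl//; congr (_ * _); rewrite ipC ip_suml// mxE; apply: eq_bigr => j _.
by rewrite ipZl// ipC fQ mulrC.
Qed.

End FilterComparison.

(** * The gap between two filters *)

Section TwoFilters.
Context {d : measure_display} {T : measurableType d} {R : realType}.
Variable mu : probability T R.
Variables (n m p : nat) (A : 'M[R]_n) (B : 'M[R]_(n, m)) (C : 'M[R]_(p, n)).
Variables (W : R -> T -> 'cV[R]_m) (V : R -> T -> 'cV[R]_p).
Variables (X : R -> T -> 'cV[R]_n) (Y : R -> T -> 'cV[R]_p).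
Hypotheses (hW : wiener mu W) (hV : wiener mu V).
Hypothesis hXY : signal_observation mu A B C W V X Y.
Hypothesis hindep : independent3 mu (sigma_process [set 0] X)
  (sigma_process `[0, +oo[ W) (sigma_process `[0, +oo[ V).
Variables (x0 z0 : 'cV[R]_n) (P S : R -> 'M[R]_n) (Xhat Z : R -> T -> 'cV[R]_n).
Hypothesis hXhat : forall t, 0 <= t ->
  cond_expectation mu (sigma_process `[0, t] Y) (X t) (Xhat t).
Hypothesis mXhat : forall t, 0 <= t -> random_vector (Xhat t).
Hypothesis Xhat0 : \forall w \ae mu, Xhat 0 w = x0.
Hypothesis hP : error_covariance mu X Xhat P.
Hypothesis hS : mcurve S (fun t => ricc A B C (S t)).
Hypothesis hZ : kalman_solution mu A C Y S z0 Z.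

Let mX t : 0 <= t -> random_vector (X t).
Proof. by case: hXY => -[+ _] _ _ _ => h; exact: h. Qed.

Let mZ t : 0 <= t -> random_vector (Z t).
Proof. by case: hZ => -[+ _] _ _ => h; exact: h. Qed.

Let mY t : 0 <= t -> random_vector (Y t).
Proof. by case: hXY => _ [+ _] _ _ => h; exact: h. Qed.

(** The second moment of X_0 about z0, a wrong mean. *)
Definition start_moment := P 0 + (x0 - z0) *m (x0 - z0)^T.

(** The filter starts at the constant x0, so X_0 - z0 is the initial error of the
    optimal filter, centered, plus the constant x0 - z0. *)
Lemma start_momentP u : isq mu (fun w => dotv u (X 0 w - z0)) /\
  ip mu (fun w => dotv u (X 0 w - z0)) (fun w => dotv u (X 0 w - z0))
  = dotv u (start_moment *m u).
Proof.
have cov i j := covariance_ip i j (lexx 0) (mX (lexx 0)) (mXhat (lexx 0)) hP.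
have [sg gg] := ip_dotv u (fun i => (cov i i).1) (fun i j => (cov i j).2).
set g := fun w => dotv u _ in sg gg; pose c := dotv u (x0 - z0).
have g0 : ex mu g = 0.
  rewrite /g; under [X in ex _ X]eq_fun do rewrite dotvE.
  rewrite ex_sum => [|i]; last by apply: isqZ; exact: (cov i i).1.
  apply: big1 => i _; rewrite exZ; last exact: isq_itg (cov i i).1.
  rewrite /ex (cond_orth i (hXhat (lexx 0)) measurableT) ?mulr0//.
  have [_ _ meas _] := hXhat (lexx 0) i.
  by have := meas setT measurableT; rewrite preimage_setT.
have sc : isq mu (fun=> c) := isq_cst mu c.
have gc : ip mu g (fun=> c) = 0.
  by rewrite ipC /ip exZ ?g0 ?mulr0//; exact: isq_itg.
have mf : measurable_fun setT (fun w => dotv u (X 0 w - z0)).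
  apply: measurable_dotv; apply: random_vectorB; first exact: mX.
  by move=> i; exact: measurable_cst.
have fg : {ae mu, forall w, g w + c = dotv u (X 0 w - z0)}.
  by apply: filterS Xhat0 => w e; rewrite /g/c -dotvDr e addrA subrK.
have mom : ip mu (fun w => g w + c) (fun w => g w + c) = dotv u (start_moment *m u).
  rewrite (ip_add_orth sg sc gc) gg mulmxDl dotvDr; congr (_ + _).
  by rewrite /ip ex_cst -mulmxA dotvC dotv_mull dotvE big_ord1 /c dotvC.
split; last first.
  rewrite -mom; apply: ex_ae_eq.
  - exact: measurable_funM.
  - by apply: measurable_funM; exact: (isq_meas (isqD sg sc)).
  - by apply: filterS fg => w <-.
have cfg : {ae mu, forall w, (g w + c) @[N --> \oo] --> dotv u (X 0 w - z0)}.
  by apply: filterS fg => w <-; exact: cvg_cst.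
by have [] := fatou_ip (fun=> isqD sg sc) mf cfg (fun=> lexx _) (cvg_cst _).
Qed.

Variable Psi : R -> 'M[R]_n.
Hypothesis fP : inverse_flow (fun t => closed_loop A C (S t)) Psi.
Hypothesis S0sym : (S 0)^T = S 0.

(** The gap is an almost sure limit of variables determined by the observation up
    to time t, and the error of the optimal filter integrates to 0 over the
    events of that sigma-algebra. *)
Lemma gap_orth t i : 0 < t -> isq mu (fun w => (X t w - Z t w) i 0) ->
  isq mu (fun w => (Xhat t w - Z t w) i 0) /\
  ip mu (fun w => (Xhat t w - Z t w) i 0) (fun w => (X t w - Xhat t w) i 0) = 0.
Proof.
move=> t0 sE; have t0' := ltW t0.
have [se _] := covariance_ip i i t0' (mX t0') (mXhat t0') hP.
have sD : isq mu (fun w => (Xhat t w - Z t w) i 0).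
  rewrite (_ : (fun w => _) = fun w => (X t w - Z t w) i 0 - (X t w - Xhat t w) i 0).
    exact: isqB.
  by apply/funext => w; rewrite !mxE; ring.
split=> //.
pose L N w := (invmx (Psi t) *m (z0
  + mnode_sum (fun s => Psi s *m gain C S s) (fun s => Y s w) t N)) i 0.
have [_ _ aXhat _] := hXhat t0' i.
have aL N : adapted (sigma_process `[0, t] Y) (L N).
  rewrite /L; under [X in adapted _ X]eq_fun do rewrite mxE.
    apply: adapted_sum => j; apply: adaptedM; first exact: adapted_cst.
  under [X in adapted _ X]eq_fun do rewrite mxE.
  apply: adaptedD; first exact: adapted_cst.
  under [X in adapted _ X]eq_fun do rewrite mnode_sumE /node_sum.
  apply: adapted_sum => k; under [X in adapted _ X]eq_fun do rewrite big_mkord.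
  apply: adapted_sum => l; apply: adaptedM; first exact: adapted_cst.
  by apply: adaptedB; apply: sigma_process_coord;
    rewrite /= in_itv/= node_ge0//= -[leRHS](node_last t N) node_le// ltnW.
have aXN N : adapted (sigma_process `[0, t] Y) (fun w => Xhat t w i 0 - L N w).
  by apply: adaptedB => // U mU; exact: aXhat.
have mXN N : measurable_fun setT (fun w => Xhat t w i 0 - L N w).
  apply: measurable_funB; first exact: mXhat.
  rewrite /L; under eq_fun do rewrite mxE.
  apply: measurable_sum => j; apply: measurable_funM; first exact: measurable_cst.
  under eq_fun do rewrite mxE.
  apply: measurable_funD; first exact: measurable_cst.
  exact: random_vector_mnode_sum.
apply: (orth_limit sD se mXN).
  have := filter_limit hV hXY hS hZ fP i t0'.
  apply: filterS => w cL; rewrite !mxE.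
  by apply: cvgB; [exact: cvg_cst|exact: cL].
move=> N U mU; apply: (cond_orth i (hXhat t0')).
  by rewrite -[X in measurable X]setTI; exact: mXN.
exact: aXN.
Qed.

(** Pythagoras: the second moment of the gap is what the error of the filter Z
    has in excess of the optimal error. *)
Lemma gap_moment t i : 0 < t ->
  isq mu (fun w => (Xhat t w - Z t w) i 0) /\
  ip mu (fun w => (Xhat t w - Z t w) i 0) (fun w => (Xhat t w - Z t w) i 0) <=
  (invmx (Psi t) *m (start_moment - S 0) *m (invmx (Psi t))^T) i i
  + (S t i i - P t i i).
Proof.
move=> t0; have t0' := ltW t0.
have [] := error_moment hW hV hXY hS hZ fP hindep
  (fun u => (start_momentP u).1) (fun u => (start_momentP u).2) S0sym
  (delta_mx i 0) t0.
have dE (y : 'cV[R]_n) : dotv (delta_mx i 0) y = y i 0.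
  by rewrite /dotv trmx_delta -rowE mxE.
under [X in isq _ X]eq_fun do rewrite dE.
rewrite (_ : (fun w => dotv _ (X t w - Z t w)) = fun w => (X t w - Z t w) i 0); last first.
  by apply/funext => w; rewrite dE.
rewrite !dE -!colE ![col i _ _ _]mxE => sE momE.
have [sD orth] := gap_orth t0 sE; split=> //.
have [se ee] := covariance_ip i i t0' (mX t0') (mXhat t0') hP.
have := ip_add_orth sD se orth; rewrite ee => eqE.
rewrite addrA lerBrDr -eqE; apply: le_trans momE.
by rewrite le_eqVlt; apply/orP; left; apply/eqP; congr ip;
  apply/funext => w; rewrite !mxE; ring.
Qed.

End TwoFilters.

(** * Convergence *)

(** Pointwise |D| <= e + |D|^2 / e. *)
Lemma ex_enorm_le (d : measure_display) (T : measurableType d) (R : realType)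
    (mu : probability T R) n (D : T -> 'cV[R]_n) (e : R) : 0 < e ->
  (forall i, isq mu (fun w => D w i 0)) ->
  itg mu (fun w => enorm (D w)) /\
  ex mu (fun w => enorm (D w)) <=
    e + e^-1 * \sum_i ip mu (fun w => D w i 0) (fun w => D w i 0).
Proof.
move=> e0 sq; have sqq i : itg mu (fun w => D w i 0 * D w i 0) by exact: isq_mul.
have iq : itg mu (fun w => dotv (D w) (D w)).
  under eq_fun do rewrite dotvE.
  elim: (index_enum _) => [|i s IH]; first by under eq_fun do rewrite big_nil; exact: itg_cst.
  by under eq_fun do rewrite big_cons; exact: itgD.
have exq : ex mu (fun w => dotv (D w) (D w))
    = \sum_i ip mu (fun w => D w i 0) (fun w => D w i 0).
  under [X in ex _ X]eq_fun do rewrite dotvE.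
  elim: (index_enum _) => [|i s IH].
    by rewrite big_nil; under [X in ex _ X]eq_fun do rewrite big_nil; exact: ex_cst.
  rewrite big_cons -IH; under [X in ex _ X]eq_fun do rewrite big_cons.
  rewrite exD//; elim: {IH} s => [|j s IH].
    by under eq_fun do rewrite big_nil; exact: itg_cst.
  by under eq_fun do rewrite big_cons; exact: itgD.
have ib : itg mu (fun w => e + e^-1 * dotv (D w) (D w)).
  by apply: itgD; [exact: itg_cst|exact: itgZ].
have le w : enorm (D w) <= e + e^-1 * dotv (D w) (D w).
  have eq : dotv (D w) (D w) = enorm (D w) ^+ 2 by rewrite sqr_sqrtr ?dotv_ge0.
  rewrite eq -(ler_pM2l e0) mulrDr mulVKf ?gt_eqF//.
  have := sqr_ge0 (e - enorm (D w)); have := sqr_ge0 (e + enorm (D w)); nra.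
have ie : itg mu (fun w => enorm (D w)).
  apply: itg_le ib _.
    by apply: measurable_enorm => i; exact: isq_meas (sq i).
  by move=> w; rewrite ger0_norm ?sqrtr_ge0.
split=> //; apply: le_trans (ex_le ie ib le) _.
rewrite exD ?exZ ?ex_cst ?exq//; first exact: itg_cst.
exact: itgZ.
Qed.

Theorem propositionA2 (R : realType) (d : measure_display)
  (T : measurableType d) (mu : probability T R) (n m p : nat)
  (A : 'M[R]_n) (B : 'M[R]_(n, m)) (C : 'M[R]_(p, n))
  (W : R -> T -> 'cV[R]_m) (V : R -> T -> 'cV[R]_p)
  (X : R -> T -> 'cV[R]_n) (Y : R -> T -> 'cV[R]_p)
  (x0 x0' : 'cV[R]_n) (P0 P0' : 'M[R]_n)
  (Xhat Xhat' : R -> T -> 'cV[R]_n) (P P' : R -> 'M[R]_n)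
  (* the model *)
  (hW : wiener mu W) (hV : wiener mu V)
  (hX0 : gaussian_vector mu (X 0) x0 P0)
  (hindep : independent3 mu (sigma_process [set 0] X)
              (sigma_process `[0, +oo[ W) (sigma_process `[0, +oo[ V))
  (hXY : signal_observation mu A B C W V X Y)
  (* the filter and its error covariance *)
  (hXhat : forall t, 0 <= t ->
     cond_expectation mu (sigma_process `[0, t] Y) (X t) (Xhat t))
  (hP : error_covariance mu X Xhat P)
  (hXhat_eq : kalman_solution mu A C Y P x0 Xhat)
  (hP_eq : riccati_solution A B C P0 P)
  (* the wrongly initialized filter *)
  (hXhat'_eq : kalman_solution mu A C Y P' x0' Xhat')
  (hP'_eq : riccati_solution A B C P0' P')
  (* the hypotheses of the proposition *)
  (hdet : detectable A C) (hP0 : pos_def P0) (hP0' : pos_def P0') :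
  exists Pinf : 'M[R]_n,
    [/\ P t @[t --> +oo] --> Pinf,
        P' t @[t --> +oo] --> Pinf &
        ('E_mu[fun w => enorm (Xhat t w - Xhat' t w)%R])%E @[t --> +oo]
          --> 0%E].
Proof.
have [cP cP'] := (riccati_curve hP_eq, riccati_curve hP'_eq).
have P00 : P 0 = P0 by case: hP_eq.
have P'00 : P' 0 = P0' by case: hP'_eq.
have pos0 : pos_def (P 0) by rewrite P00.
have pos0' : pos_def (P' 0) by rewrite P'00.
have diff i j : P t i j - P' t i j @[t --> +oo] --> (0 : R).
  exact: riccati_diff_decay hdet cP pos0 cP' pos0'.
have [Pinf cvP] := riccati_cvg hdet cP pos0.
exists Pinf; split.
- exact: mx_cvg.
- apply: mx_cvg => i j; rewrite -[Pinf i j]subr0.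
  rewrite (_ : (fun t => P' t i j) = fun t => P t i j - (P t i j - P' t i j)).
    by apply: cvgB.
  by apply/funext => t; rewrite subKr.
have [Psi fP] := riccati_inverse_flow cP'.
have [[mXhat _] Xhat0 _] := hXhat_eq.
have gap t i := gap_moment hW hV hXY hindep hXhat mXhat Xhat0 hP cP' hXhat'_eq
  fP pos0'.1 i (t := t).
pose D t w := Xhat t w - Xhat' t w.
pose b t := \sum_i ((invmx (Psi t) *m (start_moment x0 x0' P - P' 0)
  *m (invmx (Psi t))^T) i i + (P' t i i - P t i i)).
have b0 : b t @[t --> +oo] --> (0 : R).
  have fdecay i j : invmx (Psi t) i j @[t --> +oo] --> (0 : R).
    exact: (flow_entry_decay cP' erefl pos0' hdet fP).
  apply: cvgr_sum0 => i; rewrite -[0]addr0; apply: cvgD; first exact: conj_decay.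
  rewrite -[0]oppr0; under eq_fun do rewrite -opprB.
  by apply: cvgN; exact: diff.
have bound t e : 0 < t -> 0 < e -> itg mu (fun w => enorm (D t w)) /\
    ex mu (fun w => enorm (D t w)) <= e + e^-1 * b t.
  move=> t0 e0; have [i1 i2] := ex_enorm_le e0 (fun i => (gap t i t0).1).
  split=> //; apply: le_trans i2 _; rewrite lerD2l ler_pM2l ?invr_gt0//.
  by apply: ler_sum => i _; exact: (gap t i t0).2.
have expE t : 0 < t ->
    ('E_mu[fun w => enorm (D t w)] = (ex mu (fun w => enorm (D t w)))%:E)%E.
  by move=> t0; rewrite unlock; apply: ex_EFin; case: (bound t 1 t0 ltr01).
apply: cvg_EFin.
  near=> t; rewrite expE//.
apply/cvgrPdist_lt => e e0; have e3 : 0 < e / 3 by rewrite divr_gt0.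
near=> t.
have t0 : 0 < t by near: t; exact: nbhs_pinfty_gt.
rewrite sub0r normrN /= expE//= ger0_norm; last first.
  by rewrite -(ex_cst mu 0); apply: ex_le (itg_cst mu 0) (bound t 1 t0 ltr01).1 _ => w; exact: sqrtr_ge0.
apply: le_lt_trans (bound t _ t0 e3).2 _.
have bt : b t < (e / 3) ^+ 2.
  apply: le_lt_trans (ler_norm _) _.
  near: t; move/cvgrPdist_lt: b0 => /(_ _ (exprn_gt0 2 e3)).
  by apply: filterS => t; rewrite sub0r normrN.
have : (e / 3)^-1 * b t < e / 3 by rewrite ltr_pdivrMl// -expr2.
lra.
Unshelve. all: by end_near. Qed.
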